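(* Let $p\in(1,\infty]$, $\rho\in L^p(0,1)$ with $\rho(x)>0$ for a.e. $x\in(0,1)$, $T>0$, $\tau\in(0,T)$, and $(\alpha_0,\beta_0),(\alpha_1,\beta_1)\in\mathbb{R}^2\setminus\{(0,0)\}$. Let $u_0\in L^2_\rho$ be decomposed as $u_0=\sum_{n\ge0}c_ne_n$ in $L^2_\rho$ (with $\sum_{n\ge 0}|c_n|^2<\infty$), let $s\in(1,2-\frac1p)$, let $\varphi\in G^s([0,2T])$ be such that $\varphi(t)=1$ for $t\le\tau$ and $\varphi(t)=0$ for $t\ge T$, and let $$y(t):=\varphi(t)\sum_{n\ge0}c_n\zeta_ne^{-\lambda_nt},\qquad t\in[\tau,T].$$ Then $y\in G^s([\tau,T])$, and the control $$h(t)=\begin{cases}0&\text{if }0\le t\le\tau,\\ \sum_{i\ge0}y^{(i)}(t)\big(\alpha_1g_i(1)+\beta_1g_i'(1)\big)&\text{if }\tau<t\le T\end{cases}$$ is such that the solution $u$ of $$u_{xx}-\rho(x)u_t=0,\quad x\in(0,1),\ t\in(0,T),$$ $$\alpha_0u(0,t)+\beta_0u_x(0,t)=0,\quad t\in(0,T),$$ $$\alpha_1u(1,t)+\beta_1u_x(1,t)=h(t),\quad t\in(0,T),$$ $$u(x,0)=u_0(x),\quad x\in(0,1),$$ satisfies $u(\cdot,T)=0$. Moreover $u$ is given by $$u(x,t)=\begin{cases}\sum_{n\ge0}c_ne^{-\lambda_nt}e_n(x)&\text{if }0\le t\le\tau,\\ \sum_{i\ge0}y^{(i)}(t)g_i(x)&\text{if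 }\tau<t\le T,\end{cases}$$ $h\in G^s([0,T])$, and $u\in C([0,T],L^2_\rho)\cap G^s([\varepsilon,T],W^{2,p}(0,1))$ for all $0<\varepsilon<T$.
   Context: Convention: $1/p=0$ when $p=\infty$. $L^2_\rho:=\{f:(0,1)\to\mathbb{R};\ \|f\|_{L^2_\rho}^2:=\int_0^1|f(x)|^2\rho(x)\,dx<\infty\}$. Gevrey classes: for a Banach space $E$, $t_1<t_2$ and $s\ge0$, $G^s([t_1,t_2],E)$ is the class of $u\in C^\infty([t_1,t_2],E)$ for which there exist constants $M,R>0$ with $\|u^{(k)}(t)\|_E\le M\,(k!)^s/R^k$ for all $t\in[t_1,t_2]$ and all integers $k\ge0$; $G^s([t_1,t_2])=G^s([t_1,t_2],\mathbb{R})$. Eigenfunctions: $(e_n)_{n\ge0}$ is an orthonormal basis of $L^2_\rho$ and $(\lambda_n)_{n\ge0}$ a strictly increasing real sequence such that, for all $n$, $e_n\in W^{2,p}(0,1)$, $-e_n''=\lambda_n\rho e_n$ in $(0,1)$, $\alpha_0e_n(0)+\beta_0e_n'(0)=0$, $\alpha_1e_n(1)+\beta_1e_n'(1)=0$ (such sequences exist). Generating functions: $g_0$ is the solution of $g_0''=0$ in $(0,1)$, $\alpha_0g_0(0)+\beta_0g_0'(0)=0$, $\beta_0g_0(0)-\alpha_0g_0'(0)=1$; for $i\ge1$, $g_i$ is the solution of $g_i''=\rho g_{i-1}$ in $(0,1)$, $g_i(0)=g_i'(0)=0$. Coefficients: $\zeta_n:=\beta_0e_n(0)-\alpha_0e_n'(0)$;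 these are the real numbers with $e_n=\zeta_n\sum_{i\ge0}(-\lambda_n)^ig_i$ in $W^{2,p}(0,1)$. Solution: a function $u\in C([0,T],L^2_\rho)\cap C^1((0,T],W^{2,p}(0,1))$ with $u(\cdot,0)=u_0$ such that for every $t\in(0,T)$ the equation holds a.e. in $(0,1)$ and the boundary conditions hold pointwise. *)

(* Defs.v *)
From HB Require Import structures.
From mathcomp Require Import all_boot all_order all_algebra.
From mathcomp Require Import all_classical all_reals all_analysis.

Set Implicit Arguments.
Unset Strict Implicit.
Unset Printing Implicit Defensive.

Import Order.TTheory GRing.Theory Num.Theory.
Import numFieldNormedType.Exports.

Local Open Scope classical_set_scope.
Local Open Scope ring_scope.

(* Derivatives taken inside a set: they are one-sided at the endpoints of an
   interval, and only the values of the function on the set matter. *)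
Section DerivativeWithin.
Variable R : realType.
Implicit Types (D : set R) (f : R -> R) (x : R).

Definition derivable_within D f x : Prop :=
  cvg ((fun y => (f y - f x) / (y - x)) @ within D x^').

Definition deriv_within D f x : R :=
  lim ((fun y => (f y - f x) / (y - x)) @ within D x^').

Definition nderiv_within (i : nat) D f : R -> R := iter i (deriv_within D) f.

Definition D01 f x : R := deriv_within `[0, 1] f x.

End DerivativeWithin.

(* Regularity of functions of time with values in a normed space, given as a
   subspace E of an ambient vector space V with a norm N on E.  N may be a
   seminorm at the level of representatives. *)
Section VectorValued.
Variables (R : realType) (V : lmodType R) (E : set V) (N : V -> R).
Implicit Types (D : set R) (u v : R -> V) (s a b : R).

Definition continuous_in D u : Prop :=
  (forall t, D t -> E (u t)) /\
  (forall t, D t -> (fun r => N (u r - u t)) @ within D (nbhs t) --> (0 : R)).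

Definition has_derivative_in D u v : Prop :=
  [/\ forall t, D t -> E (u t),
      forall t, D t -> E (v t) &
      forall t, D t ->
        (fun r => N ((r - t)^-1 *: (u r - u t) - v t)) @ within D t^'
          --> (0 : R)].

Definition C1_in D u v : Prop :=
  [/\ continuous_in D u, continuous_in D v & has_derivative_in D u v].

(* G^s([a, b], E); U is the sequence of successive derivatives of u. *)
Definition gevrey s a b u : Prop :=
  exists U : nat -> R -> V,
    [/\ U 0%N = u,
        forall k, has_derivative_in `[a, b] (U k) (U k.+1) &
        exists M r : R, [/\ 0 < M, 0 < r &
          forall k t, `[a, b]%classic t ->
            N (U k t) <= M * (k`!%:R `^ s) / r ^+ k]].

End VectorValued.

Definition gevreyR (R : realType) (s a b : R) (f : R -> R) : Prop :=
  @gevrey R R^o setT (fun x => `|x|) s a b f.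

Section Spaces.
Variable R : realType.
Local Notation mu := (@lebesgue_measure R).
Local Notation I01 := (`]0%R, 1%R[%classic : set R).
Implicit Types (p : \bar R) (rho f g : R -> R).

Definition restr01 f : R -> R := f \_ I01.

Definition Lp01 p f : Prop := restr01 f \in Lfun mu p.

Definition Lp01_norm p f : R := fine ('N[mu]_p [EFin \o restr01 f])%E.

Definition L2rho rho : set (R -> R^o) := [set f : R -> R |
  measurable_fun I01 f /\
  (\int[mu]_(x in I01) (`|f x| ^+ 2 * rho x)%:E < +oo)%E].

Definition L2rho_dot rho f g : R :=
  \int[mu]_(x in I01) (f x * g x * rho x).

Definition L2rho_norm rho (f : R -> R^o) : R :=
  Num.sqrt (\int[mu]_(x in I01) (`|f x| ^+ 2 * rho x)).

Definition L2rho_series rho (c : nat -> R) (e : nat -> R -> R) f : Prop :=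
  (fun n => L2rho_norm rho (fun x => f x - \sum_(k < n) c k * e k x)) @ \oo
    --> (0 : R).

(* On an interval, an integrable g is the second derivative of f in the sense
   of distributions iff f (up to a null set) is C^1 on [0, 1] and f' is an
   indefinite integral of g.  We always work with that C^1 representative, so
   that f(0), f'(0), f(1), f'(1) make sense. *)
Definition is_second_derivative f g : Prop :=
  [/\ forall x, `[0, 1]%classic x -> derivable_within `[0, 1] f x,
      mu.-integrable I01 (EFin \o g) &
      forall x, `[0, 1]%classic x ->
        D01 f x = D01 f 0 + \int[mu]_(z in `[0, x]) g z].

(* Determined up to a null set when some g satisfies is_second_derivative f g,
   in particular on W^{2,p}(0, 1). *)
Definition D2 f : R -> R := xget (fun _ => 0) [set g | is_second_derivative f g].

(* f and f', being continuous on [0, 1], are automatically in L^p(0, 1). *)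
Definition W2p p : set (R -> R^o) := [set f : R -> R |
  exists g, is_second_derivative f g /\ Lp01 p g].

Definition W2p_norm p (f : R -> R^o) : R :=
  Lp01_norm p f + Lp01_norm p (D01 f) + Lp01_norm p (D2 f).

Definition ae01 (P : R -> Prop) : Prop :=
  {ae mu, forall x, I01 x -> P x}.

End Spaces.

Section Problem.
Variable R : realType.
Variables (p : \bar R) (rho : R -> R).
Variables alpha0 beta0 alpha1 beta1 : R.

Definition orthonormal_basis (e : nat -> R -> R) : Prop :=
  [/\ forall n, L2rho rho (e n),
      forall m n, L2rho_dot rho (e m) (e n) = (m == n)%:R &
      forall f, L2rho rho f -> forall eps : R, 0 < eps ->
        exists (n : nat) (a : nat -> R),
          L2rho_norm rho (fun x => f x - \sum_(k < n) a k * e k x) < eps].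

Definition eigenpair (lam : R) (e : R -> R) : Prop :=
  [/\ W2p p e,
      ae01 (fun x => - D2 e x = lam * rho x * e x),
      alpha0 * e 0 + beta0 * D01 e 0 = 0 &
      alpha1 * e 1 + beta1 * D01 e 1 = 0].

Definition eigenbasis (lam : nat -> R) (e : nat -> R -> R) : Prop :=
  [/\ orthonormal_basis e,
      {homo lam : m n / (m < n)%N >-> m < n} &
      forall n, eigenpair (lam n) (e n)].

Definition generating_functions (g : nat -> R -> R) : Prop :=
  [/\ forall i, W2p p (g i),
      [/\ ae01 (fun x => D2 (g 0%N) x = 0),
          alpha0 * g 0%N 0 + beta0 * D01 (g 0%N) 0 = 0 &
          beta0 * g 0%N 0 - alpha0 * D01 (g 0%N) 0 = 1] &
      forall i, [/\ ae01 (fun x => D2 (g i.+1) x = rho x * g i x),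
                    g i.+1 0 = 0 & D01 (g i.+1) 0 = 0]].

Definition zeta (e : nat -> R -> R) (n : nat) : R :=
  beta0 * e n 0 - alpha0 * D01 (e n) 0.

Definition y_term (lam : nat -> R) (e : nat -> R -> R) (c : nat -> R) (t : R)
    (n : nat) : R :=
  c n * zeta e n * expR (- lam n * t).

Definition flat_output (phi : R -> R) (lam : nat -> R) (e : nat -> R -> R)
    (c : nat -> R) (t : R) : R :=
  phi t * limn (series (y_term lam e c t)).

Definition h_term (tau T : R) (y : R -> R) (g : nat -> R -> R) (t : R)
    (i : nat) : R :=
  nderiv_within i `[tau, T] y t * (alpha1 * g i 1 + beta1 * D01 (g i) 1).

Definition control (tau T : R) (y : R -> R) (g : nat -> R -> R) (t : R) : R :=
  if t <= tau then 0 else limn (series (h_term tau T y g t)).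

(* u t x stands for u(x, t); ut is the time derivative of u. *)
Definition is_solution (T : R) (h u0 : R -> R) (u : R -> R -> R) : Prop :=
  [/\ continuous_in (L2rho rho) (L2rho_norm rho) `[0, T] u,
      ae01 (fun x => u 0 x = u0 x) &
      exists ut : R -> R -> R,
        C1_in (W2p p) (W2p_norm p) `]0, T] u ut /\
        forall t, `]0, T[%classic t ->
          [/\ ae01 (fun x => D2 (u t) x - rho x * ut t x = 0),
              alpha0 * u t 0 + beta0 * D01 (u t) 0 = 0 &
              alpha1 * u t 1 + beta1 * D01 (u t) 1 = h t]].

End Problem.

(* Main.v *)
Require Import Defs.
From HB Require Import structures.
From mathcomp Require Import all_boot all_order all_algebra.
From mathcomp Require Import all_classical all_reals all_analysis.
From mathcomp Require Import measurable_realfun ess_sup_inf.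
From mathcomp Require Import ring lra.
Import Order.TTheory GRing.Theory Num.Theory.
Import numFieldNormedType.Exports.
Local Open Scope classical_set_scope.
Local Open Scope ring_scope.

(** The equation is flat: every solution in play has the form
    u(x, t) = sum_i dy_i(t) g_i(x), where dy_i is the i-th derivative of a scalar
    function y.  Formally this solves rho u_t = u_xx with the left boundary
    condition, because g_(i+1)'' = rho g_i, and the right boundary value of u is
    then the control.  So the theorem is about convergence of such series, about
    the choice of y, and about uniqueness.

    Convergence.  Let nu(x) be the integral of |rho| over [0, x].  Going from g_i
    to g_(i+1) integrates once against nu and once against dx.  Iterating, both
    integrations act on powers of nu(x) and of x and each gains a factor 1/(i+1),
    whence |g_i| <= C K^i / (i!)^2 (lemmas sprim2_growth, iter_growth and
    gen_sprim2_unif).  If y is of Gevrey order s < 2, this beats the growth of dy_i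
    (sqr_fact_dominates, gevrey_sum), and the sum is again of Gevrey order s in
    time.

    The functions of x are handled through sprim2 nu B f f1 w, a list of
    inequalities between values of f, f1, w at two points which says, with a
    constant B, that f' = f1 and df1 = w dnu.  The inequalities survive linear
    combinations and pointwise limits, and B bounds the norm of f in W^{2,p}; so
    differentiation under the sum, in x and in t, reduces to estimates of scalar
    series (flat_fun_sprim2).

    The output.  On (0, tau] the cutoff is 1 and y is the Dirichlet series of the
    numbers c_n zeta_n.  Testing the eigenvalue equation against a fixed function
    with boundary data 1 on the left and 0 on the right expresses zeta_n
    as a combination of two Fourier coefficients with factors of size at most
    1 + |lam_n|, so c_n zeta_n / (1 + |lam_n|) is summable by
    Bessel's inequality (zeta_sum, coef_zeta_sum).  Since m^(k+1) exp(-m t) is at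
    most (k+1)! / t^(k+1), the Dirichlet series is of Gevrey order 1 on every
    [ep, T] (free_output_gevrey), and its product with the cutoff is of order s by
    Leibniz' rule.

    Gluing.  For t <= tau the two summations, over i and over n, may be
    interchanged (flat_sum_expand); as e_n = zeta_n sum_i (-lam_n)^i g_i, the flat
    series is the free evolution of u_0, and its right boundary value vanishes, so
    the control extends by 0 in a Gevrey way.  At t = T all dy_i vanish, so
    u(T) = 0.  Continuity at t = 0 in L^2_rho is Parseval's identity
    (sol_cont0).

    Uniqueness.  If v is the difference of two solutions, Green's formula shows
    that the coefficient of v(t) on e_n satisfies the equation a' = -lam_n a on
    (0, T) and tends to 0 at t = 0, hence vanishes; the basis is complete, so
    v = 0 (solution_unique).  Thus all assertions about an arbitrary solution
    follow from those about the flat series. *)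

(** * Derivatives inside a set *)
Section Calculus.
Set Implicit Arguments. Unset Strict Implicit. Unset Printing Implicit Defensive.
Variable R : realType.
Implicit Types (f : R -> R) (x : R).

Lemma le_of_dyadic (a b d : R) :
  (forall m, a <= b + d / 2 ^+ m) -> a <= b.
Proof.
move=> H; rewrite leNgt; apply/negP => ba.
have [m Hm] : exists m : nat, `|d| / (a - b) < m%:R.
  exists (Num.truncn (`|d| / (a - b))).+1; exact: truncnS_gt.
have ab0 : 0 < a - b by rewrite subr_gt0.
have m2 : (m%:R : R) <= 2 ^+ m.
  by rewrite -natrX ler_nat; apply: ltnW; apply: ltn_expl.
have := H m; apply/negP; rewrite -ltNge -ltrBrDl.
rewrite ltr_pdivrMr ?exprn_gt0//.
rewrite ltr_pdivrMr// in Hm.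
apply: le_lt_trans (ler_norm _) _; apply: lt_le_trans Hm _.
by rewrite mulrC ler_wpM2l// ltW.
Qed.

(** A mean value inequality that asks for no derivative: bisecting
    [x, y] halves the factor y - x of the error while the increments of nu add up,
    so m bisections divide the error by 2^m.  It replaces integration against
    dnu in the estimates below. *)
Lemma dyadic_mvt (a b C : R) (P Psi nu : R -> R) :
  (forall x y, a <= x -> x <= y -> y <= b ->
     `|P y - P x| <= Psi y - Psi x + C * (y - x) * (nu y - nu x)) ->
  forall x y, a <= x -> x <= y -> y <= b -> `|P y - P x| <= Psi y - Psi x.
Proof.
move=> H.
have K m : forall x y, a <= x -> x <= y -> y <= b ->
  `|P y - P x| <= Psi y - Psi x + C * (y - x) * (nu y - nu x) / 2 ^+ m.
  elim: m => [|m IH] x y ax xy yb; first by rewrite expr0 divr1; exact: H.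
  have xc : x <= (x + y) / 2 by lra.
  have cy : (x + y) / 2 <= y by lra.
  have := IH x ((x + y) / 2) ax xc (le_trans cy yb).
  have := IH ((x + y) / 2) y (le_trans ax xc) cy yb.
  set c := (x + y) / 2 => H1 H2.
  rewrite (_ : P y - P x = (P y - P c) + (P c - P x)); last by ring.
  apply: le_trans (ler_normD _ _) _.
  apply: le_trans (lerD H1 H2) _.
  rewrite exprSr invfM.
  have -> : y - c = (y - x) / 2 by rewrite /c; field.
  have -> : c - x = (y - x) / 2 by rewrite /c; field.
  by rewrite le_eqVlt; apply/orP; left; apply/eqP; field; rewrite expf_neq0.
move=> x y ax xy yb; apply: le_of_dyadic => m; exact: K.
Qed.

Lemma cvg_withinP (D : set R) (F : R -> R) (x l : R) :
  F r @[r --> within D x^'] --> l <->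
  forall e, 0 < e -> exists2 d, 0 < d &
    forall y, D y -> y != x -> `|y - x| < d -> `|F y - l| < e.
Proof.
split.
- move/cvgrPdist_lt => H e e0; have := H e e0.
  rewrite near_withinE /dnbhs => /nbhs_ballP [d /= d0 Hd].
  exists d => // y Dy yx yd; rewrite distrC; apply: (Hd y) => //.
  by rewrite -ball_normE /= distrC.
- move=> H; apply/cvgrPdist_lt => e e0; have [d d0 Hd] := H e e0.
  rewrite near_withinE; apply/nbhs_ballP; exists d => //= y.
  rewrite -ball_normE /= => yd yx Dy; rewrite distrC; apply: Hd => //.
  by rewrite distrC.
Qed.

Lemma cvg_within_nbhsP (D : set R) (F : R -> R) (x l : R) :
  F r @[r --> within D (nbhs x)] --> l <->
  forall e, 0 < e -> exists2 d, 0 < d &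
    forall y, D y -> `|y - x| < d -> `|F y - l| < e.
Proof.
split.
- move/cvgrPdist_lt => H e e0; have := H e e0.
  rewrite near_withinE => /nbhs_ballP [d /= d0 Hd].
  exists d => // y Dy yd; rewrite distrC; apply: (Hd y) => //.
  by rewrite -ball_normE /= distrC.
- move=> H; apply/cvgrPdist_lt => e e0; have [d d0 Hd] := H e e0.
  rewrite near_withinE; apply/nbhs_ballP; exists d => //= y.
  rewrite -ball_normE /= => yd Dy; rewrite distrC; apply: Hd => //.
  by rewrite distrC.
Qed.

(** The relational form of [deriv_within], which keeps the value at hand
    and avoids proving existence separately. *)
Definition wderiv (D : set R) f x (l : R) : Prop :=
  (fun y => (f y - f x) / (y - x)) @ within D x^' --> l.

Lemma wderivP D f x l : wderiv D f x l <->
  forall e, 0 < e -> exists2 d, 0 < d &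
    forall y, D y -> `|y - x| < d -> `|f y - f x - l * (y - x)| <= e * `|y - x|.
Proof.
have E y : y != x -> (f y - f x) / (y - x) - l = (f y - f x - l * (y - x)) / (y - x).
  by move=> yx; field; rewrite subr_eq0.
split.
- move/cvg_withinP => H e /H[d d0 Hd]; exists d => // y Dy yd.
  have [->|yx] := eqVneq y x; first by rewrite !subrr mulr0 subr0 normr0 mulr0.
  have := Hd y Dy yx yd; rewrite E// normrM normfV.
  by rewrite ltr_pdivrMr ?normr_gt0 ?subr_eq0// => /ltW.
- move=> H; apply/cvg_withinP => e e0.
  have e20 : 0 < e / 2 by lra.
  have [d d0 Hd] := H _ e20; exists d => // y Dy yx yd.
  have yx0 : 0 < `|y - x| by rewrite normr_gt0 subr_eq0.
  rewrite E// normrM normfV ltr_pdivrMr//.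
  by apply: le_lt_trans (Hd y Dy yd) _; rewrite ltr_pM2r//; lra.
Qed.

(** Makes limits inside [a, b] unique, at the endpoints as well. *)
Lemma wderiv_proper a b x : a < b -> a <= x <= b -> ProperFilter (within `[a, b]%classic x^').
Proof.
move=> ab /andP[ax xb]; apply: Build_ProperFilter_ex => P.
rewrite /within /= /dnbhs /within /= => /nbhs_ballP [d /= d0 Hd].
have Pc y : y != x -> `|y - x| < d -> a <= y <= b -> exists z, P z.
  move=> yx yd /andP[ay yb]; exists y.
  have : ball x d y by rewrite -ball_normE /= distrC.
  by move=> /Hd /(_ yx); apply; rewrite /= in_itv /= ay yb.
have [xlb|xgb] := ltP x b.
  pose m := Num.min (d / 2) ((b - x) / 2).
  have m0 : 0 < m by rewrite /m lt_min; apply/andP; split; lra.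
  have m1 : m <= d / 2 by rewrite /m ge_min lexx.
  have m2 : m <= (b - x) / 2 by rewrite /m ge_min lexx orbT.
  apply: (Pc (x + m)).
  - by rewrite -subr_eq0 addrC addKr gt_eqF.
  - by rewrite addrC addKr gtr0_norm//; lra.
  - by apply/andP; split; lra.
pose m := Num.min (d / 2) ((x - a) / 2).
have m0 : 0 < m by rewrite /m lt_min; apply/andP; split; lra.
have m1 : m <= d / 2 by rewrite /m ge_min lexx.
have m2 : m <= (x - a) / 2 by rewrite /m ge_min lexx orbT.
apply: (Pc (x - m)).
- by rewrite -subr_eq0 addrC addKr oppr_eq0 gt_eqF.
- by rewrite addrC addKr normrN gtr0_norm//; lra.
- by apply/andP; split; lra.
Qed.

Lemma deriv_withinE a b f x l : a < b -> a <= x <= b ->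
  wderiv `[a, b] f x l -> deriv_within `[a, b] f x = l.
Proof.
move=> ab xab H; have PF := wderiv_proper ab xab.
by apply: cvg_lim => //; exact: Rhausdorff.
Qed.

Lemma wderiv_D01 f x : derivable_within `[0, 1] f x ->
  wderiv `[0, 1] f x (D01 f x).
Proof. by []. Qed.

Lemma wderiv_subset (D E : set R) f x l : D `<=` E ->
  wderiv E f x l -> wderiv D f x l.
Proof.
move=> DE /wderivP H; apply/wderivP => e /H[d d0 Hd]; exists d => // y Dy.
by apply: Hd; exact: DE.
Qed.

Lemma mvt_within a b f (f1 : R -> R) :
  (forall x, a <= x <= b -> wderiv `[a, b] f x (f1 x)) ->
  forall x y, a <= x -> x < y -> y <= b ->
  exists2 c, x < c < y & f y - f x = f1 c * (y - x).
Proof.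
move=> H x y ax xy yb.
have [|| c] := @MVT _ f f1 x y xy.
- move=> z /[!in_itv] /= /andP[xz zy].
  have zab : a <= z <= b by rewrite (le_trans ax (ltW xz)) (le_trans (ltW zy) yb).
  have Hz : (fun h => h^-1 *: ((f \o shift z) h - f z)) @ 0^' --> f1 z.
    apply/cvgrPdist_lt => e e0.
    have /cvg_withinP/(_ e e0)[d d0 Hd] := H z zab.
    near=> h.
    have h0 : h != 0 by near: h; exact: nbhs_dnbhs_neq.
    have hd : `|h| < d by near: h; apply: dnbhs0_lt.
    have h1 : `|h| < z - x by near: h; apply: dnbhs0_lt; lra.
    have h2 : `|h| < y - z by near: h; apply: dnbhs0_lt; lra.
    rewrite distrC /=.
    have -> : h^-1 *: (f (h + z) - f z) = (f (h + z) - f z) / ((h + z) - z).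
      by rewrite addrK mulrC.
    apply: Hd.
    - have zh : x < h + z < y.
        move: h1 h2; rewrite !ltr_norml !ltrBrDr => /andP[+ _] /andP[_ ->].
        by rewrite opprB ltrBlDr => ->.
      by case/andP: zh => h3 h4; rewrite /= in_itv /= (le_trans ax (ltW h3)) (le_trans (ltW h4) yb).
    - by rewrite -subr_eq0 addrK.
    - by rewrite addrK.
  have E : (fun h : R => h^-1 *: ((f \o shift z) (h *: (1 : R^o)) - f z)) =
      (fun h => h^-1 *: ((f \o shift z) h - f z)).
    by apply/funext => h; rewrite [h *: _]mulr1.
  apply: DeriveDef.
    by apply/cvg_ex; exists (f1 z); rewrite E.
  by apply: cvg_lim; [exact: Rhausdorff|rewrite E].
- apply/continuous_within_itvP => //.
  have C z : a <= z <= b -> forall e, 0 < e -> exists2 d, 0 < d &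
      forall r, a <= r <= b -> `|r - z| < d -> `|f r - f z| < e.
    move=> zab e e0; have /wderivP/(_ 1 ltr01)[d d0 Hd] := H z zab.
    pose k := `|f1 z| + 1.
    have k0 : 0 < k by rewrite /k ltr_wpDl.
    exists (Num.min d (e / k)); first by rewrite lt_min d0 divr_gt0.
    move=> r rab; rewrite lt_min => /andP[rd rk].
    have : `|f r - f z| <= k * `|r - z|.
      have -> : f r - f z = f r - f z - f1 z * (r - z) + f1 z * (r - z) by ring.
      apply: le_trans (ler_normD _ _) _; rewrite normrM /k mulrDl addrC lerD//.
      by apply: Hd => //; rewrite /= in_itv.
    move/le_lt_trans; apply.
    by rewrite mulrC -ltr_pdivlMr.
  split.
  - move=> z /[!in_itv] /= /andP[xz zy].
    have zab : a <= z <= b by rewrite (le_trans ax (ltW xz)) (le_trans (ltW zy) yb).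
    apply/cvgrPdist_lt => e e0; have [d d0 Hd] := C z zab e e0.
    near=> r; rewrite distrC; apply: Hd.
      have : r \in `]x, y[ by near: r; apply: near_in_itvoo; rewrite in_itv /= xz zy.
      by rewrite in_itv /= => /andP[? ?]; apply/andP; split; lra.
    by rewrite distrC; near: r; exact: (@cvgr_dist_lt _ _ _ (nbhs z) _ id z cvg_id).
  - have zab : a <= x <= b by apply/andP; split; lra.
    apply/cvgrPdist_lt => e e0; have [d d0 Hd] := C x zab e e0.
    near=> r; have xr : x < r by near: r; exact: nbhs_right_gt.
    have ry : r < y by near: r; exact: nbhs_right_lt.
    rewrite distrC; apply: Hd; first by apply/andP; split; lra.
    by rewrite gtr0_norm ?subr_gt0// ltrBlDl; near: r; apply: nbhs_right_lt; lra.
  - have zab : a <= y <= b by apply/andP; split; lra.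
    apply/cvgrPdist_lt => e e0; have [d d0 Hd] := C y zab e e0.
    near=> r; have xr : x < r by near: r; exact: nbhs_left_gt.
    have ry : r < y by near: r; exact: nbhs_left_lt.
    rewrite distrC; apply: Hd; first by apply/andP; split; lra.
    by rewrite distrC gtr0_norm ?subr_gt0// ltrBlDl -ltrBlDr; near: r; apply: nbhs_left_gt; lra.
- rewrite in_itv /= => xcy E; by exists c.
Unshelve. all: by end_near. Qed.

Lemma mvt_bound a b f (f1 : R -> R) M : (forall x, a <= x <= b -> wderiv `[a, b] f x (f1 x)) ->
  (forall x, a <= x <= b -> `|f1 x| <= M) ->
  forall x y, a <= x <= b -> a <= y <= b -> `|f y - f x| <= M * `|y - x|.
Proof.
move=> H HM x y; wlog xy : x y / x <= y.
  move=> W xi yi; have [|/ltW] := leP x y; first by move=> ?; exact: W.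
  by move=> ?; rewrite distrC [`|y - x|]distrC; exact: W.
move=> /andP[x0 x1] /andP[y0 y1].
move: xy; rewrite le_eqVlt => /predU1P[->|xy]; first by rewrite !subrr normr0 mulr0.
have [c /andP[xc cy] ->] := mvt_within H x0 xy y1.
by rewrite normrM ler_wpM2r// HM//; apply/andP; split; lra.
Qed.

Lemma taylor_bound a b f (f1 f2 : R -> R) M :
  (forall x, a <= x <= b -> wderiv `[a, b] f x (f1 x)) ->
  (forall x, a <= x <= b -> wderiv `[a, b] f1 x (f2 x)) ->
  (forall x, a <= x <= b -> `|f2 x| <= M) ->
  forall x y, a <= x <= b -> a <= y <= b ->
  `|f y - f x - (y - x) * f1 x| <= M * `|y - x| ^+ 2.
Proof.
move=> H H1 HM x y xi yi.
have M0 : 0 <= M := le_trans (normr_ge0 _) (HM x xi).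
have L := mvt_bound H1 HM.
have [/andP[x0 x1] /andP[y0 y1]] := (xi, yi).
have [xy|yx|->] := ltgtP x y; last by rewrite !subrr mul0r subr0 normr0 expr0n mulr0.
- have [c /andP[xc cy] ->] := mvt_within H x0 xy y1.
  have ci : a <= c <= b by apply/andP; split; lra.
  rewrite [(y - x) * _]mulrC -mulrBl normrM expr2 mulrA ler_wpM2r//.
  apply: le_trans (L x c xi ci) _; rewrite ler_wpM2l// !gtr0_norm ?subr_gt0//; lra.
- have [c /andP[yc cx] E] := mvt_within H y0 yx x1.
  have ci : a <= c <= b by apply/andP; split; lra.
  have -> : f y - f x - (y - x) * f1 x = (f1 c - f1 x) * (y - x).
    have -> : f y - f x = - (f x - f y) by ring.
    by rewrite E; ring.
  rewrite normrM expr2 mulrA ler_wpM2r//.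
  apply: le_trans (L x c xi ci) _; rewrite ler_wpM2l// distrC [`|y - x|]distrC !gtr0_norm ?subr_gt0//; lra.
Qed.

Lemma wderiv_local (D D' : set R) (f f' : R -> R) x l d : 0 < d ->
  (forall y, D y -> `|y - x| < d -> D' y /\ f y = f' y) -> f x = f' x ->
  wderiv D' f' x l -> wderiv D f x l.
Proof.
move=> d0 E Ex /wderivP H; apply/wderivP => e /H[d' d0' Hd].
exists (Num.min d d'); first by rewrite lt_min d0.
move=> y Dy; rewrite lt_min => /andP[yd yd'].
have [Dy' Ey] := E y Dy yd; rewrite Ey Ex; exact: Hd.
Qed.

Lemma half_le_near (t r : R) : 0 < t -> `|r - t| < t / 2 -> t / 2 <= r.
Proof. by move=> t0; rewrite ltr_norml => /andP[? ?]; lra. Qed.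

End Calculus.

(** * Second primitives with respect to an increasing function *)
Section Primitives.
Set Implicit Arguments. Unset Strict Implicit. Unset Printing Implicit Defensive.
Variable R : realType.

Lemma abs_series_cvg (a : nat -> R) S :
  (forall N, \sum_(i < N) `|a i| <= S) -> cvgn (series a).
Proof.
move=> H; apply: normed_cvg; apply: nondecreasing_is_cvgn.
  by apply/nondecreasing_seqP => n; rewrite /= /series /= big_nat_recr //= lerDl.
exists S => _ [n _ <-]; rewrite /= /series /= big_mkord; exact: H.
Qed.

Lemma abs_series_le (a : nat -> R) S :
  (forall N, \sum_(i < N) `|a i| <= S) -> `|limn (series a)| <= S.
Proof.
move=> H; have C := abs_series_cvg H.
rewrite -lim_norm//; apply: limr_le; first exact: is_cvg_norm.
apply: nearW => n; rewrite /series /= big_mkord.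
by apply: le_trans (ler_norm_sum _ _ _) _; exact: H.
Qed.

Lemma squeeze0 (F H : nat -> R) : (forall n, 0 <= F n) -> (forall n, F n <= H n) ->
  H @ \oo --> (0 : R) -> F @ \oo --> (0 : R).
Proof.
move=> F0 FH HH; apply: (@squeeze_cvgr _ _ _ _ (fun=> 0) H) => //; last exact: cvg_cst.
by apply: nearW => n; rewrite F0 FH.
Qed.

Lemma cvg_abs_le (u : nat -> R) (l b : R) :
  u @ \oo --> l -> (forall n, `|u n| <= b) -> `|l| <= b.
Proof.
move=> ul flat_u; have ul' : `|u n| @[n --> \oo] --> `|l| by exact: cvg_norm.
rewrite -(cvg_lim (@Rhausdorff R) ul'); apply: limr_le; first by apply/cvg_ex; eexists; exact: ul'.
exact: nearW.
Qed.

(** The tangent inequality for the power function: it plays the part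
    of the formula for the integral of nu^i dnu. *)
Lemma pow_convex (a b : R) i : 0 <= a -> a <= b ->
  i.+1%:R * a ^+ i * (b - a) <= b ^+ i.+1 - a ^+ i.+1.
Proof.
move=> a0 ab; elim: i => [|i IH]; first by rewrite !expr1 mulr1 mul1r.
have -> : b ^+ i.+2 - a ^+ i.+2 = b * (b ^+ i.+1 - a ^+ i.+1) + a ^+ i.+1 * (b - a).
  by rewrite !exprS; ring.
have -> : i.+2%:R * a ^+ i.+1 * (b - a) = a * (i.+1%:R * a ^+ i * (b - a)) + a ^+ i.+1 * (b - a).
  by rewrite -(@natr1 R i.+1) !exprS; ring.
rewrite lerD2r.
have H0 : 0 <= b ^+ i.+1 - a ^+ i.+1 by rewrite subr_ge0 lerXn2r// nnegrE// (le_trans a0).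
by apply: le_trans (ler_wpM2l a0 IH) _; rewrite ler_wpM2r.
Qed.

Variable nu : R -> R.

(** Second Stieltjes primitives: f' = f1 and df1 = w dnu, in quantitative
    form.  The errors of the two first-order expansions are bounded by
    B |y - x| |nu y - nu x|, which is what one gets when w is B-Lipschitz.  All
    clauses are non-strict inequalities between values at two points, hence pass
    to pointwise limits. *)
Definition sprim2 (B : R) (f f1 w : R -> R) : Prop :=
  forall x y, 0 <= x <= 1 -> 0 <= y <= 1 ->
  [/\ `|f x| <= B /\ `|f1 x| <= B, `|w x| <= B, `|w y - w x| <= B * `|y - x|,
      `|f y - f x - (y - x) * f1 x| <= B * (`|y - x| * `|nu y - nu x|) &
      `|f1 y - f1 x - w x * (nu y - nu x)| <= B * (`|y - x| * `|nu y - nu x|)].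

Lemma sprim2_ge0 B f f1 w : sprim2 B f f1 w -> 0 <= B.
Proof.
have x0 : 0 <= (0 : R) <= 1 by rewrite lexx ler01.
by move=> /(_ 0 0 x0 x0)[[H _] _ _ _ _]; apply: le_trans (normr_ge0 _) H.
Qed.

Lemma sprim2_ext B f f1 w f' f1' w' :
  (forall x, 0 <= x <= 1 -> [/\ f x = f' x, f1 x = f1' x & w x = w' x]) ->
  sprim2 B f f1 w -> sprim2 B f' f1' w'.
Proof.
move=> E H x y xi yi; have [E1 E2 E3] := E x xi; have [E4 E5 E6] := E y yi.
by rewrite -E1 -E2 -E3 -E4 -E5 -E6; exact: H.
Qed.

Lemma sprim2_le B B' f f1 w : B <= B' -> sprim2 B f f1 w -> sprim2 B' f f1 w.
Proof.
move=> BB H x y xi yi; have [[H1 H2] H3 H4 H5 H6] := H x y xi yi.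
have H0 : forall c d : R, 0 <= d -> c <= B * d -> c <= B' * d.
  by move=> c d d0 /le_trans; apply; rewrite ler_wpM2r.
by split; [split| | | |]; try (by apply: le_trans BB); apply: H0 => //; rewrite mulr_ge0.
Qed.

Lemma sprim2Z B a f f1 w : sprim2 B f f1 w ->
  sprim2 (`|a| * B) (fun x => a * f x) (fun x => a * f1 x) (fun x => a * w x).
Proof.
move=> H x y xi yi; have [[H1 H2] H3 H4 H5 H6] := H x y xi yi.
have K (c d : R) : `|c| <= d -> `|a * c| <= `|a| * d.
  by move=> ?; rewrite normrM ler_wpM2l.
split; [split| | | |]; try exact: K.
- by rewrite -mulrBr -mulrA; exact: K.
- have -> : a * f y - a * f x - (y - x) * (a * f1 x) = a * (f y - f x - (y - x) * f1 x) by ring.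
  by rewrite -mulrA; exact: K.
- have -> : a * f1 y - a * f1 x - a * w x * (nu y - nu x) = a * (f1 y - f1 x - w x * (nu y - nu x)) by ring.
  by rewrite -mulrA; exact: K.
Qed.

Lemma sprim2D B B' f f1 w f' f1' w' : sprim2 B f f1 w -> sprim2 B' f' f1' w' ->
  sprim2 (B + B') (fun x => f x + f' x) (fun x => f1 x + f1' x) (fun x => w x + w' x).
Proof.
move=> H H' x y xi yi; have [[H1 H2] H3 H4 H5 H6] := H x y xi yi.
have [[H1' H2'] H3' H4' H5' H6'] := H' x y xi yi.
have K (c d c' d' : R) : `|c| <= d -> `|c'| <= d' -> `|c + c'| <= d + d'.
  by move=> ? ?; apply: le_trans (ler_normD _ _) _; rewrite lerD.
split; [split| | | |]; try exact: K.
- rewrite (_ : _ - _ = (w y - w x) + (w' y - w' x)); last by ring.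
  by rewrite [(B + B') * _]mulrDl; exact: K.
- rewrite (_ : _ - _ - _ = (f y - f x - (y - x) * f1 x) + (f' y - f' x - (y - x) * f1' x)); last by ring.
  by rewrite [(B + B') * _]mulrDl; exact: K.
- rewrite (_ : _ - _ - _ = (f1 y - f1 x - w x * (nu y - nu x)) + (f1' y - f1' x - w' x * (nu y - nu x))); last by ring.
  by rewrite [(B + B') * _]mulrDl; exact: K.
Qed.

Lemma sprim20 : sprim2 0 (fun=> 0) (fun=> 0) (fun=> 0).
Proof.
by move=> x y _ _; split; [split| | | |]; rewrite ?(mul0r, mulr0, subr0, normr0).
Qed.

Lemma sprim2_sum (B a : nat -> R) f f1 w : (forall i, sprim2 (B i) (f i) (f1 i) (w i)) ->
  forall N, sprim2 (\sum_(i < N) `|a i| * B i) (fun x => \sum_(i < N) a i * f i x)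
    (fun x => \sum_(i < N) a i * f1 i x) (fun x => \sum_(i < N) a i * w i x).
Proof.
move=> H; elim=> [|N IH].
  by rewrite big_ord0; apply: sprim2_ext sprim20 => x _; rewrite !big_ord0.
rewrite big_ord_recr /=.
by apply: sprim2_ext (sprim2D IH (sprim2Z (a N) (H N))) => x _; rewrite !big_ord_recr.
Qed.

Lemma sprim2_lim B (F F1 W : nat -> R -> R) f f1 w :
  (forall n, sprim2 B (F n) (F1 n) (W n)) ->
  (forall x, 0 <= x <= 1 -> [/\ F n x @[n --> \oo] --> f x, F1 n x @[n --> \oo] --> f1 x &
     W n x @[n --> \oo] --> w x]) ->
  sprim2 B f f1 w.
Proof.
move=> H L x y xi yi; have [Lx1 Lx2 Lx3] := L x xi; have [Ly1 Ly2 Ly3] := L y yi.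
split; [split| | | |].
- by apply: cvg_abs_le Lx1 _ => n; case: (H n x y xi yi) => -[].
- by apply: cvg_abs_le Lx2 _ => n; case: (H n x y xi yi) => -[].
- by apply: cvg_abs_le Lx3 _ => n; case: (H n x y xi yi).
- by apply: cvg_abs_le (cvgB Ly3 Lx3) _ => n; case: (H n x y xi yi).
- by apply: cvg_abs_le (cvgB (cvgB Ly1 Lx1) (cvgM (cvg_cst _) Lx2)) _ => n; case: (H n x y xi yi).
- by apply: cvg_abs_le (cvgB (cvgB Ly2 Lx2) (cvgM Lx3 (cvg_cst _))) _ => n; case: (H n x y xi yi).
Qed.

(** The reason for the form of [sprim2]: a series of second primitives
    is one as soon as the bounds are summable, and the sum of the bounds is its
    bound.  No exchange of limit and derivative or integral is involved. *)
Lemma sprim2_series (B a : nat -> R) S f f1 w :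
  (forall i, sprim2 (B i) (f i) (f1 i) (w i)) ->
  (forall N, \sum_(i < N) `|a i| * B i <= S) ->
  sprim2 S (fun x => limn (series (fun i => a i * f i x)))
    (fun x => limn (series (fun i => a i * f1 i x)))
    (fun x => limn (series (fun i => a i * w i x))).
Proof.
move=> H HS.
have C (g : nat -> R -> R) x : (forall i, `|g i x| <= B i) ->
    \sum_(i < n) a i * g i x @[n --> \oo] --> limn (series (fun i => a i * g i x)).
  move=> Hg; have : cvgn (series (fun i => a i * g i x)).
    apply: (@abs_series_cvg _ S) => N; apply: le_trans (HS N).
    by apply: ler_sum => i _; rewrite normrM ler_wpM2l.
  by move=> /cvg_ex[l Hl]; rewrite (cvg_lim (@Rhausdorff R) Hl) -(eq_cvg _ _ (fun n => big_mkord xpredT (fun i => a i * g i x))).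
apply: (@sprim2_lim S (fun N x => \sum_(i < N) a i * f i x)
  (fun N x => \sum_(i < N) a i * f1 i x) (fun N x => \sum_(i < N) a i * w i x)).
  by move=> n; apply: sprim2_le (HS n) _; exact: sprim2_sum.
move=> x xi; split; apply: C => i; by case: (H i x x xi xi) => -[].
Qed.

(** P is an indefinite integral of k dnu.  The error is of the kind
    removed by [dyadic_mvt], so P is determined by k up to a constant. *)
Definition sprim (k P : R -> R) : Prop := exists C, forall x y, 0 <= x <= 1 -> 0 <= y <= 1 ->
  `|P y - P x - k x * (nu y - nu x)| <= C * (`|y - x| * `|nu y - nu x|).

Lemma sprim2_sprim B f f1 w : sprim2 B f f1 w -> sprim w f1.
Proof. by move=> H; exists B => x y xi yi; case: (H x y xi yi). Qed.

Hypothesis nu_homo : forall x y, 0 <= x -> x <= y -> y <= 1 -> nu x <= nu y.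
Hypothesis nu0 : nu 0 = 0.

Lemma nu_ge0 x : 0 <= x <= 1 -> 0 <= nu x.
Proof. by move=> /andP[x0 x1]; rewrite -nu0; exact: nu_homo. Qed.

Lemma sprim_uniq k P Q : sprim k P -> sprim k Q ->
  forall x, 0 <= x <= 1 -> P x - P 0 = Q x - Q 0.
Proof.
move=> [C HC] [D HD] x /andP[x0 x1].
have K := @dyadic_mvt R 0 1 (C + D) (fun z => P z - Q z) (fun=> 0) nu.
suff /K/(_ 0 x (lexx _) x0 x1) : forall x y, 0 <= x -> x <= y -> y <= 1 ->
   `|(P y - Q y) - (P x - Q x)| <= 0 - 0 + (C + D) * (y - x) * (nu y - nu x).
  rewrite subrr normr_le0 => /eqP E; apply/eqP; rewrite -subr_eq0; apply/eqP.
  by rewrite -[RHS]E; ring.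
move=> {x x0 x1} x y x0 xy y1.
have xi : 0 <= x <= 1 by rewrite x0 (le_trans xy).
have yi : 0 <= y <= 1 by rewrite y1 (le_trans x0).
rewrite subrr add0r (_ : _ - _ = (P y - P x - k x * (nu y - nu x)) - (Q y - Q x - k x * (nu y - nu x))); last by ring.
apply: le_trans (ler_normB _ _) _.
have := lerD (HC x y xi yi) (HD x y xi yi).
rewrite [`|y - x|]ger0_norm ?subr_ge0// [`|nu y - nu x|]ger0_norm ?subr_ge0 ?nu_homo//.
by rewrite -mulrDl mulrA.
Qed.

Lemma dist01_le1 x y : 0 <= x <= 1 -> 0 <= y <= 1 -> `|y - x| <= 1 :> R.
Proof. by move=> /andP[? ?] /andP[? ?]; rewrite ler_norml; apply/andP; split; lra. Qed.

Lemma sprim2_f1_lip B f f1 w x y : sprim2 B f f1 w -> 0 <= x <= 1 -> 0 <= y <= 1 ->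
  `|f1 y - f1 x| <= 2 * B * `|nu y - nu x|.
Proof.
move=> H xi yi; have B0 := sprim2_ge0 H; case: (H x y xi yi) => _ Hw _ _ H1.
rewrite (_ : _ - _ = (f1 y - f1 x - w x * (nu y - nu x)) + w x * (nu y - nu x)); last by ring.
apply: le_trans (ler_normD _ _) _; rewrite normrM.
have : B * (`|y - x| * `|nu y - nu x|) <= B * `|nu y - nu x|.
  by rewrite ler_wpM2l// ler_piMl// dist01_le1.
have : `|w x| * `|nu y - nu x| <= B * `|nu y - nu x| by rewrite ler_wpM2r.
lra.
Qed.

(** Green's formula in differential form,
    d(f h' - h f') = (f v - h w) dnu: the terms f1 h1 dx cancel up to errors of
    second order. *)
Lemma green_sprim B C f f1 w h h1 v : sprim2 B f f1 w -> sprim2 C h h1 v ->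
  sprim (fun x => f x * v x - h x * w x) (fun x => f x * h1 x - h x * f1 x).
Proof.
move=> Hf Hh; exists (8 * (B * C)) => x y xi yi.
have B0 := sprim2_ge0 Hf; have C0 := sprim2_ge0 Hh.
have Lf := sprim2_f1_lip Hf xi yi; have Lh := sprim2_f1_lip Hh xi yi.
have [[fx f1x] _ _ Ef Ef1] := Hf x y xi yi.
have [[hx h1x] _ _ Eh Eh1] := Hh x y xi yi.
have [[_ f1y] _ _ _ _] := Hf y x yi xi.
have [[_ h1y] _ _ _ _] := Hh y x yi xi.
move: Ef Ef1 Eh Eh1.
set d := y - x; set D := nu y - nu x.
set ef := (X in `|X| <= B * _); set ef1 := (X in _ -> `|X| <= B * _ -> _).
set eh := (X in _ -> _ -> `|X| <= C * _ -> _); set eh1 := (X in _ -> _ -> _ -> `|X| <= C * _ -> _).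
move=> Ef Ef1 Eh Eh1.
have -> : f y * h1 y - h y * f1 y - (f x * h1 x - h x * f1 x) - (f x * v x - h x * w x) * D =
   (f x * eh1 + h1 y * ef) - (h x * ef1 + f1 y * eh) + d * (f1 x * (h1 y - h1 x) - h1 x * (f1 y - f1 x)).
  by rewrite /ef /eh /ef1 /eh1 /d /D; ring.
have M (p q r s : R) : `|p| <= r -> `|q| <= s -> `|p * q| <= r * s.
  by move=> ? ?; rewrite normrM ler_pM.
set E := `|d| * `|D| in Ef Ef1 Eh Eh1 *.
have T1 := M _ _ _ _ fx Eh1. have T2 := M _ _ _ _ h1y Ef.
have T3 := M _ _ _ _ hx Ef1. have T4 := M _ _ _ _ f1y Eh.
have T5 := M _ _ _ _ f1x Lh. have T6 := M _ _ _ _ h1x Lf.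
have T7 : `|d * (f1 x * (h1 y - h1 x) - h1 x * (f1 y - f1 x))| <= 4 * (B * C) * E.
  rewrite normrM /E (_ : 4 * _ * _ = `|d| * (B * (2 * C * `|D|) + C * (2 * B * `|D|))); last by ring.
  by rewrite ler_wpM2l//; apply: le_trans (ler_normB _ _) _; rewrite lerD.
apply: le_trans (ler_normD _ _) _.
rewrite (_ : 8 * _ * _ = ((B * (C * E) + C * (B * E)) + (C * (B * E) + B * (C * E))) + 4 * (B * C) * E); last by ring.
apply: lerD => //; apply: le_trans (ler_normB _ _) _.
by apply: lerD; apply: le_trans (ler_normD _ _) _; apply: lerD.
Qed.

(** One step of the iteration behind the bound by 1 / (i!)^2.  For
    fixed Y, the integral of M Y^i nu^i dnu gives f1 the factor 1/(i+1), and
    then the integral of x^i dx gives f the same factor again. *)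
Lemma sprim2_growth B f f1 w M i : sprim2 B f f1 w -> f 0 = 0 -> f1 0 = 0 -> 0 <= M ->
  (forall x, 0 <= x <= 1 -> `|w x| <= M * (x ^+ i * nu x ^+ i)) ->
  forall x, 0 <= x <= 1 ->
   `|f1 x| <= M * (x ^+ i * nu x ^+ i.+1) / i.+1%:R /\
   `|f x| <= M * (x ^+ i.+1 * nu x ^+ i.+1) / i.+1%:R ^+ 2.
Proof.
move=> H f0 f10 M0 Hw.
have i0 : (0 : R) < i.+1%:R by [].
have in0 : (i.+1%:R : R) != 0 by rewrite gt_eqF.
have P1 Y : 0 <= Y <= 1 -> `|f1 Y| <= M * (Y ^+ i * nu Y ^+ i.+1) / i.+1%:R.
  move=> /andP[Y0 Y1].
  pose Psi z := M * (Y ^+ i * nu z ^+ i.+1) / i.+1%:R.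
  have : `|f1 Y - f1 0| <= Psi Y - Psi 0.
    apply: (@dyadic_mvt _ 0 Y B _ _ nu) => // x y x0 xy yY.
    have xi : 0 <= x <= 1 by rewrite x0 (le_trans xy)// (le_trans yY).
    have yi : 0 <= y <= 1 by rewrite (le_trans x0 xy) (le_trans yY).
    have [_ _ _ _ H1] := H x y xi yi.
    have nxy : nu x <= nu y by apply: nu_homo => //; case/andP: yi.
    rewrite (_ : f1 y - f1 x = w x * (nu y - nu x) + (f1 y - f1 x - w x * (nu y - nu x))); last by ring.
    apply: le_trans (ler_normD _ _) _.
    rewrite [`|y - x|]ger0_norm ?subr_ge0// [`|nu y - nu x|]ger0_norm ?subr_ge0// in H1.
    apply: lerD; last by rewrite -mulrA.
    rewrite normrM [`|nu y - nu x|]ger0_norm ?subr_ge0//.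
    have : `|w x| <= M * (Y ^+ i * nu x ^+ i).
      apply: le_trans (Hw x xi) _; rewrite ler_wpM2l// ler_wpM2r ?exprn_ge0 ?nu_ge0//.
      by rewrite lerXn2r// ?nnegrE// (le_trans xy).
    have d0 : 0 <= nu y - nu x by rewrite subr_ge0.
    move=> /(ler_wpM2r d0) /le_trans; apply.
    rewrite /Psi -!mulrBl -!mulrBr.
    rewrite -!mulrA ler_wpM2l// ler_wpM2l ?exprn_ge0// ler_pdivlMr//.
    by apply: le_trans (pow_convex i (nu_ge0 xi) nxy); rewrite le_eqVlt; apply/orP; left; apply/eqP; ring.
  by rewrite f10 subr0 /Psi nu0 expr0n /= mulr0 mulr0 mul0r subr0.
move=> Y Yi; split; first exact: P1.
case/andP: (Yi) => Y0 Y1.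
pose Psi z := M * (z ^+ i.+1 * nu Y ^+ i.+1) / i.+1%:R ^+ 2.
have : `|f Y - f 0| <= Psi Y - Psi 0.
  apply: (@dyadic_mvt _ 0 Y B _ _ nu) => // x y x0 xy yY.
  have xi : 0 <= x <= 1 by rewrite x0 (le_trans xy)// (le_trans yY).
  have yi : 0 <= y <= 1 by rewrite (le_trans x0 xy) (le_trans yY).
  have [_ _ _ H1 _] := H x y xi yi.
  have nxy : nu x <= nu y by apply: nu_homo => //; case/andP: yi.
  have nxY : nu x <= nu Y by apply: nu_homo => //; apply: le_trans yY.
  rewrite (_ : f y - f x = f1 x * (y - x) + (f y - f x - (y - x) * f1 x)); last by ring.
  apply: le_trans (ler_normD _ _) _.
  rewrite [`|y - x|]ger0_norm ?subr_ge0// [`|nu y - nu x|]ger0_norm ?subr_ge0// in H1.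
  apply: lerD; last by rewrite -mulrA.
  rewrite normrM [`|y - x|]ger0_norm ?subr_ge0//.
  have : `|f1 x| <= M * (x ^+ i * nu Y ^+ i.+1) / i.+1%:R.
    apply: le_trans (P1 x xi) _; rewrite ler_wpM2r ?invr_ge0// ler_wpM2l// ler_wpM2l ?exprn_ge0//.
    by rewrite lerXn2r// ?nnegrE ?nu_ge0// Yi.
  have d0 : 0 <= y - x by rewrite subr_ge0.
  move=> /(ler_wpM2r d0) /le_trans; apply.
  rewrite /Psi -!mulrBl -!mulrBr -!mulrBl.
  have nY0 : 0 <= nu Y ^+ i.+1 by rewrite exprn_ge0// nu_ge0.
  have := ler_wpM2r nY0 (pow_convex i x0 xy).
  move=> /(ler_wpM2l M0) K.
  rewrite ler_pdivlMr ?exprn_gt0//; apply: le_trans K.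
  by rewrite le_eqVlt; apply/orP; left; apply/eqP; field.
by rewrite f0 subr0 /Psi expr0n /= mul0r mulr0 mul0r subr0.
Qed.

End Primitives.

(** * The case of an absolutely continuous measure *)
Section WeightedSecondDerivative.
Set Implicit Arguments. Unset Strict Implicit. Unset Printing Implicit Defensive.
Variable R : realType.
Local Notation mu := (@lebesgue_measure R).
Local Notation I01 := (`]0%R, 1%R[%classic : set R).

Local Notation C01 := (`[0%R, 1%R]%classic : set R).

Lemma integrable01_cc (g : R -> R) : mu.-integrable I01 (EFin \o g) ->
  mu.-integrable C01 (EFin \o g).
Proof.
move=> /integrableP[mg ig].
have mg' : measurable_fun C01 g.
  apply/measurable_fun_itv_bndo_bndcP.
  by apply/measurable_fun_itv_obnd_cbndP/measurable_EFinP.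
have {}mg' := proj2 (measurable_EFinP _ _) mg'.
apply/integrableP; split => //.
by rewrite integral_itv_bndoo//; exact: measurableT_comp.
Qed.

Lemma integrable01_sub (g : R -> R) (D : set R) : mu.-integrable I01 (EFin \o g) ->
  measurable D -> D `<=` `[0, 1] -> mu.-integrable D (EFin \o g).
Proof. by move=> /integrable01_cc H mD DI; apply: integrableS H => //. Qed.

Lemma cc_sub01 (x y : R) : 0 <= x -> y <= 1 -> `[x, y] `<=` `[0, 1].
Proof. by move=> x0 y1 z; rewrite /= !in_itv /= => /andP[? ?]; apply/andP; split; lra. Qed.

Lemma oc_sub01 (x y : R) : 0 <= x -> y <= 1 -> `]x, y] `<=` `[0, 1].
Proof. by move=> x0 y1 z; rewrite /= !in_itv /= => /andP[? ?]; apply/andP; split; lra. Qed.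

Lemma Rint_prim_sub (g : R -> R) x y : mu.-integrable I01 (EFin \o g) ->
  0 <= x -> x <= y -> y <= 1 ->
  \int[mu]_(z in `[0, y]) g z - \int[mu]_(z in `[0, x]) g z = \int[mu]_(z in `]x, y]) g z.
Proof.
move=> ig x0 xy y1; apply: Rintegral_itvB; last 2 first.
- by rewrite bnd_simp.
- by rewrite bnd_simp.
by apply: (integrable01_sub ig) => //; exact: cc_sub01.
Qed.

(** Boundedness is included so that a single constant controls everything
    that [sprim2] asks of w. *)
Definition Lip (B : R) (w : R -> R) : Prop := forall x y, 0 <= x <= 1 -> 0 <= y <= 1 ->
  `|w x| <= B /\ `|w y - w x| <= B * `|y - x|.

Lemma Lip_ge0 B w : Lip B w -> 0 <= B.
Proof.
have x0 : 0 <= (0 : R) <= 1 by rewrite lexx ler01.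
by move=> /(_ 0 0 x0 x0)[H _]; apply: le_trans (normr_ge0 _) H.
Qed.

Lemma sprim2_Lip nu B f f1 w : sprim2 nu B f f1 w -> Lip B w.
Proof. by move=> H x y xi yi; case: (H x y xi yi). Qed.

Lemma lip_measurable B (w : R -> R) :
  (forall x y, 0 <= x <= 1 -> 0 <= y <= 1 -> `|w y - w x| <= B * `|y - x|) ->
  measurable_fun I01 w.
Proof.
move=> H; apply: open_continuous_measurable_fun; first exact: interval_open.
move=> x /[!inE] /= /[!in_itv] /= /andP[x0 x1].
apply/cvgrPdist_lt => e e0.
have B0 : 0 < `|B| + 1 by rewrite ltr_wpDl.
near=> y.
have : y \in `]0, 1[ by near: y; apply: near_in_itvoo; rewrite in_itv /= x0 x1.
rewrite in_itv /= => /andP[y0 y1].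
have d : `|x - y| < e / (`|B| + 1).
  by near: y; apply: (@cvgr_dist_lt _ _ _ (nbhs x) _ id x cvg_id); rewrite divr_gt0.
rewrite distrC; apply: le_lt_trans (H x y _ _) _.
- by rewrite !ltW.
- by rewrite !ltW.
rewrite distrC; move: d; rewrite ltr_pdivlMr// mulrC; apply: le_lt_trans.
by rewrite ler_wpM2r// ler_wpDr// ler_norm.
Unshelve. all: by end_near. Qed.

Lemma bounded01 (w : R -> R) B (D : set R) : D `<=` `[0, 1] ->
  (forall x, 0 <= x <= 1 -> `|w x| <= B) -> [bounded w x | x in D].
Proof.
move=> DI H; exists B; split; first exact: num_real.
move=> M BM x Dx; apply: le_trans (ltW BM); apply: H.
by have := DI _ Dx; rewrite /= in_itv.
Qed.

Lemma integrable01_mul (s w : R -> R) B : mu.-integrable I01 (EFin \o s) ->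
  measurable_fun I01 w -> (forall x, 0 <= x <= 1 -> `|w x| <= B) ->
  mu.-integrable I01 (EFin \o (fun z => s z * w z)).
Proof.
move=> is_ mw Hw.
have bw : [bounded w x | x in I01].
  by apply: (bounded01 _ Hw) => z; rewrite /= !in_itv /= => /andP[? ?]; apply/andP; split; lra.
exact: (@integrableMl _ _ _ mu I01 _ (EFin \o s) w is_ mw bw).
Qed.

Variable sg : R -> R.
Hypothesis sg_ge0 : forall x, 0 <= sg x.
Hypothesis sg_int : mu.-integrable I01 (EFin \o sg).

Definition nu x := \int[mu]_(z in `[0, x]) sg z.

Lemma nu_0 : nu 0 = 0.
Proof. by rewrite /nu set_itv1 Rintegral_set1. Qed.

Lemma nu_nd x y : 0 <= x -> x <= y -> y <= 1 -> nu x <= nu y.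
Proof. by move=> x0 xy y1; rewrite -subr_ge0 Rint_prim_sub//; exact: Rintegral_ge0. Qed.

Lemma nu_cont x : 0 <= x <= 1 -> forall e, 0 < e -> exists2 d, 0 < d &
  forall y, 0 <= y <= 1 -> `|y - x| < d -> `|nu y - nu x| < e.
Proof.
move=> xi e e0.
have : {within `[0, 1], continuous nu}.
  exact: (parameterized_integral_continuous ler01 (integrable01_cc sg_int)).
move=> /subspace_continuousP/(_ x); rewrite /= in_itv /= => /(_ xi).
move=> /cvg_within_nbhsP/(_ _ e0)[d d0 Hd]; by exists d.
Qed.

Lemma int_sgw B w : Lip B w -> mu.-integrable I01 (EFin \o (fun z => sg z * w z)).
Proof.
move=> H; apply: (integrable01_mul (B := B)) => //.
  by apply: (@lip_measurable B) => x y xi yi; case: (H x y xi yi).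
by move=> x xi; case: (H x x xi xi).
Qed.

Lemma prim_bound (w : R -> R) B a b c K : Lip B w -> 0 <= a -> a <= b -> b <= 1 ->
  (forall z, a <= z <= b -> `|w z - c| <= K) ->
  `|\int[mu]_(z in `[0, b]) (sg z * w z) - \int[mu]_(z in `[0, a]) (sg z * w z) - c * (nu b - nu a)|
    <= K * (nu b - nu a).
Proof.
move=> H a0 ab b1 HK.
have iw := int_sgw H.
rewrite (Rint_prim_sub iw a0 ab b1) /nu (Rint_prim_sub sg_int a0 ab b1).
have s1 : mu.-integrable (`]a, b]%classic : set R) (EFin \o (fun z => sg z * w z)).
  by apply: integrable01_sub iw _ _ => //; exact: oc_sub01.
have s2 : mu.-integrable (`]a, b]%classic : set R) (EFin \o sg).
  by apply: integrable01_sub sg_int _ _ => //; exact: oc_sub01.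
have s3 (k : R) : mu.-integrable (`]a, b]%classic : set R) (EFin \o (fun z => k * sg z)).
  by exact: (@integrableZl _ _ _ mu `]a, b]%classic (measurable_itv _) k _ s2).
rewrite -!RintegralZl// -RintegralB//.
apply: le_trans (le_normr_Rintegral _ _) _ => //.
  by exact: (@integrableB _ _ _ mu `]a, b]%classic (measurable_itv _) _ _ s1 (s3 c)).
apply: le_Rintegral => //.
  by apply: integrable_norm; exact: (@integrableB _ _ _ mu `]a, b]%classic (measurable_itv _) _ _ s1 (s3 c)).
move=> z; rewrite /= in_itv /= => /andP[az zb].
rewrite [c * _]mulrC -mulrBr normrM (ger0_norm (sg_ge0 z)) mulrC ler_wpM2r// HK//.
by rewrite (ltW az).
Qed.

(** On the segment between x and y the function w differs from w x by at
    most B |y - x|. *)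
Lemma int_sprim B w : Lip B w -> forall x y, 0 <= x <= 1 -> 0 <= y <= 1 ->
  `|\int[mu]_(z in `[0, y]) (sg z * w z) - \int[mu]_(z in `[0, x]) (sg z * w z) - w x * (nu y - nu x)|
    <= B * (`|y - x| * `|nu y - nu x|).
Proof.
move=> H; have B0 := Lip_ge0 H.
move=> x y /[dup] xi /andP[x0 x1] /[dup] yi /andP[y0 y1].
have [xy|yx] := leP x y.
  have := prim_bound (B := B) (w := w) (a := x) (b := y) (c := w x) (K := B * (y - x)) H x0 xy y1.
  rewrite [`|y - x|]ger0_norm ?subr_ge0// [`|nu y - nu x|]ger0_norm ?subr_ge0 ?nu_nd// mulrA; apply.
  move=> z /andP[xz zy]; have zi : 0 <= z <= 1 by apply/andP; split; lra.
  case: (H x z xi zi) => _ /le_trans; apply.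
  by rewrite ler_wpM2l// ger0_norm ?subr_ge0// lerD2r.
have yx' := ltW yx.
have := prim_bound (B := B) (w := w) (a := y) (b := x) (c := w x) (K := B * (x - y)) H y0 yx' x1.
rewrite [`|y - x|]distrC [`|nu y - nu x|]distrC.
rewrite [`|x - y|]ger0_norm ?subr_ge0// [`|nu x - nu y|]ger0_norm ?subr_ge0 ?nu_nd// mulrA => K.
rewrite -normrN; rewrite (_ : - (_ - _ - _) = \int[mu]_(z in `[0, x]) (sg z * w z) -
  \int[mu]_(z in `[0, y]) (sg z * w z) - w x * (nu x - nu y)); last by ring.
apply: K => z /andP[yz zx]; have zi : 0 <= z <= 1 by apply/andP; split; lra.
case: (H x z xi zi) => _ /le_trans; apply.
by rewrite ler_wpM2l// distrC ger0_norm ?subr_ge0// lerB.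
Qed.

Lemma prim_sgw B w : Lip B w -> sprim nu w (fun x => \int[mu]_(z in `[0, x]) (sg z * w z)).
Proof. by move=> H; exists B; exact: int_sprim. Qed.

(** Both sides are primitives of the same k dnu. *)
Lemma sprim_int B k P : Lip B k -> sprim nu k P -> forall x, 0 <= x <= 1 ->
  P x - P 0 = \int[mu]_(z in `[0, x]) (sg z * k z).
Proof.
move=> H HP x xi.
rewrite (sprim_uniq nu_nd HP (prim_sgw H) xi) [X in _ - X](_ : _ = 0) ?subr0//.
by rewrite set_itv1 Rintegral_set1.
Qed.

Lemma ae01_Rint (f g : R -> R) (x : R) : measurable_fun I01 f -> measurable_fun I01 g ->
  ae01 (fun z => f z = g z) -> 0 <= x <= 1 ->
  \int[mu]_(z in `[0, x]) f z = \int[mu]_(z in `[0, x]) g z.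
Proof.
move=> mf mg fg /andP[x0 x1].
have sb : `]0, x[ `<=` I01 by apply: subset_itvl; rewrite bnd_simp.
have mf' : measurable_fun (`]0, x[%classic : set R) f by exact: measurable_funS mf.
have mg' : measurable_fun (`]0, x[%classic : set R) g by exact: measurable_funS mg.
have E (h : R -> R) : measurable_fun (`]0, x[%classic : set R) h ->
   (\int[mu]_(z in `[0%R, x]) (h z)%:E = \int[mu]_(z in `]0%R, x[) (h z)%:E)%E.
  by move=> mh; apply: (@integral_itv_bndoo R 0 x (EFin \o h)); exact/measurable_EFinP.
rewrite /Rintegral (E _ mf') (E _ mg').
congr fine; apply: (@ae_eq_integral _ _ _ mu `]0, x[%classic (EFin \o g) (EFin \o f)) => //; [exact/measurable_EFinP|exact/measurable_EFinP|].
move: fg; rewrite /ae01 /ae_eq; apply: filterS; first exact: (ae_filter_ringOfSetsType mu).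
by move=> z H /sb zi; congr EFin; exact: H.
Qed.

(** The bound B is not enlarged.  This matters for g_i,
    where B has to decrease like K^i / (i!)^2. *)
Lemma sprim2_of_deriv_bounded (f f1 w G : R -> R) B : Lip B w ->
  (forall x, 0 <= x <= 1 -> `|f x| <= B /\ `|f1 x| <= B) ->
  (forall x, 0 <= x <= 1 -> wderiv `[0, 1] f x (f1 x)) ->
  measurable_fun I01 G -> ae01 (fun z => G z = sg z * w z) ->
  (forall x, 0 <= x <= 1 -> f1 x = f1 0 + \int[mu]_(z in `[0, x]) G z) ->
  sprim2 nu B f f1 w.
Proof.
move=> Lw Hb df mG aeG f1E.
have subL (a b c : R) : (a + b) - (a + c) = b - c by ring.
have B0 := Lip_ge0 Lw.
have mw : measurable_fun I01 w by apply: (@lip_measurable B) => x y xi yi; case: (Lw x y xi yi).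
have mS : measurable_fun I01 (fun z => sg z * w z).
  by apply/measurable_EFinP; exact: measurable_int (int_sgw Lw).
have E x : 0 <= x <= 1 -> f1 x = f1 0 + \int[mu]_(z in `[0, x]) (sg z * w z).
  by move=> xi; rewrite f1E// (ae01_Rint mG mS aeG).
have f1d x y : 0 <= x <= 1 -> 0 <= y <= 1 -> `|f1 y - f1 x - w x * (nu y - nu x)| <= B * (`|y - x| * `|nu y - nu x|).
  by move=> xi yi; rewrite (E x)// (E y)// subL; exact: int_sprim.
have lip x y : 0 <= x -> x <= y -> y <= 1 -> `|f1 y - f1 x| <= B * (nu y - nu x).
  move=> x0 xy y1.
  have xi : 0 <= x <= 1 by rewrite x0 (le_trans xy). have yi : 0 <= y <= 1 by rewrite y1 (le_trans x0).
  have := prim_bound (B := B) (w := w) (a := x) (b := y) (c := 0) (K := B) Lw x0 xy y1.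
  rewrite mul0r subr0 (E x)// (E y)// subL; apply => z /andP[xz zy].
  by rewrite subr0; case: (Lw z z); rewrite ?(le_trans x0 xz) ?(le_trans zy y1).
have lip' x y : 0 <= x <= 1 -> 0 <= y <= 1 -> `|f1 y - f1 x| <= B * `|nu y - nu x|.
  move=> /andP[x0 x1] /andP[y0 y1]; have [xy|/ltW yx] := leP x y.
    by rewrite [`|nu _ - _|]ger0_norm ?subr_ge0 ?nu_nd//; exact: lip.
  by rewrite distrC [`|nu _ - _|]distrC [`|nu _ - _|]ger0_norm ?subr_ge0 ?nu_nd//; exact: lip.
have ndiff x y z : 0 <= x <= 1 -> 0 <= y <= 1 -> (x <= z <= y) || (y <= z <= x) ->
    `|nu z - nu x| <= `|nu y - nu x|.
  move=> /andP[x0 x1] /andP[y0 y1] /orP[] /andP[h1 h2].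
    have a1 : nu x <= nu z by apply: nu_nd => //; apply: le_trans y1.
    have a2 : nu z <= nu y by apply: nu_nd => //; apply: le_trans h1.
    by rewrite !ger0_norm ?subr_ge0// ?(le_trans a1)// lerD2r.
  have a1 : nu y <= nu z by apply: nu_nd => //; apply: le_trans x1.
  have a2 : nu z <= nu x by apply: nu_nd => //; apply: le_trans h1.
  by rewrite distrC [leRHS]distrC !ger0_norm ?subr_ge0// ?(le_trans a1)// lerB.
have fd x y : 0 <= x <= 1 -> 0 <= y <= 1 ->
   `|f y - f x - (y - x) * f1 x| <= B * (`|y - x| * `|nu y - nu x|).
  move=> xi yi; have [/andP[x0 x1] /andP[y0 y1]] := (xi, yi).
  have [xy|yx|->] := ltgtP x y; last by rewrite !subrr mul0r subr0 normr0 mul0r mulr0.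
    have [c /andP[xc cy] ->] := mvt_within df x0 xy y1.
    rewrite [(y - x) * _]mulrC -mulrBl normrM mulrC mulrCA ler_wpM2l//.
    have ci : 0 <= c <= 1 by rewrite (le_trans x0 (ltW xc)) (le_trans (ltW cy) y1).
    by apply: le_trans (lip' x c xi ci) _; rewrite ler_wpM2l// ndiff// (ltW xc) (ltW cy).
  have [c /andP[yc cx] E1] := mvt_within df y0 yx x1.
  have -> : f y - f x - (y - x) * f1 x = (f1 c - f1 x) * (y - x).
    have -> : f y - f x = - (f x - f y) by ring.
    by rewrite E1; ring.
  rewrite normrM mulrC mulrCA ler_wpM2l//.
  have ci : 0 <= c <= 1 by rewrite (le_trans y0 (ltW yc)) (le_trans (ltW cx) x1).
  by apply: le_trans (lip' x c xi ci) _; rewrite ler_wpM2l// ndiff// (ltW yc) (ltW cx) orbT.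
move=> x y xi yi; have [h1 h2] := Hb x xi; have [wx wxy] := Lw x y xi yi.
by split => //; [exact: fd|exact: f1d].
Qed.

Lemma sprim2_of_deriv (f f1 w G : R -> R) B : Lip B w ->
  (forall x, 0 <= x <= 1 -> wderiv `[0, 1] f x (f1 x)) ->
  measurable_fun I01 G -> ae01 (fun z => G z = sg z * w z) ->
  (forall x, 0 <= x <= 1 -> f1 x = f1 0 + \int[mu]_(z in `[0, x]) G z) ->
  exists B', sprim2 nu B' f f1 w.
Proof.
move=> Lw df mG aeG f1E.
have nu10 : 0 <= nu 1 by rewrite -nu_0 nu_nd.
have B0 := Lip_ge0 Lw.
have f1b x : 0 <= x <= 1 -> `|f1 x| <= `|f1 0| + B * nu 1.
  move=> xi; rewrite f1E//; apply: le_trans (ler_normD _ _) _; rewrite lerD2l.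
  have mS : measurable_fun I01 (fun z => sg z * w z).
    by apply/measurable_EFinP; exact: measurable_int (int_sgw Lw).
  have /andP[x0 x1] := xi.
  have := prim_bound (B := B) (w := w) (a := 0) (b := x) (c := 0) (K := B) Lw (lexx _) x0 x1.
  rewrite mul0r subr0 nu_0 subr0 (ae01_Rint mG mS aeG)// set_itv1 Rintegral_set1 subr0.
  move=> H; apply: le_trans (H _) _; last by rewrite ler_wpM2l// nu_nd.
  move=> z /andP[z0 zx]; rewrite subr0; case: (Lw z z); rewrite ?z0 ?(le_trans zx)//.
have fb x : 0 <= x <= 1 -> `|f x| <= `|f 0| + `|f1 0| + B * nu 1.
  move=> xi; have /andP[x0 x1] := xi.
  have [->|xn] := eqVneq x 0; first by rewrite -addrA lerDl addr_ge0// mulr_ge0.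
  have x0' : 0 < x by rewrite lt_neqAle eq_sym xn.
  have [c /andP[xc cy] E1] := mvt_within df (lexx _) x0' x1.
  have -> : f x = f 0 + (f x - f 0) by ring.
  apply: le_trans (ler_normD _ _) _; rewrite -addrA lerD2l E1 subr0 normrM.
  have ci : 0 <= c <= 1 by apply/andP; split; lra.
  by apply: le_trans (f1b c ci); rewrite ler_piMr// ger0_norm.
exists (`|f 0| + `|f1 0| + B * nu 1 + B); apply: (@sprim2_of_deriv_bounded f f1 w G) => //.
- move=> x y xi yi; have [wx wxy] := Lw x y xi yi.
  have BB : B <= `|f 0| + `|f1 0| + B * nu 1 + B by rewrite lerDr !addr_ge0// mulr_ge0.
  by split; [exact: le_trans BB|apply: le_trans wxy _; rewrite ler_wpM2r].
- move=> x xi; split; first by apply: le_trans (fb x xi) _; rewrite lerDl.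
  by apply: le_trans (f1b x xi) _; have := normr_ge0 (f 0); lra.
Qed.

Lemma sprim2_wderiv B f f1 w : sprim2 nu B f f1 w -> forall x, 0 <= x <= 1 -> wderiv `[0, 1] f x (f1 x).
Proof.
move=> H x xi; apply/wderivP => e e0.
have B0 := sprim2_ge0 H.
have B1 : 0 < B + 1 by rewrite ltr_wpDl.
have [d d0 Hd] := nu_cont xi (divr_gt0 e0 B1).
exists d => // y; rewrite /= in_itv /= => yi yd.
have [_ _ _ H1 _] := H x y xi yi.
rewrite [f1 x * _]mulrC; apply: le_trans H1 _; rewrite mulrCA mulrC ler_wpM2r//.
have := Hd y yi yd; rewrite ltr_pdivlMr// => /ltW; apply: le_trans.
by rewrite mulrDr mulr1 [B * _]mulrC lerDl.
Qed.

(** Once some bound B' is known, it may be replaced by the size of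
    f, f1 and w: the second-order errors follow from these by integration. *)
Lemma sprim2_sharp B B' f f1 w : sprim2 nu B' f f1 w -> Lip B w ->
  (forall x, 0 <= x <= 1 -> `|f x| <= B /\ `|f1 x| <= B) -> sprim2 nu B f f1 w.
Proof.
move=> H Lw Hb.
apply: (@sprim2_of_deriv_bounded f f1 w (fun z => sg z * w z)) => //.
- exact: sprim2_wderiv H.
- by apply/measurable_EFinP; exact: measurable_int (int_sgw Lw).
- exact: nearW.
by move=> x xi; rewrite -(sprim_int Lw (sprim2_sprim H) xi); ring.
Qed.

Lemma sprim2_D01 B f f1 w x : sprim2 nu B f f1 w -> 0 <= x <= 1 -> D01 f x = f1 x.
Proof. by move=> H xi; apply: deriv_withinE => //; exact: sprim2_wderiv H _ xi. Qed.

(** The bridge from the inequalities of [sprim2] back to the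
    distributional second derivative. *)
Lemma sprim2_second B f f1 w : sprim2 nu B f f1 w ->
  is_second_derivative f (fun z => sg z * w z).
Proof.
move=> H; split.
- move=> x; rewrite /= in_itv /= => xi; apply/cvg_ex; exists (f1 x).
  exact: sprim2_wderiv H _ xi.
- exact: int_sgw (sprim2_Lip H).
- move=> x; rewrite /= in_itv /= => xi.
  rewrite (sprim2_D01 H xi) (sprim2_D01 H); last by rewrite lexx ler01.
  by rewrite -(sprim_int (sprim2_Lip H) (sprim2_sprim H) xi); ring.
Qed.

End WeightedSecondDerivative.

(** * Lebesgue norms on the unit interval *)
Section LebesgueSpace.
Set Implicit Arguments. Unset Strict Implicit. Unset Printing Implicit Defensive.
Variable R : realType.
Local Notation mu := (@lebesgue_measure R).
Local Notation I01 := (`]0%R, 1%R[%classic : set R).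
Local Notation C01 := (`[0%R, 1%R]%classic : set R).

Lemma aefilterS (P Q : R -> Prop) : (forall x, P x -> Q x) ->
  {ae mu, forall x, P x} -> {ae mu, forall x, Q x}.
Proof. by move=> PQ; apply: filterS => //; exact: (ae_filter_ringOfSetsType mu). Qed.

Lemma aefilterS2 (P P' Q : R -> Prop) : (forall x, P x -> P' x -> Q x) ->
  {ae mu, forall x, P x} -> {ae mu, forall x, P' x} -> {ae mu, forall x, Q x}.
Proof. by move=> PQ; apply: filterS2 => //; exact: (ae_filter_ringOfSetsType mu). Qed.

Lemma mes_abspow (h : R -> R) r : measurable_fun setT h ->
  measurable_fun setT (fun x => `|h x| `^ r).
Proof.
move=> mh; apply: (@measurableT_comp _ _ _ _ _ _ (@powR R ^~ r)) => //.
exact: measurableT_comp.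
Qed.

Lemma mu_I01 : mu I01 = 1%E.
Proof. by rewrite lebesgue_measure_itv /= lte_fin ltr01 oppr0 adde0. Qed.

Lemma mu_gt0 : (0 < mu setT)%E.
Proof.
have : (mu I01 <= mu setT)%E by apply: le_measure => //; rewrite inE.
by apply: lt_le_trans; rewrite lebesgue_measure_itv /= lte_fin ltr01 oppr0 adde0 lte_fin.
Qed.

(** Covers finite p and p = +oo at once, so that later arguments need not
    distinguish the two cases. *)
Lemma Lnorm_mono p (h k : R -> R) K : (0 < p)%E -> 0 <= K ->
  measurable_fun setT h -> measurable_fun setT k ->
  {ae mu, forall x, `|h x| <= K * `|k x|} ->
  ('N[mu]_p[EFin \o h] <= K%:E * 'N[mu]_p[EFin \o k])%E.
Proof.
move=> p0 K0 mh mk H; rewrite unlock /Lnorm; case: p p0 => [r r0||//].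
- rewrite lte_fin in r0.
  have E : (K%:E = (K%:E `^ r) `^ r^-1)%E.
    by rewrite -poweRrM mulfV ?gt_eqF// poweRe1.
  rewrite [in leRHS]E -poweRM ?poweR_ge0//; last first.
    by apply: integral_ge0 => x _; rewrite ?poweR_ge0 ?lee_fin ?powR_ge0.
  apply: gt0_ler_poweR; first by rewrite invr_ge0 ltW.
  + by rewrite in_itv /= leey andbT; apply: integral_ge0 => x _; rewrite ?poweR_ge0 ?lee_fin ?powR_ge0.
  + by rewrite in_itv /= leey andbT mule_ge0 ?lee_fin ?powR_ge0//; apply: integral_ge0 => x _; rewrite lee_fin powR_ge0.
  rewrite /= -ge0_integralZl_EFin ?powR_ge0//; last first.
    by apply/measurable_EFinP; exact: mes_abspow.
  apply: ae_ge0_le_integral => //.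
  + by apply/measurable_EFinP; exact: mes_abspow.
  + by move=> x _; rewrite lee_fin mulr_ge0// powR_ge0.
  + apply/measurable_EFinP; apply: measurable_funM => //; exact: mes_abspow.
  + apply: aefilterS H => x H _.
    rewrite lee_fin -powRM//; apply: ge0_ler_powR => //; [exact: ltW|].
    by rewrite nnegrE mulr_ge0.
- rewrite mu_gt0 -ess_supZl ?mu_gt0// => _; apply: le_ess_sup.
  by apply: aefilterS H => x H /=; rewrite -EFinM lee_fin.
Qed.

Lemma Lnorm_ind p : (0 < p)%E -> ('N[mu]_p[EFin \o \1_I01] <= 1)%E.
Proof.
move=> p0; rewrite unlock /Lnorm; case: p p0 => [r r0||//].
- have -> : (fun x : R => `|(EFin \o \1_I01) x| `^ r)%E = (fun x => (\1_I01 x)%:E).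
    apply/funext => x; rewrite /= indicE; case: (x \in _) => /=.
      by rewrite normr1 powR1.
    by rewrite normr0 powR0// gt_eqF.
  rewrite integral_indic// setIT [X in (X `^ _)%E](_ : _ = 1%E); last exact: mu_I01.
  by rewrite poweR_EFin powR1.
- rewrite mu_gt0 => _; apply/ess_supP; apply: nearW => x /=.
  by rewrite lee_fin indicE; case: (x \in _) => /=; rewrite ?normr1 ?normr0.
Qed.

Lemma restr01E (f : R -> R) x : 0 < x < 1 -> restr01 f x = f x.
Proof. by move=> xi; rewrite /restr01 patchE mem_set//= in_itv. Qed.

Lemma restr01N (f : R -> R) x : ~~ (0 < x < 1) -> restr01 f x = 0.
Proof. by move=> xi; rewrite /restr01 patchE memNset//= in_itv /=; apply/negP. Qed.

Lemma mes_restr (f : R -> R) : measurable_fun I01 f -> measurable_fun setT (restr01 f).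
Proof. by move=> mf; apply/(measurable_restrictT f). Qed.

Lemma Lp01P p (f : R -> R) :
  Lp01 p f <-> measurable_fun I01 f /\ ('N[mu]_p [EFin \o restr01 f] < +oo)%E.
Proof.
have E : measurable_fun I01 f <-> measurable_fun setT (restr01 f) by exact: measurable_restrictT.
rewrite /Lp01 inE; split.
  by move=> /andP[]; rewrite !inE /= => mf fin; split => //; exact/E.
by move=> [/E mf fin]; apply/andP; rewrite !inE.
Qed.

Lemma Lp01_norm_ge0 p (f : R -> R) : 0 <= Lp01_norm p f.
Proof. by rewrite /Lp01_norm fine_ge0// Lnorm_ge0. Qed.

Lemma Lp01_normE p (f : R -> R) : Lp01 p f ->
  ('N[mu]_p [EFin \o restr01 f] = (Lp01_norm p f)%:E)%E.
Proof. by move=> /Lp01P[_ H]; rewrite /Lp01_norm fineK// ge0_fin_numE// Lnorm_ge0. Qed.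

Lemma Lp01_mono p (f g : R -> R) K : (0 < p)%E -> 0 <= K -> measurable_fun I01 f ->
  Lp01 p g -> ae01 (fun x => `|f x| <= K * `|g x|) ->
  Lp01 p f /\ Lp01_norm p f <= K * Lp01_norm p g.
Proof.
move=> p0 K0 mf Lg H; have /Lp01P[mg _] := Lg.
have N : ('N[mu]_p[EFin \o restr01 f] <= K%:E * 'N[mu]_p[EFin \o restr01 g])%E.
  apply: Lnorm_mono => //.
  - exact: mes_restr.
  - exact: mes_restr.
  apply: aefilterS H => x H; case: (boolP (0 < x < 1)) => xi.
    by rewrite !restr01E//; apply: H; rewrite /= in_itv.
  by rewrite !restr01N// normr0 mulr0.
rewrite (Lp01_normE Lg) -EFinM in N.
have Lf : Lp01 p f by apply/Lp01P; split => //; apply: le_lt_trans N (ltry _).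
by split => //; rewrite -lee_fin -Lp01_normE.
Qed.

Lemma restr01_1 : restr01 (fun=> 1) = \1_I01 :> (R -> R).
Proof. by apply/funext => x; rewrite /restr01 patchE indicE; case: (x \in _). Qed.

Lemma Lp01_1 p : (0 < p)%E -> Lp01 p (fun=> 1 : R) /\ Lp01_norm p (fun=> 1 : R) <= 1.
Proof.
move=> p0; have N := Lnorm_ind p0.
have L1 : Lp01 p (fun=> 1 : R).
  by apply/Lp01P; split; [exact: measurable_cst|rewrite restr01_1 (le_lt_trans N)// ltry].
by split => //; rewrite -lee_fin -Lp01_normE// restr01_1.
Qed.

(** Hoelder's inequality against the indicator of (0, 1), which has
    norm at most 1 in every Lebesgue space. *)
Lemma Lp01_int p (f : R -> R) : (1 < p)%E -> Lp01 p f ->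
  mu.-integrable I01 (EFin \o f) /\ \int[mu]_(x in I01) `|f x| <= Lp01_norm p f.
Proof.
move=> p1 Lf; have /Lp01P[mf Nf] := Lf.
have p0 : (0 < p)%E by apply: lt_trans p1.
have mrf : measurable_fun setT (restr01 f) by exact: mes_restr.
have mI : measurable_fun setT (\1_I01 : R -> R) by exact: measurable_indic.
have N : ('N[mu]_1[EFin \o restr01 f] <= (Lp01_norm p f)%:E)%E.
  case: p p1 p0 Lf Nf => [r r1 r0 Lf _|_ _ Lf _|//].
  - rewrite lte_fin in r1; rewrite lte_fin in r0.
    have r10 : r != 0 by rewrite gt_eqF.
    have r1n : r - 1 != 0 by rewrite subr_eq0 gt_eqF.
    have q0 : 0 < r / (r - 1) by rewrite divr_gt0// subr_gt0.
    have pq : r^-1 + (r / (r - 1))^-1 = 1 by rewrite invf_div; field.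
    have := hoelder mu mrf mI r0 q0 pq.
    have -> : (restr01 f \* \1_I01)%R = restr01 f.
      apply/funext => x; rewrite /= indicE /restr01 patchE; case: (x \in _) => /=; rewrite ?mulr1 ?mulr0//.
    move=> /le_trans; apply; rewrite Lp01_normE//.
    have := @Lnorm_ind (r / (r - 1))%:E _; rewrite lte_fin => /(_ q0) H.
    by apply: le_trans (lee_wpmul2l _ H) _; rewrite ?mule1// lee_fin Lp01_norm_ge0.
  - have := @Lnorm_mono 1%E (restr01 f) (\1_I01) (Lp01_norm +oo%E f) _ (Lp01_norm_ge0 _ _) mrf.
    rewrite lte_fin => /(_ ltr01 mI) H.
    apply: le_trans (H _) _.
      have : {ae mu, forall x, ((abse \o (EFin \o restr01 f)) x <= ess_sup mu (abse \o (EFin \o restr01 f)))%E}.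
        exact: ess_sup_ge.
      apply: aefilterS => x.
      have -> : ess_sup mu (abse \o (EFin \o restr01 f)) = (Lp01_norm +oo%E f)%:E.
        by rewrite -Lp01_normE// unlock /Lnorm mu_gt0.
      rewrite /= lee_fin => Hx; case: (boolP (0 < x < 1)) => xi.
        by rewrite indicE mem_set ?normr1 ?mulr1//= in_itv.
      by rewrite restr01N// normr0 mulr_ge0// Lp01_norm_ge0.
    have := @Lnorm_ind 1%E; rewrite lte_fin => /(_ ltr01) H'.
    by apply: le_trans (lee_wpmul2l _ H') _; rewrite ?mule1// lee_fin Lp01_norm_ge0.
have E : (\int[mu]_(x in I01) `|(f x)%:E| = 'N[mu]_1[EFin \o restr01 f])%E.
  rewrite Lnorm1 [LHS]integral_mkcond; apply: eq_integral => x _.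
  by rewrite /= /restr01 !patchE; case: (x \in _) => /=; rewrite ?normr0.
have fin : (\int[mu]_(x in I01) `|(f x)%:E| < +oo)%E by rewrite E (le_lt_trans N)// ltry.
split; first by apply/integrableP; split => //; exact/measurable_EFinP.
rewrite -lee_fin /Rintegral fineK; first by rewrite E.
by rewrite ge0_fin_numE//; apply: integral_ge0 => x _; rewrite lee_fin.
Qed.

End LebesgueSpace.

(** * Weak second derivatives *)
Section SecondDerivative.
Set Implicit Arguments. Unset Strict Implicit. Unset Printing Implicit Defensive.
Variable R : realType.
Local Notation mu := (@lebesgue_measure R).
Local Notation I01 := (`]0%R, 1%R[%classic : set R).
Local Notation C01 := (`[0%R, 1%R]%classic : set R).
Implicit Types (f g w : R -> R).

Lemma zero01 : 0 <= (0 : R) <= 1. Proof. by rewrite lexx ler01. Qed.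

Lemma one01 : 0 <= (1 : R) <= 1. Proof. by rewrite lexx ler01. Qed.

Lemma sd_wderiv f g : is_second_derivative f g ->
  forall x, 0 <= x <= 1 -> wderiv C01 f x (D01 f x).
Proof. by move=> [H _ _] x xi; apply: wderiv_D01; apply: H; rewrite /= in_itv. Qed.

Lemma sd_prim f g : is_second_derivative f g ->
  forall x, 0 <= x <= 1 -> D01 f x = D01 f 0 + \int[mu]_(z in `[0, x]) g z.
Proof. by move=> [_ _ H] x xi; apply: H; rewrite /= in_itv. Qed.

(** The two primitives coincide; differentiate their difference by
    Lebesgue's theorem. *)
Lemma sd_uniq f g g' : is_second_derivative f g -> is_second_derivative f g' ->
  ae01 (fun x => g x = g' x).
Proof.
move=> H H'; have [_ ig _] := H; have [_ ig' _] := H'.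
have iB : mu.-integrable I01 (EFin \o (fun z => g z - g' z)).
  exact: (@integrableB _ _ _ mu I01 (measurable_itv _) _ _ ig ig').
pose G := (fun z => g z - g' z) \_ I01.
have iG : mu.-integrable setT (EFin \o G).
  have := iffLR (@integrable_mkcond _ _ _ mu I01 (EFin \o (fun z => g z - g' z)) (measurable_itv _)) iB.
  by rewrite restrict_EFin.
have locG : locally_integrable setT G by exact: (integrable_locally (measurable_itv _) iB).
have iGy y : mu.-integrable [set` Interval (BLeft (0 : R)) (BRight y)] (EFin \o G).
  by apply: integrableS iG => //.
have := FTC1 iGy locG.
apply: aefilterS => x /= H1; rewrite in_itv /= => /andP[x0 x1].
have [|_ D] := H1; first by rewrite lte_fin.
have F0 y : 0 <= y <= 1 -> \int[mu]_(t in `[0, y]) G t = 0.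
  move=> yi.
  have -> : \int[mu]_(t in `[0, y]) G t = \int[mu]_(t in `[0, y]) (g t - g' t).
    apply: ae01_Rint => //.
    - have iG' : mu.-integrable I01 (EFin \o G) by apply: integrableS iG.
      by apply/measurable_EFinP; exact: measurable_int iG'.
    - by apply/measurable_EFinP; exact: measurable_int iB.
    - by apply: nearW => z zi; rewrite /G patchE mem_set.
  have yC : `[0, y] `<=` C01 by apply: cc_sub01 => //; case/andP: yi.
  rewrite RintegralB//; [|exact: (integrable01_sub ig)|exact: (integrable01_sub ig')].
  by have := sd_prim H yi; have := sd_prim H' yi; lra.
have : derive1 (fun y => \int[mu]_(t in `[0, y]) G t) x = 0.
  rewrite derive1E -[RHS](derive_cst (0 : R^o) (x : R^o) (1 : R^o)).
  apply: near_eq_derive.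
  near=> y; apply: F0.
  have : y \in `]0, 1[ by near: y; apply: near_in_itvoo; rewrite in_itv /= x0 x1.
  by rewrite in_itv /= => /andP[? ?]; rewrite !ltW.
rewrite D /G patchE mem_set /=; last by rewrite in_itv /= x0 x1.
lra.
Unshelve. all: by end_near. Qed.

Lemma sd_D2 f g : is_second_derivative f g -> is_second_derivative f (D2 f).
Proof.
by move=> H; rewrite /D2; case: (xgetP (fun=> 0) [set g | is_second_derivative f g]) => [h ->//|/(_ g)[]].
Qed.

Lemma sd_D2_ae f g : is_second_derivative f g -> ae01 (fun x => D2 f x = g x).
Proof. by move=> H; apply: sd_uniq (sd_D2 H) H. Qed.

Lemma wderiv_ext f f' x l : (forall x, 0 <= x <= 1 -> f x = f' x) -> 0 <= x <= 1 ->
  wderiv C01 f x l -> wderiv C01 f' x l.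
Proof.
move=> E xi /wderivP H; apply/wderivP => e /H[d d0 Hd]; exists d => // y /[dup] yC.
by rewrite /= in_itv /= => yi; rewrite -!E//; exact: Hd.
Qed.

Lemma D01_ext f f' x : (forall x, 0 <= x <= 1 -> f x = f' x) -> 0 <= x <= 1 ->
  derivable_within C01 f x -> D01 f' x = D01 f x.
Proof.
move=> E xi H; apply: deriv_withinE => //; apply: wderiv_ext E xi _; exact: wderiv_D01.
Qed.

Lemma sd_ext f f' g : (forall x, 0 <= x <= 1 -> f x = f' x) ->
  is_second_derivative f g -> is_second_derivative f' g.
Proof.
move=> E H; have [_ ig _] := H; split => //.
  move=> x; rewrite /= in_itv /= => xi; apply/cvg_ex; exists (D01 f x).
  exact: (wderiv_ext E xi (sd_wderiv H xi)).
have DE x : 0 <= x <= 1 -> D01 f' x = D01 f x.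
  by move=> xi; apply: D01_ext => //; case: H => + _ _; apply; rewrite /= in_itv.
by move=> x; rewrite /= in_itv /= => xi; rewrite !DE ?zero01// (sd_prim H).
Qed.

Lemma wderiv_lin f f' x l l' (a b : R) : wderiv C01 f x l -> wderiv C01 f' x l' ->
  wderiv C01 (fun z => a * f z + b * f' z) x (a * l + b * l').
Proof.
move=> H H'; rewrite /wderiv.
have -> : (fun y => (a * f y + b * f' y - (a * f x + b * f' x)) / (y - x)) =
  (fun y => a * ((f y - f x) / (y - x)) + b * ((f' y - f' x) / (y - x))).
  by apply/funext => y; ring.
by apply: cvgD; [exact: cvgMr|exact: cvgMr].
Qed.

Lemma D01_lin f g f' g' (a b : R) x : is_second_derivative f g -> is_second_derivative f' g' ->
  0 <= x <= 1 -> D01 (fun z => a * f z + b * f' z) x = a * D01 f x + b * D01 f' x.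
Proof.
move=> H H' xi; apply: deriv_withinE => //.
by apply: wderiv_lin; [exact: sd_wderiv H _ xi|exact: sd_wderiv H' _ xi].
Qed.

Lemma sd_lin f g f' g' (a b : R) : is_second_derivative f g -> is_second_derivative f' g' ->
  is_second_derivative (fun z => a * f z + b * f' z) (fun z => a * g z + b * g' z).
Proof.
move=> H H'; have [_ ig _] := H; have [_ ig' _] := H'.
have Z (D : set R) k h : measurable D -> mu.-integrable D (EFin \o h) -> mu.-integrable D (EFin \o (fun z => k * h z)).
  by move=> mD ih; exact: (@integrableZl _ _ _ mu D mD k _ ih).
split.
- move=> x; rewrite /= in_itv /= => xi; apply/cvg_ex; exists (a * D01 f x + b * D01 f' x).
  exact: (wderiv_lin (a := a) (b := b) (sd_wderiv H xi) (sd_wderiv H' xi)).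
- exact: (@integrableD _ _ _ mu I01 (measurable_itv _) _ _ (Z _ a _ (measurable_itv _) ig) (Z _ b _ (measurable_itv _) ig')).
- move=> x; rewrite /= in_itv /= => xi.
  rewrite !(D01_lin _ _ H H') ?zero01// (sd_prim H xi) (sd_prim H' xi).
  have xC : `[0, x] `<=` C01 by apply: cc_sub01 => //; case/andP: xi.
  have i1 := integrable01_sub ig (measurable_itv _) xC.
  have i2 := integrable01_sub ig' (measurable_itv _) xC.
  rewrite RintegralD//; [|exact: Z|exact: Z].
  by rewrite !RintegralZl//; ring.
Qed.

Variable p : \bar R.
Hypothesis p_gt1 : (1 < p)%E.

Let p_gt0 : (0 < p)%E. Proof. by apply: lt_trans p_gt1; rewrite lte_fin. Qed.

Lemma W2p_ext f f' : (forall x, 0 <= x <= 1 -> f x = f' x) -> W2p p f -> W2p p f'.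
Proof. by move=> E [g [H Lg]]; exists g; split => //; exact: sd_ext H. Qed.

(** The norm is defined on functions on the whole line, but only their
    values on [0, 1] matter: this allows replacing a solution by the flat
    series. *)
Lemma W2p_norm_ext f f' : (forall x, 0 <= x <= 1 -> f x = f' x) -> W2p p f ->
  W2p_norm p f = W2p_norm p f'.
Proof.
move=> E [g [H Lg]].
have r f0 f0' : (forall x, 0 < x < 1 -> f0 x = f0' x) -> restr01 f0 = restr01 f0' :> (R -> R).
  move=> E0; apply/funext => x; case: (boolP (0 < x < 1)) => xi; first by rewrite !restr01E// E0.
  by rewrite !restr01N.
have w x : 0 < x < 1 -> 0 <= x <= 1 by move=> /andP[? ?]; rewrite !ltW.
rewrite /W2p_norm /Lp01_norm.
have -> : restr01 f = restr01 f' by apply: r => x /w; exact: E.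
have -> : restr01 (D01 f) = restr01 (D01 f').
  apply: r => x /w xi; apply/esym/D01_ext => //.
  by case: H => + _ _; apply; rewrite /= in_itv.
suff -> : D2 f = D2 f' by [].
rewrite /D2; congr xget; apply/seteqP; split => h /=; apply: sd_ext => //.
by move=> x xi; rewrite E.
Qed.

Lemma W2p_lin f f' (a b : R) : W2p p f -> W2p p f' -> W2p p (fun z => a * f z + b * f' z).
Proof.
move=> [g [H Lg]] [g' [H' Lg']]; exists (fun z => a * g z + b * g' z); split; first exact: sd_lin.
have [K0 K] := Lfun_submod_closed mu (ltW p_gt1).
have E : restr01 (fun z => a * g z + b * g' z) = a *: restr01 g + (b *: restr01 g' + 0) :> (R -> R).
  apply/funext => x; rewrite /restr01 addr0 !fctE /= !patchE.
  by case: (x \in _) => //=; rewrite !scaler0 addr0.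
by rewrite /Lp01 E; apply: (K a _ _ Lg); exact: (K b _ _ Lg').
Qed.

End SecondDerivative.

(** * The space of functions with second derivative in L^p *)
Section SobolevSpace.
Set Implicit Arguments. Unset Strict Implicit. Unset Printing Implicit Defensive.
Variable R : realType.
Local Notation mu := (@lebesgue_measure R).
Local Notation I01 := (`]0%R, 1%R[%classic : set R).
Local Notation C01 := (`[0%R, 1%R]%classic : set R).
Implicit Types (f g w : R -> R).

Lemma norm_int g : mu.-integrable I01 (EFin \o g) -> mu.-integrable I01 (EFin \o (fun z => `|g z|)).
Proof. by move=> ig; apply: integrable_norm. Qed.

Lemma nu_norm1 g : mu.-integrable I01 (EFin \o g) ->
  nu (fun z => `|g z|) 1 = \int[mu]_(z in I01) `|g z|.
Proof.
move=> /norm_int ig; rewrite /nu /Rintegral; congr fine.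
by apply: (@integral_itv_bndoo R 0 1 (EFin \o (fun z => `|g z|))); exact: measurable_int ig.
Qed.

Lemma sd_D01_osc f g x y : is_second_derivative f g -> 0 <= x <= 1 -> 0 <= y <= 1 ->
  `|D01 f x - D01 f y| <= \int[mu]_(z in I01) `|g z|.
Proof.
move=> H; have [_ ig _] := H; have ig' := norm_int ig.
wlog yx : x y / y <= x.
  move=> W xi yi; have [|/ltW] := leP y x; first by move=> ?; exact: W.
  by move=> ?; rewrite distrC; exact: W.
move=> /[dup] xi /andP[x0 x1] /[dup] yi /andP[y0 y1].
rewrite (sd_prim H xi) (sd_prim H yi).
rewrite (_ : _ + _ - _ = \int[mu]_(z in `[0, x]) g z - \int[mu]_(z in `[0, y]) g z); last by ring.
rewrite Rint_prim_sub//; apply: le_trans (le_normr_Rintegral _ _) _ => //.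
  by apply: integrable01_sub ig _ _ => //; exact: oc_sub01.
rewrite -Rint_prim_sub// -nu_norm1// -/(nu _ x) -/(nu _ y).
have g0 : forall z, 0 <= `|g z| by [].
have := nu_nd g0 ig' x0 x1 (lexx _); have := nu_nd g0 ig' (lexx _) y0 y1.
rewrite nu_0; lra.
Qed.

Variable p : \bar R.
Hypothesis p_gt1 : (1 < p)%E.

Let p_gt0 : (0 < p)%E. Proof. by apply: lt_trans p_gt1; rewrite lte_fin. Qed.

Lemma W2p_norm_ge0 f : 0 <= W2p_norm p f.
Proof. by rewrite /W2p_norm !addr_ge0 ?Lp01_norm_ge0. Qed.

Lemma W2p_D2 f : W2p p f -> is_second_derivative f (D2 f) /\ Lp01 p (D2 f).
Proof.
move=> [g [H Lg]]; have S := sd_D2 H; split => //.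
have [_ iD _] := S.
have mD : measurable_fun I01 (D2 f) by apply/measurable_EFinP; exact: measurable_int iD.
have [] // := Lp01_mono p_gt0 ler01 mD Lg _.
by apply: aefilterS (sd_D2_ae H) => x E /E ->; rewrite mul1r.
Qed.

Lemma W2p_bounds f : W2p p f -> exists M, (forall x, 0 <= x <= 1 -> `|D01 f x| <= M) /\
  (forall x, 0 <= x <= 1 -> `|f x| <= M) /\
  (forall x y, 0 <= x <= 1 -> 0 <= y <= 1 -> `|f y - f x| <= M * `|y - x|).
Proof.
move=> [g [H Lg]].
pose K := `|D01 f 0| + \int[mu]_(z in I01) `|g z|.
have HK x : 0 <= x <= 1 -> `|D01 f x| <= K.
  move=> xi; rewrite (_ : D01 f x = D01 f 0 + (D01 f x - D01 f 0)); last by ring.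
  by apply: le_trans (ler_normD _ _) _; rewrite lerD2l; apply: sd_D01_osc => //; exact: zero01.
have L := mvt_bound (sd_wderiv H) HK.
have K0 : 0 <= K := le_trans (normr_ge0 _) (HK 0 (zero01 R)).
exists (`|f 0| + K); split; [|split].
- by move=> x /HK /le_trans; apply; rewrite lerDr.
- move=> x xi; rewrite (_ : f x = f 0 + (f x - f 0)); last by ring.
  apply: le_trans (ler_normD _ _) _; rewrite lerD2l.
  apply: le_trans (L _ _ (zero01 R) xi) _; rewrite ler_piMr// dist01_le1//; exact: zero01.
- by move=> x y xi yi; apply: le_trans (L x y xi yi) _; rewrite ler_wpM2r// lerDr.
Qed.

Lemma W2p_Lip f : W2p p f -> exists M, Lip M f.
Proof. by move=> /W2p_bounds[M [_ [H1 H2]]]; exists M => x y xi yi; split; [exact: H1|exact: H2]. Qed.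

Lemma measurable_D01 f g : is_second_derivative f g -> measurable_fun I01 (D01 f).
Proof.
move=> H; have [_ ig _] := H.
have C := parameterized_integral_continuous ler01 (integrable01_cc ig).
have mC : measurable_fun C01 (fun x => \int[mu]_(z in `[0, x]) g z).
  by apply: subspace_continuous_measurable_fun => //; exact: C.
have mI : measurable_fun I01 (fun x => D01 f 0 + \int[mu]_(z in `[0, x]) g z).
  apply: measurable_funD => //; apply: measurable_funS mC => //.
  by move=> z /=; rewrite !in_itv /= => /andP[? ?]; rewrite !ltW.
apply: eq_measurable_fun mI => x; rewrite inE /= in_itv /= => /andP[x0 x1].
by rewrite -(sd_prim H)// !ltW.
Qed.

Lemma Lp01_bounded f B : measurable_fun I01 f -> (forall x, 0 <= x <= 1 -> `|f x| <= B) ->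
  Lp01 p f /\ Lp01_norm p f <= B.
Proof.
move=> mf H; have B0 : 0 <= B := le_trans (normr_ge0 _) (H 0 (zero01 R)).
have [L1 N1] := Lp01_1 p_gt0 : _ /\ Lp01_norm p (fun=> (1 : R)) <= 1.
have ae1 : ae01 (fun x => `|f x| <= B * `|(fun=> 1 : R) x|).
  by apply: nearW => x; rewrite /= in_itv /= normr1 mulr1 => /andP[? ?]; apply: H; rewrite !ltW.
have [Lf Nf] := Lp01_mono p_gt0 B0 mf L1 ae1.
by split => //; apply: le_trans Nf _; rewrite ler_piMr.
Qed.

Lemma Lp01_norm_lb f m : Lp01 p f -> (forall x, 0 <= x <= 1 -> m <= `|f x|) -> m <= Lp01_norm p f.
Proof.
move=> Lf H; have [fi /(le_trans _)] := Lp01_int p_gt1 Lf; apply.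
have -> : m = \int[mu]_(x in I01) m.
  by rewrite Rintegral_cst// [X in fine X](_ : _ = 1%E) ?mulr1//; exact: mu_I01.
apply: le_Rintegral => //.
- apply: (@measurable_bounded_integrable _ _ _ mu (fun=> m)) => //.
    by rewrite [ltLHS](_ : _ = 1%E) ?ltry//; exact: mu_I01.
  by exists `|m|; split; [exact: num_real|move=> M mM x _; exact: ltW].
- exact: norm_int.
- by move=> x; rewrite /= in_itv /= => /andP[? ?]; apply: H; rewrite !ltW.
Qed.

(** A Sobolev embedding with constant 1.  The minimum of |D01 f| is at most
    its L^p norm and its oscillation at most the L^p norm of D2 f; the same
    argument then passes from D01 f to f. *)
Lemma W2p_sup f : W2p p f -> forall x, 0 <= x <= 1 -> `|f x| <= W2p_norm p f.
Proof.
move=> Wf; have [S LD2] := W2p_D2 Wf; have [M [M1 [M0 ML]]] := W2p_bounds Wf.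
have [Lf _] := Lp01_bounded (lip_measurable ML) M0.
have [LD _] := Lp01_bounded (measurable_D01 S) M1.
have [_ N2] := Lp01_int p_gt1 LD2.
have HD x : 0 <= x <= 1 -> `|D01 f x| <= Lp01_norm p (D01 f) + Lp01_norm p (D2 f).
  move=> xi; rewrite -lerBlDr; apply: Lp01_norm_lb => // y yi.
  rewrite lerBlDr; have := le_trans (sd_D01_osc S xi yi) N2.
  have := ler_normD (D01 f y) (D01 f x - D01 f y).
  rewrite (_ : D01 f y + _ = D01 f x); last by ring.
  lra.
have L := mvt_bound (sd_wderiv S) HD.
move=> x xi; rewrite /W2p_norm -addrA -lerBlDr; apply: Lp01_norm_lb => // y yi.
have := ler_normD (f y) (f x - f y).
rewrite (_ : f y + _ = f x); last by ring.
have := L y x yi xi.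
have : (Lp01_norm p (D01 f) + Lp01_norm p (D2 f)) * `|x - y| <= (Lp01_norm p (D01 f) + Lp01_norm p (D2 f)).
  by rewrite ler_piMr ?addr_ge0 ?Lp01_norm_ge0// dist01_le1.
lra.
Qed.

Variable sg : R -> R.
Hypothesis sg_ge0 : forall x, 0 <= sg x.
Hypothesis sg_Lp : Lp01 p sg.

Let sg_int : mu.-integrable I01 (EFin \o sg). Proof. by have [] := Lp01_int p_gt1 sg_Lp. Qed.

(** The constant of [sprim2] controls the norm, which turns every estimate
    on the flat series into one in W^{2,p}. *)
Lemma sprim2_W2p B f f1 w : sprim2 (nu sg) B f f1 w ->
  W2p p f /\ W2p_norm p f <= B * (2 + Lp01_norm p sg).
Proof.
move=> H; have S := sprim2_second sg_ge0 sg_int H; have B0 := sprim2_ge0 H.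
have mS : measurable_fun I01 (fun z => sg z * w z).
  by case: S => _ /measurable_int/measurable_EFinP.
have Hw x : 0 <= x <= 1 -> `|w x| <= B by move=> xi; case: (H x x xi xi).
have ae1 : ae01 (fun x => `|sg x * w x| <= B * `|sg x|).
  apply: nearW => x; rewrite /= in_itv /= normrM mulrC => /andP[? ?].
  by rewrite ler_wpM2r// Hw// !ltW.
have [LS NS] := Lp01_mono p_gt0 B0 mS sg_Lp ae1.
have Wf : W2p p f by exists (fun z => sg z * w z).
have [S2 LD2] := W2p_D2 Wf.
split => //.
have mf : measurable_fun I01 f.
  by have [M [_ [_ ML]]] := W2p_bounds Wf; exact: lip_measurable ML.
have [_ N0] : Lp01 p f /\ Lp01_norm p f <= B.
  by apply: Lp01_bounded => // x xi; case: (H x x xi xi) => -[].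
have [_ N1] : Lp01 p (D01 f) /\ Lp01_norm p (D01 f) <= B.
  apply: Lp01_bounded; first exact: measurable_D01 S.
  by move=> x xi; rewrite (sprim2_D01 sg_int H)//; case: (H x x xi xi) => -[].
have mD2 : measurable_fun I01 (D2 f) by case: S2 => _ /measurable_int/measurable_EFinP.
have ae2 : ae01 (fun x => `|D2 f x| <= B * `|sg x|).
  by apply: aefilterS2 (sd_D2_ae S) ae1 => x E H1 xi; rewrite E//; exact: H1.
have [_ N2] := Lp01_mono p_gt0 B0 mD2 sg_Lp ae2.
rewrite /W2p_norm; lra.
Qed.

Lemma sprim2_D2 B f f1 w : sprim2 (nu sg) B f f1 w -> ae01 (fun x => D2 f x = sg x * w x).
Proof. by move=> H; apply: sd_D2_ae; exact: sprim2_second H. Qed.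

(** The converse passage, for a function solving f'' = sg w with w
    Lipschitz; this is how given eigenfunctions, generating functions and
    solutions enter. *)
Lemma W2p_sprim2 f w B : W2p p f -> Lip B w -> ae01 (fun x => D2 f x = sg x * w x) ->
  exists B', sprim2 (nu sg) B' f (D01 f) w.
Proof.
move=> Wf Lw E; have [S LD2] := W2p_D2 Wf.
apply: (sprim2_of_deriv sg_ge0 sg_int Lw (sd_wderiv S) _ E (sd_prim S)).
by case: S => _ /measurable_int/measurable_EFinP.
Qed.

End SobolevSpace.

(** * Factorial estimates *)
Section Factorials.
Set Implicit Arguments. Unset Strict Implicit. Unset Printing Implicit Defensive.
Variable R : realType.

Lemma pow_le_exp (x : R) k : 0 <= x -> x ^+ k <= k`!%:R * expR x.
Proof.
move=> x0; have k0 : (0 : R) < k`!%:R by rewrite ltr0n fact_gt0.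
rewrite mulrC -ler_pdivrMr//; case: k k0 => [|k] _.
  by rewrite expr0 fact0 divr1 -expR0 ler_expR.
by apply: le_trans (expR_ge1Dxn k x0); rewrite lerDr.
Qed.

Lemma fact_split i k : ((i + k)`! <= 2 ^ (i + k) * (i`! * k`!))%N.
Proof.
have : ('C(i + k, i) * (i`! * k`!) = (i + k)`!)%N.
  by have := bin_fact (leq_addr k i); rewrite addKn.
move=> <-; rewrite leq_mul2r; apply/orP; right.
have := expnDn 1 1 (i + k); rewrite addn1 => ->.
have H : (i < (i + k).+1)%N by rewrite ltnS leq_addr.
by rewrite (bigD1 (Ordinal H)) //= !exp1n !muln1 leq_addr.
Qed.

(** Here s < 2 is used.  With d = 2 - s > 0 the left side is
    Q^i / (i!)^d, and (2 Q)^i is the d-th power of a^i <= i! exp(a), where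
    a = (2 Q)^(1/d). *)
Lemma sqr_fact_dominates (s Q : R) : s < 2 -> 0 <= Q ->
  exists2 A, 0 < A & forall i, Q ^+ i * (i`!%:R `^ s) / i`!%:R ^+ 2 <= A / 2 ^+ i.
Proof.
move=> s2 Q0; pose d := 2 - s; have d0 : 0 < d by rewrite subr_gt0.
pose A := (2 * Q) `^ d^-1; have A0 : 0 <= A by exact: powR_ge0.
exists (expR A `^ d); first by rewrite powR_gt0// expR_gt0.
move=> i; have i0 : (0 : R) < i`!%:R by rewrite ltr0n fact_gt0.
have H1 : (A ^+ i) `^ d <= (i`!%:R * expR A) `^ d.
  apply: ge0_ler_powR; first exact: ltW.
  - by rewrite nnegrE exprn_ge0.
  - by rewrite nnegrE mulr_ge0// ?expR_ge0// ltW.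
  - exact: pow_le_exp.
rewrite powRM ?expR_ge0 ?(ltW i0)// in H1.
have E1 : (A ^+ i) `^ d = (2 * Q) ^+ i.
  have Ad : A `^ d = 2 * Q by rewrite /A -powRrM mulVf ?gt_eqF// powRr1 ?mulr_ge0.
  by rewrite -powR_mulrn// -powRrM [_%:R * d]mulrC powRrM Ad powR_mulrn// mulr_ge0.
have E2 : i`!%:R ^+ 2 = i`!%:R `^ d * i`!%:R `^ s.
  rewrite -powRD; last by rewrite (gt_eqF i0) ?implybT.
  by rewrite /d subrK powR_mulrn// ltW.
rewrite E2 E1 exprMn in H1 *.
have p1 : 0 < (i`!%:R : R) `^ d by rewrite powR_gt0.
have p2 : 0 < (i`!%:R : R) `^ s by rewrite powR_gt0.
have p3 : (0 : R) < 2 ^+ i by rewrite exprn_gt0.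
have -> : Q ^+ i * i`!%:R `^ s / (i`!%:R `^ d * i`!%:R `^ s) = Q ^+ i / i`!%:R `^ d.
  by field; rewrite !gt_eqF.
rewrite ler_pdivlMr// mulrAC ler_pdivrMr// mulrC.
by apply: le_trans H1 _; rewrite mulrC.
Qed.

Lemma geo_sum (N : nat) : \sum_(i < N) (2 ^+ i)^-1 <= 2 :> R.
Proof.
suff : \sum_(i < N) (2 ^+ i)^-1 = 2 - 2 / 2 ^+ N :> R.
  by move=> ->; rewrite gerBl divr_ge0// exprn_ge0.
elim: N => [|N IH]; first by rewrite big_ord0 expr0 divr1 subrr.
by rewrite big_ord_recr /= IH exprS; field; rewrite expf_neq0.
Qed.

Lemma powR_fact_split (s : R) i k : 0 <= s ->
  ((i + k)`!%:R : R) `^ s <= (2 `^ s) ^+ (i + k) * (i`!%:R `^ s * k`!%:R `^ s).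
Proof.
move=> s0; rewrite -powRM// -powR_mulrn ?powR_ge0// -powRrM [s * _]mulrC powRrM powR_mulrn// -powRM ?exprn_ge0 ?mulr_ge0//.
apply: ge0_ler_powR => //; rewrite ?nnegrE ?mulr_ge0 ?exprn_ge0//.
by rewrite -natrX -!natrM ler_nat fact_split.
Qed.

(** Stability of the Gevrey class under summation against the g_i:
    (i + k)! <= 2^(i + k) i! k! separates the factor (k!)^s from a sum over i that
    converges because s < 2. *)
Lemma gevrey_sum (s K C M r : R) : 0 <= s -> s < 2 -> 0 <= K -> 0 <= C -> 0 <= M -> 0 < r ->
  exists M' r', [/\ 0 < M', 0 < r' & forall (y : nat -> R) k N,
    (forall j, `|y j| <= M * (j`!%:R `^ s) / r ^+ j) ->
    \sum_(i < N) `|y (i + k)%N| * (C * K ^+ i / i`!%:R ^+ 2) <= M' * (k`!%:R `^ s) / r' ^+ k].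
Proof.
move=> s0 s2 K0 C0 M0 r0.
have q0 : 0 < (2 : R) `^ s by rewrite powR_gt0.
have Q0 : 0 <= 2 `^ s / r * K by rewrite mulr_ge0// divr_ge0 ?ltW.
have [A A0 HA] := sqr_fact_dominates s2 Q0.
exists (2 * (M * C * A) + 1), (r / 2 `^ s); split.
- by rewrite ltr_wpDl// !mulr_ge0// ltW.
- by rewrite divr_gt0.
move=> y k N Hy.
have k0 : 0 < (k`!%:R : R) `^ s by rewrite powR_gt0// ltr0n fact_gt0.
have rk : 0 < (r / 2 `^ s) ^+ k by rewrite exprn_gt0// divr_gt0.
apply: (@le_trans _ _ (2 * (M * C * A) * (k`!%:R `^ s) / (r / 2 `^ s) ^+ k)); last first.
  by rewrite ler_wpM2r ?invr_ge0 ?(ltW rk)// ler_wpM2r ?(ltW k0)// lerDl.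
apply: (@le_trans _ _ (\sum_(i < N) (M * C * A * (k`!%:R `^ s) / (r / 2 `^ s) ^+ k) * (2 ^+ i)^-1)).
  apply: ler_sum => i _.
  have i0 : (0 : R) < i`!%:R by rewrite ltr0n fact_gt0.
  have ci : 0 <= C * K ^+ i / i`!%:R ^+ 2 by rewrite divr_ge0 ?mulr_ge0 ?exprn_ge0.
  apply: le_trans (ler_wpM2r ci (Hy _)) _.
  have ri : r ^+ i != 0 by rewrite expf_neq0// gt_eqF.
  have rk' : r ^+ k != 0 by rewrite expf_neq0// gt_eqF.
  have qi : (2 `^ s) ^+ i != 0 by rewrite expf_neq0// gt_eqF.
  have qk : (2 `^ s) ^+ k != 0 by rewrite expf_neq0// gt_eqF.
  have i0' : (i`!%:R : R) != 0 by rewrite gt_eqF.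
  have rik : 0 < r ^+ (i + k) by rewrite exprn_gt0.
  pose X := M * (C * K ^+ i / i`!%:R ^+ 2) / r ^+ (i + k).
  have X0 : 0 <= X by apply: divr_ge0 (ltW rik); exact: mulr_ge0.
  have -> : M * ((i + k)`!%:R `^ s) / r ^+ (i + k) * (C * K ^+ i / i`!%:R ^+ 2) = (i + k)`!%:R `^ s * X.
    by rewrite /X; ring.
  apply: le_trans (ler_wpM2r X0 (powR_fact_split i k s0)) _.
  pose Y := M * C * (k`!%:R `^ s) / (r / 2 `^ s) ^+ k.
  have Y0 : 0 <= Y by apply: divr_ge0; [apply: mulr_ge0; [exact: mulr_ge0|exact: ltW]|exact: ltW].
  have -> : (2 `^ s) ^+ (i + k) * (i`!%:R `^ s * k`!%:R `^ s) * X =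
      Y * ((2 `^ s / r * K) ^+ i * (i`!%:R `^ s) / i`!%:R ^+ 2).
    by rewrite /X /Y !exprD !exprMn !exprVn; field; rewrite ri rk' qk i0'.
  apply: le_trans (ler_wpM2l Y0 (HA i)) _.
  by rewrite /Y le_eqVlt; apply/orP; left; apply/eqP; ring.
rewrite -mulr_sumr mulrC.
have Z0 : 0 <= M * C * A * (k`!%:R `^ s) / (r / 2 `^ s) ^+ k.
  apply: divr_ge0; last exact: ltW.
  apply: mulr_ge0; last exact: ltW.
  by apply: mulr_ge0; [exact: mulr_ge0|exact: ltW].
apply: le_trans (ler_wpM2r Z0 (geo_sum N)) _.
by rewrite le_eqVlt; apply/orP; left; apply/eqP; ring.
Qed.

Lemma gevrey_order_lt2 (s : R) (p : \bar R) : (1 < p)%E -> (s%:E < 2%:E - p^-1)%E -> s < 2.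
Proof.
case: p => [r r1 H|_ H|//].
- rewrite lte_fin in r1; move: H; rewrite inver (gt_eqF (lt_trans ltr01 r1)) -EFinB lte_fin => H.
  have : 0 < r^-1 by rewrite invr_gt0 (lt_trans ltr01).
  lra.
- by move: H; rewrite invey sube0 lte_fin.
Qed.

End Factorials.

(** * Rules for derivatives, products and sums of series *)
Section Leibniz.
Set Implicit Arguments. Unset Strict Implicit. Unset Printing Implicit Defensive.
Variable R : realType.
Implicit Types (D : set R) (f g : R -> R).

Lemma within_neq D (x : R) : \forall y \near within D x^', y != x.
Proof. by rewrite near_withinE; near=> y => _; near: y; exact: nbhs_dnbhs_neq. Unshelve. all: by end_near. Qed.

Lemma wderiv_cont D f x l : wderiv D f x l -> f y @[y --> within D x^'] --> f x.
Proof.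
move=> H.
have c0 : (y - x) @[y --> within D x^'] --> 0.
  apply/cvg_withinP => e e0; exists e => // y _ _; by rewrite subr0.
have : (f x + (f y - f x) / (y - x) * (y - x)) @[y --> within D x^'] --> f x + l * 0.
  by apply: cvgD; [exact: cvg_cst|exact: cvgM].
rewrite mulr0 addr0; apply: cvg_trans; apply: near_eq_cvg.
near=> y; rewrite divfK ?subrKC// subr_eq0.
near: y; exact: within_neq.
Unshelve. all: by end_near. Qed.

Lemma wderivM D f g x l m : wderiv D f x l -> wderiv D g x m ->
  wderiv D (fun y => f y * g y) x (l * g x + f x * m).
Proof.
move=> Hf Hg; rewrite /wderiv.
have -> : (fun y => (f y * g y - f x * g x) / (y - x)) =
  (fun y => (f y - f x) / (y - x) * g y + f x * ((g y - g x) / (y - x))).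
  by apply/funext => y; ring.
apply: cvgD; first by apply: cvgM => //; exact: wderiv_cont Hg.
exact: cvgMr.
Qed.

Lemma wderivD D f g x l m : wderiv D f x l -> wderiv D g x m ->
  wderiv D (fun y => f y + g y) x (l + m).
Proof.
move=> Hf Hg; rewrite /wderiv.
have -> : (fun y => (f y + g y - (f x + g x)) / (y - x)) =
  (fun y => (f y - f x) / (y - x) + (g y - g x) / (y - x)).
  by apply/funext => y; ring.
exact: cvgD.
Qed.

Lemma wderiv_cst D (k : R) x : wderiv D (fun=> k) x 0.
Proof. by apply/wderivP => e e0; exists 1 => // y _ _; rewrite subrr mul0r subr0 normr0 mulr_ge0// ltW. Qed.

Lemma wderiv_eqD D f g x l : D x -> (forall y, D y -> f y = g y) -> wderiv D f x l -> wderiv D g x l.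
Proof.
by move=> Dx E /wderivP H; apply/wderivP => e /H[d d0 Hd]; exists d => // y Dy; rewrite -!E//; exact: Hd.
Qed.

Lemma wderiv_uniq a b f x l m : a < b -> a <= x <= b ->
  wderiv `[a, b] f x l -> wderiv `[a, b] f x m -> l = m.
Proof. by move=> ab xi H1 H2; rewrite -(deriv_withinE ab xi H1) (deriv_withinE ab xi H2). Qed.

(** A Taylor estimate with quadratic remainder is the form in which
    derivatives of series are obtained below. *)
Lemma wderiv_quad D f x l K : (forall y, D y -> `|f y - f x - (y - x) * l| <= K * `|y - x| ^+ 2) ->
  wderiv D f x l.
Proof.
move=> H; apply/wderivP => e e0.
have K0 : 0 < `|K| + 1 by rewrite ltr_wpDl.
exists (e / (`|K| + 1)); first by rewrite divr_gt0.
move=> y Dy; rewrite ltr_pdivlMr// => yd.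
rewrite [l * _]mulrC; apply: le_trans (H y Dy) _.
rewrite expr2 mulrA ler_wpM2r//; apply: le_trans (ltW yd).
rewrite mulrC ler_wpM2l//; apply: le_trans (ler_norm _) _; by rewrite lerDl.
Qed.

(** Iterated derivatives are computed by exhibiting the whole
    sequence of derivatives, which is also what [gevrey] asks for. *)
Lemma nderiv_within_chain (a b : R) (U : nat -> R -> R) : a < b ->
  (forall k x, a <= x <= b -> wderiv `[a, b] (U k) x (U k.+1 x)) ->
  forall k x, a <= x <= b -> nderiv_within k `[a, b] (U 0%N) x = U k x.
Proof.
move=> ab H; elim=> [//|k IH] x xi.
rewrite /nderiv_within iterS; apply: deriv_withinE => //.
apply: wderiv_eqD (H k x xi); first by rewrite /= in_itv.
by move=> y; rewrite /= in_itv /= => yi; rewrite -IH.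
Qed.

Lemma has_derivative_realP D u v : @has_derivative_in R R^o setT (fun x => `|x|) D u v <->
  forall t, D t -> wderiv D u t (v t).
Proof.
have E t : (fun r : R => `|(r - t)^-1 *: (u r - u t : R^o) - v t|) = (fun r => `|(u r - u t) / (r - t) - v t|).
  by apply/funext => r; rewrite /GRing.scale /= mulrC.
split.
- move=> [_ _ H] t Dt; have := H t Dt; rewrite E => K.
  apply/cvg_withinP => e e0; have /cvg_withinP/(_ e e0)[d d0 Hd] := K.
  by exists d => // y Dy yx yd; have := Hd y Dy yx yd; rewrite subr0 normr_id.
- move=> H; split => // t Dt; rewrite E.
  apply/cvg_withinP => e e0; have /cvg_withinP/(_ e e0)[d d0 Hd] := H t Dt.
  by exists d => // y Dy yx yd; rewrite subr0 normr_id; exact: Hd.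
Qed.

(** The bound may depend on t: the constants for the flat
    series blow up as t tends to 0. *)
Lemma continuous_in_local (V : lmodType R) (E : set V) (N : V -> R) D (u : R -> V) :
  (forall x, 0 <= N x) -> (forall t, D t -> E (u t)) ->
  (forall t, D t -> exists K' d, 0 < d /\ forall r, D r -> `|r - t| < d -> N (u r - u t) <= K' * `|r - t|) ->
  continuous_in E N D u.
Proof.
move=> N0 Hu H; split => // t Dt; have [K' [d [d0 HK]]] := H t Dt.
apply/cvg_within_nbhsP => e0 e00.
have K'0 : 0 < `|K'| + 1 by rewrite ltr_wpDl.
exists (Num.min d (e0 / (`|K'| + 1))); first by rewrite lt_min d0 divr_gt0.
move=> r Dr; rewrite lt_min => /andP[rd]; rewrite ltr_pdivlMr// => re; rewrite subr0 ger0_norm//.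
apply: le_lt_trans (HK r Dr rd) _; apply: le_lt_trans re.
by rewrite mulrC ler_wpM2l//; apply: le_trans (ler_norm _) _; rewrite lerDl.
Qed.

Lemma has_derivative_in_local (V : lmodType R) (E : set V) (N : V -> R) D (u v : R -> V) :
  (forall x, 0 <= N x) -> (forall t, D t -> E (u t)) -> (forall t, D t -> E (v t)) ->
  (forall t, D t -> exists K' d, 0 < d /\ forall r, D r -> r != t -> `|r - t| < d ->
     N ((r - t)^-1 *: (u r - u t) - v t) <= K' * `|r - t|) ->
  has_derivative_in E N D u v.
Proof.
move=> N0 Hu Hv H; split => // t Dt; have [K' [d [d0 HK]]] := H t Dt.
apply/cvg_withinP => e0 e00.
have K'0 : 0 < `|K'| + 1 by rewrite ltr_wpDl.
exists (Num.min d (e0 / (`|K'| + 1))); first by rewrite lt_min d0 divr_gt0.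
move=> r Dr rt; rewrite lt_min => /andP[rd]; rewrite ltr_pdivlMr// => re; rewrite subr0 ger0_norm//.
apply: le_lt_trans (HK r Dr rt rd) _; apply: le_lt_trans re.
by rewrite mulrC ler_wpM2l//; apply: le_trans (ler_norm _) _; rewrite lerDl.
Qed.

(** The k-th derivative of the product of the i-th term of U and the j-th
    term of V.  The recursion is Leibniz' rule without binomial coefficients:
    it has 2^k terms, which only costs a factor 2 in the Gevrey radius. *)
Fixpoint leib (U V : nat -> R -> R) (k i j : nat) (t : R) : R :=
  if k is k'.+1 then leib U V k' i.+1 j t + leib U V k' i j.+1 t else U i t * V j t.

Lemma leib_wderiv D U V x : (forall k, wderiv D (U k) x (U k.+1 x)) ->
  (forall k, wderiv D (V k) x (V k.+1 x)) ->
  forall k i j, wderiv D (leib U V k i j) x (leib U V k.+1 i j x).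
Proof.
move=> HU HV; elim=> [|k IH] i j /=; first exact: wderivM.
exact: wderivD.
Qed.

Lemma fact_mul_le i j : (i`! * j`! <= (i + j)`!)%N.
Proof.
have := bin_fact (leq_addr j i); rewrite addKn => <-.
by rewrite leq_pmull// bin_gt0 leq_addr.
Qed.

Lemma leib_bound U V (M M' r s : R) (t : R) : 1 <= s -> 0 < r -> 0 <= M -> 0 <= M' ->
  (forall k, `|U k t| <= M * (k`!%:R `^ s) / r ^+ k) ->
  (forall k, `|V k t| <= M' * (k`!%:R `^ s) / r ^+ k) ->
  forall k i j, `|leib U V k i j t| <= 2 ^+ k * (M * M' * ((i + j + k)`!%:R `^ s) / r ^+ (i + j + k)).
Proof.
move=> s1 r0 M0 M0' HU HV; have s0 : 0 <= s by apply: le_trans s1.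
elim=> [|k IH] i j /=.
  rewrite expr0 mul1r addn0 normrM; apply: le_trans (ler_pM _ _ (HU i) (HV j)) _ => //.
  rewrite exprD invfM.
  have -> : M * i`!%:R `^ s / r ^+ i * (M' * j`!%:R `^ s / r ^+ j) =
    M * M' * (i`!%:R `^ s * j`!%:R `^ s) * ((r ^+ i)^-1 * (r ^+ j)^-1) by ring.
  have p0 : 0 <= (r ^+ i)^-1 * (r ^+ j)^-1 by rewrite mulr_ge0// invr_ge0 exprn_ge0// ltW.
  apply: ler_wpM2r => //; apply: ler_wpM2l; first exact: mulr_ge0.
  rewrite -powRM//; apply: ge0_ler_powR => //; rewrite ?nnegrE ?mulr_ge0//.
  by rewrite -natrM ler_nat fact_mul_le.
apply: le_trans (ler_normD _ _) _.
have := lerD (IH i.+1 j) (IH i j.+1).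
rewrite addSn addnS addSn !addnS => /le_trans; apply.
by rewrite [2 ^+ k.+1]exprS; lra.
Qed.

(** Where U is locally constant equal to 1, the derivatives of the product
    are those of V. *)
Lemma leib_delta U V t : U 0%N t = 1 -> (forall k, U k.+1 t = 0) ->
  forall k j, leib U V k 0 j t = V (j + k)%N t /\ forall i, leib U V k i.+1 j t = 0.
Proof.
move=> U0 U1; elim=> [|k IH] j /=; first by rewrite U0 mul1r addn0; split => // i; rewrite U1 mul0r.
split; first by rewrite (IH j).2 (IH j.+1).1 add0r addSnnS.
by move=> i; rewrite (IH j).2 (IH j.+1).2 addr0.
Qed.

Lemma leib_zero U V t : (forall k, U k t = 0) -> forall k i j, leib U V k i j t = 0.
Proof. by move=> U0; elim=> [|k IH] i j /=; [rewrite U0 mul0r|rewrite !IH addr0]. Qed.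

Definition ser (a : nat -> R) : R := limn (series a).

Lemma ser_lin (a b : nat -> R) x y : cvgn (series a) -> cvgn (series b) ->
  cvgn (series (fun n => x * a n + y * b n)) /\
  ser (fun n => x * a n + y * b n) = x * ser a + y * ser b.
Proof.
move=> /cvg_ex[l Ha] /cvg_ex[m Hb].
have H : series (fun n => x * a n + y * b n) @ \oo --> x * l + y * m.
  have -> : series (fun n => x * a n + y * b n) = (fun N => x * series a N + y * series b N).
    by apply/funext => N; rewrite /series /= big_split /= -!mulr_sumr.
  by apply: cvgD; exact: cvgMr.
split; first by apply/cvg_ex; eexists; exact: H.
by rewrite /ser (cvg_lim (@Rhausdorff R) H) (cvg_lim (@Rhausdorff R) Ha) (cvg_lim (@Rhausdorff R) Hb).
Qed.

Lemma ser_taylor_bound (a b c : nat -> R) (h S : R) : cvgn (series a) -> cvgn (series b) -> cvgn (series c) ->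
  (forall N, \sum_(i < N) `|a i - b i - h * c i| <= S) ->
  `|ser a - ser b - h * ser c| <= S.
Proof.
move=> Ha Hb Hc HS.
have [H1 E1] := ser_lin 1 (-1) Ha Hb.
have [H2 E2] := ser_lin 1 (- h) H1 Hc.
have -> : ser a - ser b - h * ser c = ser (fun n => 1 * (1 * a n + (-1) * b n) + (- h) * c n).
  by rewrite E2 E1; ring.
apply: abs_series_le => N; apply: le_trans (HS N).
by apply: ler_sum => i _; rewrite !mul1r !mulN1r mulNr.
Qed.

Lemma ser0 : ser (fun=> 0 : R) = 0.
Proof.
have E : series (fun=> 0 : R) = (fun=> 0) by apply/funext => n; rewrite /series /= big1.
by rewrite /ser E; exact: lim_cst.
Qed.

Lemma ser_shift (a : nat -> R) : a 0%N = 0 -> cvgn (series a) -> ser a = ser (fun n => a n.+1).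
Proof.
move=> a0 /cvg_ex[l Hl].
rewrite /ser (cvg_lim (@Rhausdorff R) Hl); apply/esym; apply: cvg_lim; first exact: Rhausdorff.
have : (fun n => series a (n + 1)%N) @ \oo --> l by rewrite (cvg_shiftn 1 (series a)).
by apply: cvg_trans; apply: near_eq_cvg; near=> n; rewrite addn1 /series /= big_nat_recl //= a0 add0r.
Unshelve. all: by end_near. Qed.

End Leibniz.

(** * The weighted space L^2 *)
Section WeightedL2.
Set Implicit Arguments. Unset Strict Implicit. Unset Printing Implicit Defensive.
Variable R : realType.
Local Notation mu := (@lebesgue_measure R).
Local Notation I01 := (`]0%R, 1%R[%classic : set R).
Local Notation C01 := (`[0%R, 1%R]%classic : set R).
Implicit Types (f g h : R -> R).

Variable rho : R -> R.
Hypothesis rho_int : mu.-integrable I01 (EFin \o rho).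
Hypothesis rho_gt0 : ae01 (fun x => 0 < rho x).

Let sg : R -> R := fun z => `|rho z|.

Lemma sg_ge0 z : 0 <= sg z. Proof. by rewrite /sg. Qed.

Lemma sg_int : mu.-integrable I01 (EFin \o sg). Proof. exact: norm_int. Qed.

Lemma rho_sg : ae01 (fun x => rho x = sg x).
Proof. by apply: aefilterS rho_gt0 => x H /H r0; rewrite /sg gtr0_norm. Qed.

Lemma mes_rho : measurable_fun I01 rho.
Proof. by apply/measurable_EFinP; exact: measurable_int rho_int. Qed.

Lemma mes_mul (f g : R -> R) : measurable_fun I01 f -> measurable_fun I01 g ->
  measurable_fun I01 (fun z => f z * g z).
Proof. by move=> mf mg; exact: measurable_funM. Qed.

Lemma ae_Rint01 f g : measurable_fun I01 f -> measurable_fun I01 g ->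
  ae01 (fun z => f z = g z) -> \int[mu]_(z in I01) f z = \int[mu]_(z in I01) g z.
Proof.
move=> mf mg H; rewrite /Rintegral; congr fine.
apply: (@ae_eq_integral _ _ _ mu I01 (EFin \o g) (EFin \o f)) => //.
- exact/measurable_EFinP.
- exact/measurable_EFinP.
by apply: aefilterS H => x H /H /= ->.
Qed.

Lemma ge0_int01 f : measurable_fun I01 f -> ae01 (fun z => 0 <= f z) ->
  0 <= \int[mu]_(z in I01) f z.
Proof.
move=> mf H; rewrite (@ae_Rint01 _ (fun z => `|f z|))//; first exact: Rintegral_ge0.
- exact: measurableT_comp.
- by apply: aefilterS H => x H /H ?; rewrite ger0_norm.
Qed.

Lemma L2P f : L2rho rho f <->
  measurable_fun I01 f /\ mu.-integrable I01 (EFin \o (fun x => f x * f x * rho x)).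
Proof.
have m1 : measurable_fun I01 f -> measurable_fun I01 (fun x => f x * f x * rho x).
  by move=> mf; apply: mes_mul mes_rho; exact: mes_mul.
have E : measurable_fun I01 f -> (\int[mu]_(x in I01) `|(f x * f x * rho x)%:E| =
   \int[mu]_(x in I01) (`|f x| ^+ 2 * rho x)%:E)%E.
  move=> mf; apply: (@ae_eq_integral _ _ _ mu I01) => //.
  - by apply/measurable_EFinP; apply: measurableT_comp => //; exact: m1.
  - apply/measurable_EFinP; apply: mes_mul mes_rho; apply: measurable_funX.
    exact: measurableT_comp.
  apply: aefilterS rho_gt0 => x H /H r0 /=.
  by rewrite normrM (gtr0_norm r0) expr2 -normrM.
split.
- move=> [mf H]; split => //; apply/integrableP; split; first by apply/measurable_EFinP; exact: m1.
  by rewrite /= E.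
- by move=> [mf /integrableP[_ H]]; split => //; rewrite -E.
Qed.

Lemma L2_mes f : L2rho rho f -> measurable_fun I01 f. Proof. by case. Qed.

Lemma L2_int f g : L2rho rho f -> L2rho rho g ->
  mu.-integrable I01 (EFin \o (fun x => f x * g x * rho x)).
Proof.
move=> /L2P[mf iff] /L2P[mg igg].
have i2 : mu.-integrable I01 (EFin \o (fun x => `|f x * f x * rho x| + `|g x * g x * rho x|)).
  exact: (@integrableD _ _ _ mu I01 (measurable_itv _) _ _ (norm_int iff) (norm_int igg)).
apply: le_integrable i2 => //.
  by apply/measurable_EFinP; apply: mes_mul mes_rho; exact: mes_mul.
move=> x _; rewrite /= lee_fin !normrM -!mulrDl.
rewrite [leRHS]ger0_norm; last by rewrite mulr_ge0// addr_ge0 ?mulr_ge0.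
rewrite ler_wpM2r//; have := sqr_ge0 (`|f x| - `|g x|).
have := mulr_ge0 (normr_ge0 (f x)) (normr_ge0 (g x)).
rewrite sqrrB !expr2; lra.
Qed.

Local Notation dot := (L2rho_dot rho).
Local Notation nrm := (L2rho_norm rho).

Lemma intZ (D : set R) k f : measurable D -> mu.-integrable D (EFin \o f) ->
  mu.-integrable D (EFin \o (fun z => k * f z)).
Proof. by move=> mD H; exact: (@integrableZl _ _ _ mu D mD k _ H). Qed.

Lemma dotC f g : dot f g = dot g f.
Proof. by rewrite /L2rho_dot; apply: eq_Rintegral => x _; rewrite [f x * _]mulrC. Qed.

Lemma dotD f g h a b : L2rho rho f -> L2rho rho g -> L2rho rho h ->
  dot (fun x => a * f x + b * g x) h = a * dot f h + b * dot g h.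
Proof.
move=> Lf Lg Lh; have i1 := L2_int Lf Lh; have i2 := L2_int Lg Lh.
rewrite /L2rho_dot -!RintegralZl// -RintegralD//; [|exact: intZ|exact: intZ].
by apply: eq_Rintegral => x _; ring.
Qed.

Lemma L2_lin f g a b : L2rho rho f -> L2rho rho g -> L2rho rho (fun x => a * f x + b * g x).
Proof.
move=> Lf Lg; apply/L2P; split.
  by apply: measurable_funD; apply: measurable_funM => //; exact: L2_mes.
have i1 := intZ (a ^+ 2) (measurable_itv _) (L2_int Lf Lf).
have i2 := intZ (2 * a * b) (measurable_itv _) (L2_int Lf Lg).
have i3 := intZ (b ^+ 2) (measurable_itv _) (L2_int Lg Lg).
have i12 := @integrableD _ _ _ mu I01 (measurable_itv _) _ _ i1 i2.
have i123 := @integrableD _ _ _ mu I01 (measurable_itv _) _ _ i12 i3.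
apply: eq_integrable i123 => // x _; rewrite /= -!EFinD; congr EFin; ring.
Qed.

Lemma dot_ge0 f : L2rho rho f -> 0 <= dot f f.
Proof.
move=> Lf; apply: ge0_int01.
  by apply: mes_mul mes_rho; apply: mes_mul; exact: L2_mes.
by apply: aefilterS rho_gt0 => x H /H r0; apply: mulr_ge0; [rewrite -expr2 sqr_ge0|exact: ltW].
Qed.

Lemma nrmE f : nrm f = Num.sqrt (dot f f).
Proof.
rewrite /L2rho_norm /L2rho_dot; congr Num.sqrt; apply: eq_Rintegral => x _.
by rewrite real_normK ?num_real// expr2.
Qed.

Lemma nrm_ge0 f : 0 <= nrm f. Proof. by rewrite nrmE sqrtr_ge0. Qed.

Lemma nrm_sqr f : L2rho rho f -> nrm f ^+ 2 = dot f f.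
Proof. by move=> Lf; rewrite nrmE sqr_sqrtr// dot_ge0. Qed.

Lemma dot_sq f g a b : L2rho rho f -> L2rho rho g ->
  dot (fun x => a * f x + b * g x) (fun x => a * f x + b * g x) =
  a ^+ 2 * dot f f + 2 * a * b * dot f g + b ^+ 2 * dot g g.
Proof.
move=> Lf Lg; have Lh := L2_lin a b Lf Lg.
rewrite dotD// [dot f _]dotC [dot g _]dotC !dotD// [dot g f]dotC; ring.
Qed.

Lemma cauchy_schwarz f g : L2rho rho f -> L2rho rho g -> `|dot f g| <= nrm f * nrm g.
Proof.
move=> Lf Lg.
have H : dot f g ^+ 2 <= dot f f * dot g g.
  have [g0|g0] := ltP 0 (dot g g).
    have := dot_ge0 (L2_lin (dot g g) (- dot f g) Lf Lg).
    rewrite dot_sq// => K.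
    have : 0 <= dot g g * (dot f f * dot g g - dot f g ^+ 2).
      by apply: le_trans K _; rewrite le_eqVlt; apply/orP; left; apply/eqP; ring.
    by rewrite pmulr_rge0// subr_ge0.
  have g00 : dot g g = 0 by apply/eqP; rewrite eq_le g0 dot_ge0.
  have K t : 0 <= dot f f + 2 * t * dot f g.
    have := dot_ge0 (L2_lin 1 t Lf Lg); rewrite dot_sq// g00; lra.
  rewrite g00 mulr0; suff -> : dot f g = 0 by rewrite expr0n.
  apply/eqP; apply: contraT => n0.
  have := K (- (dot f f + 1) / (2 * dot f g)).
  rewrite (_ : _ + _ = -1); first lra.
  by field.
rewrite -(@ler_pXn2r _ 2)// ?nnegrE ?mulr_ge0 ?nrm_ge0//.
by rewrite exprMn !nrm_sqr// real_normK ?num_real.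
Qed.

Lemma nrm_lin f g a b : L2rho rho f -> L2rho rho g ->
  nrm (fun x => a * f x + b * g x) <= `|a| * nrm f + `|b| * nrm g.
Proof.
move=> Lf Lg; have Lh := L2_lin a b Lf Lg.
have K0 : 0 <= `|a| * nrm f + `|b| * nrm g by rewrite addr_ge0 ?mulr_ge0 ?nrm_ge0.
rewrite -(@ler_pXn2r _ 2)// ?nnegrE ?nrm_ge0// nrm_sqr// dot_sq//.
rewrite sqrrD !exprMn !nrm_sqr// !real_normK ?num_real//.
have : 2 * a * b * dot f g <= 2 * (`|a| * nrm f * (`|b| * nrm g)).
  apply: le_trans (ler_norm _) _; rewrite !normrM (ger0_norm (_ : 0 <= 2))//.
  have := ler_wpM2l (mulr_ge0 (normr_ge0 a) (normr_ge0 b)) (cauchy_schwarz Lf Lg).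
  lra.
rewrite mulr2n; lra.
Qed.

Lemma nrm_ext f g : (forall x, 0 < x < 1 -> f x = g x) -> nrm f = nrm g.
Proof.
move=> E; rewrite /L2rho_norm; congr Num.sqrt; apply: eq_Rintegral => x.
by rewrite inE /= in_itv /= => xi; rewrite E.
Qed.

Lemma nrm_aeext f g : measurable_fun I01 f -> measurable_fun I01 g ->
  ae01 (fun x => f x = g x) -> nrm f = nrm g.
Proof.
move=> mf mg E; rewrite !nrmE /L2rho_dot; congr Num.sqrt; apply: ae_Rint01.
- by apply: mes_mul mes_rho; exact: mes_mul.
- by apply: mes_mul mes_rho; exact: mes_mul.
by apply: aefilterS E => x H /H ->.
Qed.

Lemma L2_bounded f B : measurable_fun I01 f -> (forall x, 0 <= x <= 1 -> `|f x| <= B) ->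
  L2rho rho f /\ nrm f <= B * Num.sqrt (nu sg 1).
Proof.
move=> mf HB; have B0 : 0 <= B := le_trans (normr_ge0 _) (HB 0 (zero01 R)).
have iB : mu.-integrable I01 (EFin \o (fun z => B ^+ 2 * sg z)) by apply: intZ => //; exact: sg_int.
have P x : I01 x -> `|f x * f x * rho x| <= B ^+ 2 * sg x.
  rewrite /= in_itv /= => /andP[x0 x1]; rewrite !normrM ler_wpM2r// expr2 ler_pM// HB// !ltW//.
have mff : measurable_fun I01 (fun x => f x * f x * rho x).
  by apply: mes_mul mes_rho; exact: mes_mul.
have iff : mu.-integrable I01 (EFin \o (fun x => f x * f x * rho x)).
  apply: le_integrable iB => //; first exact/measurable_EFinP.
  move=> x xi; rewrite /= lee_fin; apply: le_trans (P x xi) _; exact: ler_norm.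
split; first exact/L2P.
rewrite nrmE -[B]ger0_norm// -sqrtr_sqr -sqrtrM ?sqr_ge0//; apply: ler_wsqrtr.
rewrite nu_norm1// -RintegralZl//; last exact: sg_int.
by apply: le_Rintegral => // x xi; apply: le_trans (P x xi); exact: ler_norm.
Qed.

Lemma L2_Lip f B : Lip B f -> L2rho rho f /\ nrm f <= B * Num.sqrt (nu sg 1).
Proof.
move=> H; apply: L2_bounded; last by move=> x xi; case: (H x x xi xi).
by apply: (@lip_measurable _ B) => x y xi yi; case: (H x y xi yi).
Qed.

(** The weight is positive almost everywhere, so f vanishes almost
    everywhere; a nonzero value would persist on an interval. *)
Lemma nrm0_Lip f B : Lip B f -> nrm f = 0 -> forall x, 0 <= x <= 1 -> f x = 0.
Proof.
move=> H n0 x xi; have [Lf _] := L2_Lip H; have B0 := Lip_ge0 H.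
have d0 : dot f f = 0 by rewrite -nrm_sqr// n0 expr0n.
have mff : measurable_fun I01 (fun x => f x * f x * rho x).
  by apply: mes_mul mes_rho; apply: mes_mul; exact: L2_mes.
have aef : ae01 (fun z => f z = 0).
  have iff := L2_int Lf Lf.
  have : (\int[mu]_(z in I01) `|(f z * f z * rho z)%:E| = 0)%E.
    have fin := @integrable_fin_num _ _ _ mu I01 (measurable_itv _) _ (norm_int iff).
    rewrite -(fineK fin); congr EFin.
    rewrite -[RHS]d0; apply: ae_Rint01 => //; first exact: measurableT_comp.
    by apply: aefilterS rho_gt0 => z Hz /Hz r0; rewrite ger0_norm// mulr_ge0 ?(ltW r0)// -expr2 sqr_ge0.
  have mE : measurable_fun I01 (EFin \o (fun z => f z * f z * rho z)) by exact/measurable_EFinP.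
  move=> /(iffLR (ae_eq_integral_abs mu (measurable_itv _) mE)).
  apply: aefilterS2 rho_gt0 => z Hz Kz zi.
  have /eqP := Kz zi; rewrite /= eqe mulf_eq0 (gt_eqF (Hz zi)) orbF mulf_eq0 orbb.
  by move/eqP.
apply/eqP; apply: contraT => fx.
pose d := `|f x| / (B + 1).
have d0' : 0 < d by rewrite divr_gt0 ?normr_gt0// ltr_wpDl.
pose a := Num.max 0 (x - d); pose b := Num.min 1 (x + d).
have /andP[x0 x1] := xi.
have ab : a < b.
  by rewrite /a /b gt_max !lt_min ltr01 /=; apply/andP; split; [|apply/andP; split]; lra.
have [N [mN N0 HN]] := aef.
have sub : `]a, b[ `<=` N.
  move=> z; rewrite /= in_itv /= /a /b gt_max lt_min => /andP[/andP[z0 zx] /andP[z1 zx']].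
  apply: HN => /=; apply/not_implyP; split; first by rewrite in_itv /= z0 z1.
  move=> fz.
  have zi : 0 <= z <= 1 by rewrite !ltW.
  have [_] := H x z xi zi; rewrite fz sub0r normrN => K.
  have : `|z - x| < d by rewrite ltr_norml; apply/andP; split; lra.
  rewrite /d ltr_pdivlMr ?ltr_wpDl// => K2.
  have : B * `|z - x| <= `|z - x| * (B + 1) by rewrite mulrC ler_wpM2l// lerDl.
  lra.
have : (mu `]a, b[ <= mu N)%E by apply: le_measure => //; rewrite inE.
by rewrite N0 lebesgue_measure_itv /= lte_fin ab -EFinB lee_fin leNgt subr_gt0 ab.
Qed.

Lemma dot_prim f g : measurable_fun I01 f -> measurable_fun I01 g ->
  dot f g = \int[mu]_(z in `[0, 1]) (sg z * (f z * g z)).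
Proof.
move=> mf mg; have mfg : measurable_fun I01 (fun z => f z * g z) by exact: mes_mul.
have ms : measurable_fun I01 sg by apply/measurable_EFinP; exact: measurable_int sg_int.
have m2 : measurable_fun I01 (fun z => sg z * (f z * g z)) by exact: mes_mul.
transitivity (\int[mu]_(z in I01) (sg z * (f z * g z))).
  apply: ae_Rint01 => //; first by apply: mes_mul mes_rho.
  by apply: aefilterS rho_sg => z H /H ->; rewrite mulrC.
rewrite /Rintegral; congr fine; apply/esym.
by apply: (@integral_itv_bndoo R 0 1 (EFin \o (fun z => sg z * (f z * g z)))); exact/measurable_EFinP.
Qed.

Lemma LipM B C f g : Lip B f -> Lip C g -> Lip (2 * (B * C)) (fun x => f x * g x).
Proof.
move=> Hf Hg x y xi yi; have B0 := Lip_ge0 Hf; have C0 := Lip_ge0 Hg.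
have [f1 f2] := Hf x y xi yi; have [g1 g2] := Hg x y xi yi.
have [g3 _] := Hg y x yi xi.
split; first by rewrite normrM; have := ler_pM (normr_ge0 _) (normr_ge0 _) f1 g1; have := mulr_ge0 B0 C0; lra.
have -> : f y * g y - f x * g x = (f y - f x) * g y + f x * (g y - g x) by ring.
apply: le_trans (ler_normD _ _) _; rewrite !normrM.
have := ler_pM (normr_ge0 _) (normr_ge0 _) f2 g3.
have := ler_pM (normr_ge0 _) (normr_ge0 _) f1 g2.
lra.
Qed.

Lemma Lip_lin B C f g a b : Lip B f -> Lip C g -> Lip (`|a| * B + `|b| * C) (fun x => a * f x + b * g x).
Proof.
move=> Hf Hg x y xi yi; have [f1 f2] := Hf x y xi yi; have [g1 g2] := Hg x y xi yi.
split.
  by apply: le_trans (ler_normD _ _) _; rewrite !normrM lerD// ler_wpM2l.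
have -> : a * f y + b * g y - (a * f x + b * g x) = a * (f y - f x) + b * (g y - g x) by ring.
apply: le_trans (ler_normD _ _) _; rewrite !normrM mulrDl -!mulrA.
by rewrite lerD// ler_wpM2l.
Qed.

Lemma sprim2_Lip0 B f f1 w : sprim2 (nu sg) B f f1 w -> Lip B f.
Proof.
move=> H x y xi yi; split; first by case: (H x y xi yi) => -[].
apply: (mvt_bound (sprim2_wderiv sg_int H)) => // z zi.
by case: (H z z zi zi) => -[].
Qed.

(** Green's formula for the operator f'' / rho: [green_sprim] integrated
    over [0, 1]. *)
Lemma green_dot B C f f1 w h h1 v : sprim2 (nu sg) B f f1 w -> sprim2 (nu sg) C h h1 v ->
  (f 1 * h1 1 - h 1 * f1 1) - (f 0 * h1 0 - h 0 * f1 0) = dot f v - dot h w.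
Proof.
move=> Hf Hh; have sp := green_sprim Hf Hh.
have Lw := sprim2_Lip Hf; have Lv := sprim2_Lip Hh.
have Lf := sprim2_Lip0 Hf; have Lh := sprim2_Lip0 Hh.
have L1 := LipM Lf Lv; have L2 := LipM Lh Lw.
have Lk : Lip (`|1| * (2 * (B * C)) + `|-1| * (2 * (C * B))) (fun x => f x * v x - h x * w x).
  move=> x y xi yi; have := @Lip_lin _ _ _ _ 1 (-1) L1 L2 x y xi yi; rewrite !mul1r !mulN1r; exact.
have H1 : 0 <= (1 : R) <= 1 by rewrite ler01 lexx.
rewrite (sprim_int sg_ge0 sg_int Lk sp H1).
have m (D : R) u : Lip D u -> measurable_fun I01 u by move=> L; apply: L2_mes (L2_Lip L).1.
rewrite (dot_prim (m _ _ Lf) (m _ _ Lv)) (dot_prim (m _ _ Lh) (m _ _ Lw)).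
have i1 := integrable01_cc (int_sgw sg_int L1).
have i2 := integrable01_cc (int_sgw sg_int L2).
rewrite -RintegralB//; apply: eq_Rintegral => x _; ring.
Qed.

End WeightedL2.

(** * Orthonormal families *)
Section Orthonormal.
Set Implicit Arguments. Unset Strict Implicit. Unset Printing Implicit Defensive.
Variable R : realType.
Local Notation mu := (@lebesgue_measure R).
Local Notation I01 := (`]0%R, 1%R[%classic : set R).
Implicit Types (f g h : R -> R).

Variable rho : R -> R.
Hypothesis rho_int : mu.-integrable I01 (EFin \o rho).
Hypothesis rho_gt0 : ae01 (fun x => 0 < rho x).
Local Notation dot := (L2rho_dot rho).
Local Notation nrm := (L2rho_norm rho).

Variable e : nat -> R -> R.
Hypothesis Le : forall n, L2rho rho (e n).
Hypothesis ON : forall m n, dot (e m) (e n) = (m == n)%:R.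

Definition fsum (a : nat -> R) N : R -> R := fun x => \sum_(k < N) a k * e k x.

Lemma fsumS a N : fsum a N.+1 = (fun x => 1 * fsum a N x + a N * e N x).
Proof. by apply/funext => x; rewrite /fsum big_ord_recr /= mul1r. Qed.

Lemma dot0 f : dot (fun=> 0) f = 0.
Proof.
rewrite /L2rho_dot (_ : (fun x => 0 * f x * rho x) = (fun=> 0)); last by apply/funext => x; rewrite !mul0r.
by rewrite /Rintegral integral0.
Qed.

Lemma L2_0 : L2rho rho (fun=> 0).
Proof.
have [] // := @L2_bounded _ _ rho_int rho_gt0 (fun=> 0) 0 _ _.
by move=> x _; rewrite normr0.
Qed.

Lemma L2_fsum a N : L2rho rho (fsum a N).
Proof.
elim: N => [|N IH]; last by rewrite fsumS; exact: L2_lin.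
by rewrite (_ : fsum a 0 = (fun=> 0)); [exact: L2_0|apply/funext => x; rewrite /fsum big_ord0].
Qed.

Lemma dot_fsum a N f : L2rho rho f -> dot (fsum a N) f = \sum_(k < N) a k * dot (e k) f.
Proof.
move=> Lf; elim: N => [|N IH].
  rewrite big_ord0 (_ : fsum a 0 = (fun=> 0)) ?dot0//.
  by apply/funext => x; rewrite /fsum big_ord0.
by rewrite fsumS dotD ?IH ?mul1r ?big_ord_recr//; exact: L2_fsum.
Qed.

Lemma dot_fsum_e a N m : dot (fsum a N) (e m) = if (m < N)%N then a m else 0.
Proof.
rewrite dot_fsum//; case: ltnP => mN.
  rewrite (bigD1 (Ordinal mN)) //= ON eqxx mulr1 big1 ?addr0// => k km.
  rewrite ON [_ == m](negbTE _) ?mulr0//.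
rewrite big1// => k _; rewrite ON ltn_eqF ?mulr0//.
exact: leq_trans (ltn_ord k) mN.
Qed.

Lemma dot_fsum_fsum a N : dot (fsum a N) (fsum a N) = \sum_(k < N) a k ^+ 2.
Proof.
rewrite dot_fsum; last exact: L2_fsum.
by apply: eq_bigr => k _; rewrite dotC dot_fsum_e ltn_ord expr2.
Qed.

Lemma dot_minus_fsum f a N : L2rho rho f ->
  dot (fun x => f x - fsum a N x) (fun x => f x - fsum a N x) =
  dot f f - 2 * \sum_(k < N) a k * dot f (e k) + \sum_(k < N) a k ^+ 2.
Proof.
move=> Lf; have LS := L2_fsum a N.
have -> : (fun x => f x - fsum a N x) = (fun x => 1 * f x + (-1) * fsum a N x).
  by apply/funext => x; rewrite mul1r mulN1r.
rewrite dot_sq// dot_fsum_fsum [dot f (fsum _ _)]dotC dot_fsum//.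
under eq_bigr do rewrite [dot (e _) f]dotC.
ring.
Qed.

Lemma bessel f N : L2rho rho f -> \sum_(k < N) dot f (e k) ^+ 2 <= dot f f.
Proof.
move=> Lf; have LS := L2_fsum (fun k => dot f (e k)) N.
have : 0 <= dot (fun x => f x - fsum (fun k => dot f (e k)) N x) (fun x => f x - fsum (fun k => dot f (e k)) N x).
  apply: dot_ge0 => //.
  have -> : (fun x => f x - fsum (fun k => dot f (e k)) N x) = (fun x => 1 * f x + (-1) * fsum (fun k => dot f (e k)) N x).
    by apply/funext => x; rewrite mul1r mulN1r.
  exact: L2_lin.
rewrite dot_minus_fsum//; under [X in 2 * X]eq_bigr do rewrite -expr2.
lra.
Qed.

Lemma L2_sub f g : L2rho rho f -> L2rho rho g -> L2rho rho (fun x => f x - g x).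
Proof.
move=> Lf Lg; have -> : (fun x => f x - g x) = (fun x => 1 * f x + (-1) * g x).
  by apply/funext => x; rewrite mul1r mulN1r.
exact: L2_lin.
Qed.

Lemma nrm_tri f g h : L2rho rho f -> L2rho rho g -> L2rho rho h ->
  nrm (fun x => f x - h x) <= nrm (fun x => f x - g x) + nrm (fun x => g x - h x).
Proof.
move=> Lf Lg Lh; have := nrm_lin rho_int rho_gt0 1 1 (L2_sub Lf Lg) (L2_sub Lg Lh).
rewrite normr1 !mul1r; congr (_ <= _); apply: nrm_ext => x _; ring.
Qed.

(** Among the combinations of e_0, ..., e_(n-1), the best approximation of
    a function orthogonal to all of them is 0. *)
Lemma dense_dot0 f : (forall h, L2rho rho h -> forall eps : R, 0 < eps ->
        exists (n : nat) (a : nat -> R), nrm (fun x => h x - \sum_(k < n) a k * e k x) < eps) ->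
  L2rho rho f -> (forall n, dot f (e n) = 0) -> nrm f = 0.
Proof.
move=> dense Lf H; apply/eqP; rewrite eq_le nrm_ge0 andbT.
apply/ler_addgt0Pl => eps eps0; rewrite addr0.
have [n [a Ha]] := dense f Lf eps eps0.
apply: le_trans (ltW Ha).
have L := L2_sub Lf (L2_fsum a n).
rewrite -(@ler_pXn2r _ 2)// ?nnegrE ?nrm_ge0// !nrm_sqr//.
rewrite [leRHS](dot_minus_fsum a n Lf) big1 ?mulr0 ?subr0 ?lerDl ?sumr_ge0//.
- by move=> i _; rewrite sqr_ge0.
- by move=> i _; rewrite H mulr0.
Qed.

Lemma fsum_tail a N M eps : (N <= M)%N -> 0 <= eps ->
  \sum_(N <= k < M) a k ^+ 2 <= eps ^+ 2 ->
  nrm (fun x => fsum a M x - fsum a N x) <= eps.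
Proof.
move=> NM eps0 H.
pose b k := if (k < N)%N then 0 else a k.
have E : (fun x => fsum a M x - fsum a N x) = fsum b M.
  apply/funext => x.
  have S c M' : fsum c M' x = \sum_(0 <= k < M') c k * e k x by rewrite big_mkord.
  rewrite !S (@big_cat_nat _ _ _ N 0 M)//= addrAC subrr add0r.
  rewrite (@big_cat_nat _ _ _ N 0 M)//= [X in _ = X + _](_ : _ = 0) ?add0r.
    apply: eq_big_nat => k /andP[Nk _]; by rewrite /b ltnNge Nk.
  by rewrite big_nat_cond big1// => k /andP[/andP[_ kN] _]; rewrite /b kN mul0r.
have Ls := L2_fsum b M.
rewrite E -(@ler_pXn2r _ 2)// ?nnegrE ?nrm_ge0// nrm_sqr// dot_fsum_fsum.
rewrite -(big_mkord xpredT (fun k => b k ^+ 2)) (@big_cat_nat _ _ _ N 0 M)//=.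
rewrite big_nat_cond big1 ?add0r; last first.
  by move=> k /andP[/andP[_ kN] _]; rewrite /b kN expr0n.
apply: le_trans H; rewrite le_eqVlt; apply/orP; left; apply/eqP.
by apply: eq_big_nat => k /andP[Nk _]; rewrite /b ltnNge Nk.
Qed.

(** Parseval for the remainder, without identifying the coefficients of f:
    it is used both for u_0 and for the free evolution at time t, with a rank N
    that does not depend on t. *)
Lemma series_tail f a N eps : L2rho rho f -> 0 <= eps ->
  (nrm (fun x => f x - fsum a M x) @[M --> \oo] --> (0 : R)) ->
  (forall M, (N <= M)%N -> \sum_(N <= k < M) a k ^+ 2 <= eps ^+ 2) ->
  nrm (fun x => f x - fsum a N x) <= eps.
Proof.
move=> Lf eps0 /cvgrPdist_lt H T.
apply/ler_addgt0Pl => d d0.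
have := H d d0 => -[M0 _ HM].
pose M := maxn M0 N.
have NM : (N <= M)%N by rewrite leq_maxr.
have := HM M; rewrite /= leq_maxl sub0r normrN => /(_ isT).
rewrite ger0_norm ?nrm_ge0// => H1.
have := nrm_tri Lf (L2_fsum a M) (L2_fsum a N).
have := fsum_tail NM eps0 (T M NM).
lra.
Qed.

End Orthonormal.

(** * Growth of the generating functions *)
Section Generating.
Set Implicit Arguments. Unset Strict Implicit. Unset Printing Implicit Defensive.
Variable R : realType.
Local Notation mu := (@lebesgue_measure R).
Local Notation I01 := (`]0%R, 1%R[%classic : set R).

Section Growth.
Variable sg : R -> R.
Hypothesis sg_ge0 : forall x, 0 <= sg x.
Hypothesis sg_int : mu.-integrable I01 (EFin \o sg).

(** The weight x^k nu(x)^k in the bound is what makes [sprim2_growth]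
    gain the factor 1 / (k+1) twice.  The scalar q serves the remainders of the
    eigenfunction expansion, where q = - lam; for the g_i it is 1. *)
Lemma iter_growth (f f1 : nat -> R -> R) (q B : R) : 0 <= B ->
  (forall x, 0 <= x <= 1 -> `|f 0%N x| <= B) ->
  (forall k, exists B', sprim2 (nu sg) B' (f k.+1) (f1 k.+1) (fun x => q * f k x)) ->
  (forall k, f k.+1 0 = 0 /\ f1 k.+1 0 = 0) ->
  forall k x, 0 <= x <= 1 ->
    `|f k x| <= B * `|q| ^+ k / k`!%:R ^+ 2 * (x ^+ k * nu sg x ^+ k) /\
    `|f1 k.+1 x| <= B * `|q| ^+ k.+1 / k`!%:R ^+ 2 * (x ^+ k * nu sg x ^+ k.+1) / k.+1%:R.
Proof.
move=> B0 H0 Hr Hz.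
have nd := nu_nd sg_ge0 sg_int; have n0 := nu_0 sg.
have M0 k : 0 <= B * `|q| ^+ k / k`!%:R ^+ 2 by rewrite divr_ge0 ?mulr_ge0 ?exprn_ge0.
have step k : (forall x, 0 <= x <= 1 -> `|f k x| <= B * `|q| ^+ k / k`!%:R ^+ 2 * (x ^+ k * nu sg x ^+ k)) ->
  forall x, 0 <= x <= 1 ->
  `|f1 k.+1 x| <= B * `|q| ^+ k.+1 / k`!%:R ^+ 2 * (x ^+ k * nu sg x ^+ k.+1) / k.+1%:R /\
  `|f k.+1 x| <= B * `|q| ^+ k.+1 / k.+1`!%:R ^+ 2 * (x ^+ k.+1 * nu sg x ^+ k.+1).
  move=> IH x xi; have [B' HB] := Hr k; have [z1 z2] := Hz k.
  have Mq : 0 <= `|q| * (B * `|q| ^+ k / k`!%:R ^+ 2) by rewrite mulr_ge0.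
  have Hw z : 0 <= z <= 1 -> `|q * f k z| <= `|q| * (B * `|q| ^+ k / k`!%:R ^+ 2) * (z ^+ k * nu sg z ^+ k).
    by move=> zi; rewrite normrM -mulrA ler_wpM2l// IH.
  have [G1 G2] := sprim2_growth nd n0 HB z1 z2 Mq Hw xi.
  have kn : (k`!%:R : R) != 0 by rewrite pnatr_eq0 -lt0n fact_gt0.
  have kn1 : (k.+1%:R : R) != 0 by [].
  split.
    by apply: le_trans G1 _; rewrite le_eqVlt; apply/orP; left; apply/eqP; rewrite !exprS; ring.
  apply: le_trans G2 _; rewrite le_eqVlt; apply/orP; left; apply/eqP.
  by rewrite factS natrM exprMn [`|q| ^+ k.+1]exprS; field; rewrite kn nat1r kn1.
have A k : forall x, 0 <= x <= 1 -> `|f k x| <= B * `|q| ^+ k / k`!%:R ^+ 2 * (x ^+ k * nu sg x ^+ k).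
  elim: k => [|k IH] x xi; last by case: (step k IH x xi).
  by rewrite !expr0 fact0 expr1n divr1 !mulr1 H0.
move=> k x xi; split; first exact: A.
by case: (step k (A k) x xi).
Qed.

(** The derivative lacks one factor 1 / (k+1), which is absorbed
    into the geometric factor since k+1 <= 2^(k+1). *)
Lemma iter_growth_unif (f f1 : nat -> R -> R) (q B : R) : 0 <= B ->
  (forall x, 0 <= x <= 1 -> `|f 0%N x| <= B /\ `|f1 0%N x| <= B) ->
  (forall k, exists B', sprim2 (nu sg) B' (f k.+1) (f1 k.+1) (fun x => q * f k x)) ->
  (forall k, f k.+1 0 = 0 /\ f1 k.+1 0 = 0) ->
  forall k x, 0 <= x <= 1 ->
    `|f k x| <= B * (2 * (nu sg 1 + 1) * `|q|) ^+ k / k`!%:R ^+ 2 /\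
    `|f1 k x| <= B * (2 * (nu sg 1 + 1) * `|q|) ^+ k / k`!%:R ^+ 2.
Proof.
move=> B0 H0 Hr Hz k x xi.
have nd := nu_nd sg_ge0 sg_int; have n0 := nu_0 sg.
have G := iter_growth B0 (fun x xi => (H0 x xi).1) Hr Hz.
have [x0 x1] := andP xi.
have N0 : 0 <= nu sg 1 by rewrite -n0 nd.
have nx : nu sg x <= nu sg 1 + 1 by apply: le_trans (nd _ _ x0 x1 (lexx _)) _; rewrite lerDl.
have nx0 : 0 <= nu sg x by apply: nu_ge0.
have M1 : 1 <= nu sg 1 + 1 by rewrite lerDr.
have k2 j : 0 < (j`!%:R : R) ^+ 2 by rewrite exprn_gt0// ltr0n fact_gt0.
split.
  apply: le_trans (G k x xi).1 _.
  rewrite -!mulrA; apply: ler_wpM2l => //; rewrite mulrCA [leRHS]mulrC; apply: ler_wpM2l; first by rewrite invr_ge0 ltW.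
  rewrite mulrCA mulrA -!exprMn; apply: lerXn2r; rewrite ?nnegrE ?mulr_ge0 ?addr_ge0//.
  have : x * (nu sg x * `|q|) <= (nu sg 1 + 1) * `|q|.
    rewrite mulrA ler_wpM2r//; apply: le_trans nx; rewrite ler_piMl//.
  have : 0 <= (nu sg 1 + 1) * `|q| by rewrite mulr_ge0 ?addr_ge0.
  rewrite [_ * `|q|]mulrC; lra.
case: k => [|k]; first by rewrite expr0 fact0 expr1n divr1 mulr1; case: (H0 x xi).
apply: le_trans (G k x xi).2 _.
have E : B * `|q| ^+ k.+1 / k`!%:R ^+ 2 * (x ^+ k * nu sg x ^+ k.+1) / k.+1%:R =
   (B * `|q| ^+ k.+1 / k.+1`!%:R ^+ 2) * (k.+1%:R * (x ^+ k * nu sg x ^+ k.+1)).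
  by rewrite factS natrM; field; rewrite nat1r !pnatr_eq0 -!lt0n fact_gt0.
rewrite E exprMn mulrA [leRHS]mulrC [leRHS]mulrA [leRHS]mulrC !mulrA.
have C0 : 0 <= B * `|q| ^+ k.+1 / k.+1`!%:R ^+ 2 by rewrite divr_ge0 ?mulr_ge0 ?exprn_ge0.
suff : k.+1%:R * (x ^+ k * nu sg x ^+ k.+1) <= (2 * (nu sg 1 + 1)) ^+ k.+1.
  move=> /(ler_wpM2l C0) H; move: H; rewrite !mulrA => /le_trans; apply.
  by rewrite le_eqVlt; apply/orP; left; apply/eqP; ring.
rewrite exprMn; apply: ler_pM => //.
- by rewrite mulr_ge0 ?exprn_ge0.
- by rewrite -natrX ler_nat; apply: ltnW; apply: ltn_expl.
- have : x ^+ k <= 1 by rewrite exprn_ile1.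
  have : nu sg x ^+ k.+1 <= (nu sg 1 + 1) ^+ k.+1 by rewrite lerXn2r// ?nnegrE ?addr_ge0.
  have p0 : 0 <= nu sg x ^+ k.+1 by rewrite exprn_ge0.
  move=> h1 h2; apply: le_trans h1; rewrite ler_piMl//.
Qed.

End Growth.

Variables (p : \bar R) (rho : R -> R).
Hypothesis p_gt1 : (1 < p)%E.
Hypothesis rho_Lp : Lp01 p rho.
Hypothesis rho_gt0 : ae01 (fun x => 0 < rho x).
Let sg : R -> R := fun z => `|rho z|.

Lemma rho_int : mu.-integrable I01 (EFin \o rho).
Proof. by have [] := Lp01_int p_gt1 rho_Lp. Qed.

Lemma sg_ge0' x : 0 <= sg x. Proof. by rewrite /sg. Qed.

Lemma sg_Lp : Lp01 p sg.
Proof.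
have p0 : (0 < p)%E by apply: lt_trans p_gt1; rewrite lte_fin.
have ms : measurable_fun I01 sg.
  by apply/measurable_EFinP; apply: (measurable_int mu); exact: norm_int rho_int.
have H : ae01 (fun x => `|sg x| <= 1 * `|rho x|) by apply: nearW => x _; rewrite mul1r /sg normr_id.
by have [] := Lp01_mono p0 ler01 ms rho_Lp H.
Qed.

Lemma sg_int' : mu.-integrable I01 (EFin \o sg). Proof. by have [] := Lp01_int p_gt1 sg_Lp. Qed.

Lemma W2p_sprim2_rho f w : W2p p f -> (exists B, Lip B w) -> ae01 (fun x => D2 f x = rho x * w x) ->
  exists B', sprim2 (nu sg) B' f (D01 f) w.
Proof.
move=> Wf [B Lw] H; apply: (W2p_sprim2 p_gt1 sg_ge0' sg_Lp Wf Lw).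
apply: aefilterS2 H (rho_sg rho_gt0) => x H1 H2 xi; by rewrite H1// H2.
Qed.

Section Gen.
Variables (alpha0 beta0 : R) (g : nat -> R -> R).
Hypothesis gen : generating_functions p rho alpha0 beta0 g.

(** The function w with g_i'' = rho w. *)
Definition gprev (i : nat) : R -> R := if i is j.+1 then g j else (fun=> 0).

Lemma gen_sprim2 i : exists B, sprim2 (nu sg) B (g i) (D01 (g i)) (gprev i).
Proof.
have [W [D0 _ _] DS] := gen.
case: i => [|i]; apply: W2p_sprim2_rho => //=.
- by exists 0 => x y _ _; rewrite subrr normr0 mul0r.
- by apply: aefilterS D0 => x H /H ->; rewrite mulr0.
- exact: W2p_Lip (W i).
- by have [] := DS i.
Qed.

Lemma gen_bounds : exists B, 0 <= B /\ forall i x, 0 <= x <= 1 ->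
  `|g i x| <= B * (2 * (nu sg 1 + 1)) ^+ i / i`!%:R ^+ 2 /\
  `|D01 (g i) x| <= B * (2 * (nu sg 1 + 1)) ^+ i / i`!%:R ^+ 2.
Proof.
have [B HB] := gen_sprim2 0; exists B; split; first exact: sprim2_ge0 HB.
have [_ _ DS] := gen.
move=> i x xi.
have H0 z : 0 <= z <= 1 -> `|g 0%N z| <= B /\ `|D01 (g 0%N) z| <= B.
  by move=> zi; case: (HB z z zi zi).
have := @iter_growth_unif sg sg_ge0' sg_int' g (fun i => D01 (g i)) 1 B (sprim2_ge0 HB) H0 _ _ i x xi.
rewrite normr1 mulr1; apply.
- move=> k; have [B' HB'] := gen_sprim2 k.+1; exists B'.
  by apply: sprim2_ext HB' => z _; rewrite /= mul1r.
- by move=> k; have [_ ? ?] := DS k.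
Qed.

(** The bound must dominate g_(i-1) too, which enters through the
    second derivative; the quotient i^2 of the two factorials squared is absorbed
    into 4^i. *)
Lemma gen_sprim2_unif : exists C K, [/\ 0 <= C, 0 <= K &
  forall i, sprim2 (nu sg) (C * K ^+ i / i`!%:R ^+ 2) (g i) (D01 (g i)) (gprev i)].
Proof.
have [B [B0 HB]] := gen_bounds.
have N0 : 0 <= nu sg 1 by rewrite -(nu_0 sg); apply: (nu_nd sg_ge0' sg_int').
pose L := 2 * (nu sg 1 + 1).
have L1 : 1 <= L by rewrite /L; lra.
have L0 : 0 <= L by lra.
exists B, (4 * L); split => //; first by rewrite mulr_ge0.
move=> i; have [B' H] := gen_sprim2 i.
pose Hi j := B * L ^+ j / j`!%:R ^+ 2.
have Hi0 j : 0 <= Hi j by rewrite /Hi divr_ge0 ?mulr_ge0 ?exprn_ge0.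
have GH j : Hi j <= B * (4 * L) ^+ j / j`!%:R ^+ 2.
  rewrite /Hi ler_wpM2r ?invr_ge0 ?exprn_ge0// ler_wpM2l//.
  by apply: lerXn2r; rewrite ?nnegrE; lra.
have GHS j : Hi j <= B * (4 * L) ^+ j.+1 / j.+1`!%:R ^+ 2.
  have jn : (j`!%:R : R) != 0 by rewrite pnatr_eq0 -lt0n fact_gt0.
  have -> : Hi j = B * (j.+1%:R ^+ 2 * L ^+ j) / j.+1`!%:R ^+ 2.
    by rewrite /Hi factS natrM; field; rewrite jn nat1r pnatr_eq0.
  have h1 : (j.+1%:R : R) ^+ 2 <= 4 ^+ j.+1.
    have -> : (4 : R) ^+ j.+1 = (2 ^+ j.+1) ^+ 2.
      by rewrite -exprM mulnC exprM; congr (_ ^+ _); rewrite expr2; lra.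
    by apply: lerXn2r; rewrite ?nnegrE ?exprn_ge0// -natrX ler_nat; apply: ltnW; apply: ltn_expl.
  have h2 : L ^+ j <= L ^+ j.+1 by rewrite exprS ler_peMl// exprn_ge0.
  have h3 : j.+1%:R ^+ 2 * L ^+ j <= (4 * L) ^+ j.+1.
    by rewrite [leRHS]exprMn; apply: ler_pM => //; rewrite exprn_ge0.
  by apply: ler_wpM2r; [rewrite invr_ge0 exprn_ge0|exact: ler_wpM2l].
have LipH j : Lip (Hi j) (g j).
  have [Bj Hj] := gen_sprim2 j.
  move=> x y xi yi; split; first by case: (HB j x xi).
  apply: (mvt_bound (sprim2_wderiv sg_int' Hj)) => // z zi.
  by case: (HB j z zi).
apply: (sprim2_sharp sg_ge0' sg_int' H).
  case: i {H} => [|i] /=.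
    by move=> x y _ _; rewrite expr0 fact0 expr1n divr1 mulr1 subrr normr0 mulr_ge0.
  move=> x y xi yi; have [h1 h2] := LipH i x y xi yi; split; first exact: le_trans (GHS i).
  by apply: le_trans h2 _; rewrite ler_wpM2r.
by move=> x xi; have [h1 h2] := HB i x xi; split; [exact: le_trans (GH i)|exact: le_trans (GH i)].
Qed.

End Gen.
End Generating.

(** * Eigenfunctions and their boundary coefficients *)
Section Eigenfunctions.
Set Implicit Arguments. Unset Strict Implicit. Unset Printing Implicit Defensive.
Variable R : realType.
Local Notation mu := (@lebesgue_measure R).
Local Notation I01 := (`]0%R, 1%R[%classic : set R).

(** The vectors (a, b) and (b, -a) form an orthogonal basis of the
    plane. *)
Lemma initial_data_uniq (a b f f' g g' z : R) : (a, b) != (0, 0) ->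
  a * f + b * f' = 0 -> b * f - a * f' = z ->
  a * g + b * g' = 0 -> b * g - a * g' = 1 -> f = z * g /\ f' = z * g'.
Proof.
move=> ab aff1 h2 h3 h4.
have D0 : a ^+ 2 + b ^+ 2 != 0.
  apply: contra ab; rewrite paddr_eq0 ?sqr_ge0// !sqrf_eq0 => /andP[/eqP -> /eqP ->].
  by rewrite eqxx.
split; apply: (mulfI D0).
- have -> : (a ^+ 2 + b ^+ 2) * f = a * (a * f + b * f') + b * (b * f - a * f') by ring.
  have -> : (a ^+ 2 + b ^+ 2) * (z * g) = z * (a * (a * g + b * g') + b * (b * g - a * g')) by ring.
  by rewrite aff1 h2 h3 h4; ring.
- have -> : (a ^+ 2 + b ^+ 2) * f' = b * (a * f + b * f') - a * (b * f - a * f') by ring.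
  have -> : (a ^+ 2 + b ^+ 2) * (z * g') = z * (b * (a * g + b * g') - a * (b * g - a * g')) by ring.
  by rewrite aff1 h2 h3 h4; ring.
Qed.

Lemma pow_gen_sum (q C K : R) : 0 <= C -> 0 <= K -> exists S, forall N,
  \sum_(i < N) `|q| ^+ i * (C * K ^+ i / i`!%:R ^+ 2) <= S.
Proof.
move=> C0 K0; have Q0 : 0 <= `|q| * K by rewrite mulr_ge0.
have [A A0 HA] := @sqr_fact_dominates R 0 _ (ltr0n _ 2) Q0.
exists (2 * (C * A)) => N.
apply: (@le_trans _ _ (\sum_(i < N) (2 ^+ i)^-1 * (C * A))).
  apply: ler_sum => i _; have := HA i; rewrite powRr0 mulr1 exprMn => /(ler_wpM2l C0) H.
  apply: le_trans (le_trans H _); rewrite le_eqVlt; apply/orP; left; apply/eqP; ring.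
by rewrite -mulr_suml ler_wpM2r ?geo_sum// mulr_ge0// ltW.
Qed.

Lemma cvg_dyadic (u : nat -> R) l A : (forall k, `|l - u k| <= A / 2 ^+ k) -> u @ \oo --> l.
Proof.
move=> H; apply/cvgrPdist_le => eps e0.
have [m Hm] : exists m : nat, `|A| / eps < m%:R.
  exists (Num.truncn (`|A| / eps)).+1; exact: truncnS_gt.
exists m => // k /= mk; apply: le_trans (H k) _.
have k2 : (m%:R : R) <= 2 ^+ k.
  rewrite -natrX ler_nat; apply: leq_trans mk _; apply: ltnW; exact: ltn_expl.
rewrite ler_pdivrMr ?exprn_gt0//; apply: le_trans (ler_norm _) _.
rewrite mulrC -ler_pdivrMr//; exact: le_trans (ltW Hm) k2.
Qed.

Lemma LipZ B a f : @Lip R B f -> Lip (`|a| * B) (fun x => a * f x).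
Proof.
move=> H x y xi yi; have [aff1 h2] := H x y xi yi; rewrite normrM -mulrBr normrM -mulrA.
by split; apply: ler_wpM2l.
Qed.

Variables (p : \bar R) (rho : R -> R).
Hypothesis p_gt1 : (1 < p)%E.
Hypothesis rho_Lp : Lp01 p rho.
Hypothesis rho_gt0 : ae01 (fun x => 0 < rho x).
Let sg : R -> R := fun z => `|rho z|.
Variables (alpha0 beta0 alpha1 beta1 : R) (g : nat -> R -> R).
Hypothesis ab0 : (alpha0, beta0) != (0, 0).
Hypothesis ab1 : (alpha1, beta1) != (0, 0).
Hypothesis gen : generating_functions p rho alpha0 beta0 g.

Let rI := rho_int p_gt1 rho_Lp.
Let sI := sg_int' p_gt1 rho_Lp.
Let s0 := sg_ge0' rho.

Lemma eigen_sprim2 lam e : eigenpair p rho alpha0 beta0 alpha1 beta1 lam e ->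
  exists B, sprim2 (nu sg) B e (D01 e) (fun x => - lam * e x).
Proof.
move=> [We aee _ _]; apply: (W2p_sprim2_rho p_gt1 rho_Lp rho_gt0 We).
- by have [B LB] := W2p_Lip We; exists (`|- lam| * B); exact: LipZ.
- apply: aefilterS aee => x H /H E.
  by rewrite -[LHS]opprK E; ring.
Qed.

(** The remainders r_k = e - zeta sum_(i<k) (-lam)^i g_i satisfy
    r_(k+1)'' = - lam rho r_k with zero Cauchy data at 0, so they decay like
    |lam|^k K^k / (k!)^2 by [iter_growth_unif]. *)
Lemma eigen_expansion lam e : eigenpair p rho alpha0 beta0 alpha1 beta1 lam e ->
  let z := beta0 * e 0 - alpha0 * D01 e 0 in
  forall x, 0 <= x <= 1 ->
  (fun k => z * \sum_(i < k) (- lam) ^+ i * g i x) @ \oo --> e x /\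
  (fun k => z * \sum_(i < k) (- lam) ^+ i * D01 (g i) x) @ \oo --> D01 e x.
Proof.
move=> ee z; have [B HB] := eigen_sprim2 ee; have [_ _ bc0 _] := ee.
have [_ [_ g0a g0b] DS] := gen.
have [I1 I2] := initial_data_uniq ab0 bc0 (erefl z) g0a g0b.
pose a (i : nat) := (- lam) ^+ i.
pose r k x := e x - z * \sum_(i < k) a i * g i x.
pose r1 k x := D01 e x - z * \sum_(i < k) a i * D01 (g i) x.
have B0 := sprim2_ge0 HB.
have E0 x : r 0%N x = e x by rewrite /r big_ord0 mulr0 subr0.
have E10 x : r1 0%N x = D01 e x by rewrite /r1 big_ord0 mulr0 subr0.
have Hr k : exists B', sprim2 (nu sg) B' (r k.+1) (r1 k.+1) (fun x => - lam * r k x).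
  have /choice[Bg HBg] := gen_sprim2 p_gt1 rho_Lp rho_gt0 gen.
  have HS := sprim2D HB (sprim2Z (- z) (sprim2_sum a HBg k.+1)).
  eexists; apply: sprim2_ext HS => x xi.
  split; rewrite ?mulNr// /r big_ord_recl /= mulr0 add0r.
  under eq_bigr => i _ do rewrite /a exprS -mulrA.
  by rewrite -mulr_sumr; ring.
have Hz k : r k.+1 0 = 0 /\ r1 k.+1 0 = 0.
  split.
    rewrite /r big_ord_recl /= I1 big1 ?addr0 /a ?expr0; first by ring.
    by move=> i _; have [_ -> _] := DS i; rewrite mulr0.
  rewrite /r1 big_ord_recl /= I2 big1 ?addr0 /a ?expr0; first by ring.
  by move=> i _; have [_ _ ->] := DS i; rewrite mulr0.
have H0 x : 0 <= x <= 1 -> `|r 0%N x| <= B /\ `|r1 0%N x| <= B.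
  by move=> xi; rewrite E0 E10; case: (HB x x xi xi).
have G := iter_growth_unif s0 sI B0 H0 Hr Hz.
have N0 : 0 <= nu sg 1 by rewrite -(nu_0 sg); apply: (nu_nd s0 sI).
have Q0 : 0 <= 2 * (nu sg 1 + 1) * `|- lam| by rewrite !mulr_ge0// addr_ge0.
have [A A0 HA] := @sqr_fact_dominates R 0 _ (ltr0n _ 2) Q0.
have K k : B * (2 * (nu sg 1 + 1) * `|- lam|) ^+ k / k`!%:R ^+ 2 <= B * A / 2 ^+ k.
  by have := HA k; rewrite powRr0 mulr1 => /(ler_wpM2l B0); rewrite !mulrA.
move=> x xi; split; apply: (@cvg_dyadic _ _ (B * A)) => k; apply: le_trans (K k).
- exact: (G k x xi).1.
- exact: (G k x xi).2.
Qed.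

(** An affine function with left boundary value 1. *)
Let aff (x : R) := (alpha0 + beta0 * x) / (alpha0 ^+ 2 + beta0 ^+ 2).
Let aff1 (x : R) := beta0 / (alpha0 ^+ 2 + beta0 ^+ 2).

Lemma D0_neq0 : alpha0 ^+ 2 + beta0 ^+ 2 != 0.
Proof.
apply: contra ab0; rewrite paddr_eq0 ?sqr_ge0// !sqrf_eq0 => /andP[/eqP -> /eqP ->].
by rewrite eqxx.
Qed.

Lemma aff_sprim2 : exists B, sprim2 (nu sg) B aff aff1 (fun=> 0).
Proof.
pose D := alpha0 ^+ 2 + beta0 ^+ 2.
exists ((`|alpha0| + `|beta0|) / `|D|) => x y xi yi.
have D0 : 0 < `|D| by rewrite normr_gt0; exact: D0_neq0.
have B0 : 0 <= (`|alpha0| + `|beta0|) / `|D| by rewrite divr_ge0 ?addr_ge0.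
split; [split| | | |].
- rewrite /aff -/D normrM normfV ler_pM2r ?invr_gt0//.
  apply: le_trans (ler_normD _ _) _; rewrite lerD2l normrM ler_piMr//.
  by have /andP[x0 x1] := xi; rewrite ger0_norm.
- by rewrite /aff1 -/D normrM normfV ler_pM2r ?invr_gt0// lerDr.
- by rewrite normr0.
- by rewrite subrr normr0 mulr_ge0.
- rewrite /aff /aff1 -/D (_ : _ - _ - _ = 0) ?normr0 ?mulr_ge0//; ring.
- by rewrite /aff1 subrr mul0r subr0 normr0 !mulr_ge0.
Qed.

Let B1 (f0 f1 : R) := alpha1 * f0 + beta1 * f1.

(** Two vectors annihilated by a nonzero linear form of the plane are
    proportional. *)
Lemma wronskian_eq0 (f f' k k' : R) : B1 f f' = 0 -> B1 k k' = 0 -> f * k' - k * f' = 0.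
Proof.
rewrite /B1 => H1 H2.
have [a0|a0] := eqVneq alpha1 0.
  have b0 : beta1 != 0.
    by apply: contra ab1 => /eqP b0; rewrite a0 b0.
  move: H1 H2; rewrite a0 !mul0r !add0r => /eqP; rewrite mulf_eq0 (negbTE b0) /= => /eqP ->.
  by move=> /eqP; rewrite mulf_eq0 (negbTE b0) /= => /eqP ->; rewrite !mulr0 subrr.
apply: (mulfI a0); rewrite mulr0.
have -> : alpha1 * (f * k' - k * f') = (alpha1 * f + beta1 * f') * k' - (alpha1 * k + beta1 * k') * f' by ring.
by rewrite H1 H2 !mul0r subrr.
Qed.

(** If g_0 and g_1 both satisfied the right boundary condition, Green's
    formula for the pair (g_0, g_1) would give the square of the norm of g_0 the
    value 0, as g_1 has zero Cauchy data at 0; but g_0 is not 0. *)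
Lemma gen_bc1_neq0 : B1 (g 0%N 1) (D01 (g 0%N) 1) = 0 -> B1 (g 1%N 1) (D01 (g 1%N) 1) = 0 -> False.
Proof.
move=> H0 H1.
have [C0 R0] := gen_sprim2 p_gt1 rho_Lp rho_gt0 gen 0%N.
have [C1 R1] := gen_sprim2 p_gt1 rho_Lp rho_gt0 gen 1%N.
have [_ [_ g0a g0b] DS] := gen.
have [_ z0 z1] := DS 0%N.
have := green_dot rI rho_gt0 R0 R1.
rewrite (wronskian_eq0 H0 H1) z0 z1 mulr0 mul0r !subrr /=.
have E0 : L2rho_dot rho (g 1%N) (fun=> 0) = 0 by rewrite dotC dot0.
rewrite E0 subr0 => d0.
have L0 := sprim2_Lip0 rI R0.
have n0 : L2rho_norm rho (g 0%N) = 0 by rewrite nrmE -d0 sqrtr0.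
have Z := nrm0_Lip rI rho_gt0 L0 n0.
have D0 : D01 (g 0%N) 0 = 0.
  apply: (@wderiv_uniq R 0 1 (g 0%N) 0) => //; first exact: zero01.
  - by apply: (sprim2_wderiv sI R0); exact: zero01.
  - apply: wderiv_ext (wderiv_cst _ 0 0) => //; last exact: zero01.
    by move=> x xi; rewrite Z.
by move: g0b; rewrite Z ?zero01// D0 !mulr0 subrr => /esym/eqP; rewrite oner_eq0.
Qed.

(** A function with left boundary value 1 and right boundary value 0.
    The affine function is corrected by a multiple of g_0 or g_1, whichever has
    nonzero right boundary value. *)
Lemma test_function : exists B w w1 w2, [/\ sprim2 (nu sg) B w w1 w2,
  (exists B', Lip B' w2), alpha0 * w 0 + beta0 * w1 0 = 1 & B1 (w 1) (w1 1) = 0].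
Proof.
have [Bh Hh] := aff_sprim2; have [_ [_ g0a g0b] DS] := gen.
have hB0 : alpha0 * aff 0 + beta0 * aff1 0 = 1.
  rewrite /aff /aff1; field; exact: D0_neq0.
have key j : alpha0 * g j 0 + beta0 * D01 (g j) 0 = 0 -> B1 (g j 1) (D01 (g j) 1) != 0 ->
  exists B w w1 w2, [/\ sprim2 (nu sg) B w w1 w2,
  (exists B', Lip B' w2), alpha0 * w 0 + beta0 * w1 0 = 1 & B1 (w 1) (w1 1) = 0].
  move=> gj Bj; have [Bg Hg] := gen_sprim2 p_gt1 rho_Lp rho_gt0 gen j.
  pose k := - (B1 (aff 1) (aff1 1) / B1 (g j 1) (D01 (g j) 1)).
  have RD := sprim2D Hh (sprim2Z k Hg).
  eexists; eexists; eexists; eexists; split; first exact: RD.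
  - by eexists; exact: sprim2_Lip RD.
  - rewrite /= (_ : _ + _ = (alpha0 * aff 0 + beta0 * aff1 0) + k * (alpha0 * g j 0 + beta0 * D01 (g j) 0)); last by ring.
    by rewrite hB0 gj mulr0 addr0.
  - rewrite /B1 /= (_ : _ + _ = B1 (aff 1) (aff1 1) + k * B1 (g j 1) (D01 (g j) 1)); last by rewrite /B1; ring.
    by rewrite /k mulNr divfK// subrr.
have [E0|N0] := eqVneq (B1 (g 0%N 1) (D01 (g 0%N) 1)) 0; last exact: (key 0%N).
have [E1|N1] := eqVneq (B1 (g 1%N 1) (D01 (g 1%N) 1)) 0.
  by case: (gen_bc1_neq0 E0 E1).
by apply: (key 1%N) => //; have [_ -> ->] := DS 0%N; rewrite !mulr0 addr0.
Qed.

Variables (lam : nat -> R) (e : nat -> R -> R).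
Hypothesis eigen : eigenbasis p rho alpha0 beta0 alpha1 beta1 lam e.
Let zeta_ n := zeta alpha0 beta0 e n.

(** By Green's formula with the test function w, zeta_n is up to a constant
    - lam_n <w, e_n> - <w2, e_n>: divided by 1 + |lam_n| it is bounded by Fourier
    coefficients of w and w2, which are square summable. *)
Lemma zeta_sum : exists S, forall N, \sum_(n < N) zeta_ n ^+ 2 / (1 + `|lam n|) ^+ 2 <= S.
Proof.
have [[Le ON _] _ Ep] := eigen.
have [B [w [w1 [w2 [Rw [B' Lw2] b0 b1]]]]] := test_function.
pose D := alpha0 ^+ 2 + beta0 ^+ 2.
have Lw : L2rho rho w by have [] := L2_Lip rI rho_gt0 (sprim2_Lip0 rI Rw).
have L2w2 : L2rho rho w2 by have [] := L2_Lip rI rho_gt0 Lw2.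
have Z n : zeta_ n = D * (- lam n * L2rho_dot rho w (e n) - L2rho_dot rho w2 (e n)).
  have [Be Re] := eigen_sprim2 (Ep n); have [_ _ e0 e1] := Ep n.
  have := green_dot rI rho_gt0 Rw Re.
  rewrite (wronskian_eq0 b1 e1) sub0r.
  have -> : L2rho_dot rho w (fun x => - lam n * e n x) = - lam n * L2rho_dot rho w (e n).
    rewrite dotC; have := dotD rI rho_gt0 (- lam n) 0 (Le n) (Le n) Lw.
    rewrite mul0r addr0 [L2rho_dot rho w _]dotC => <-; congr L2rho_dot.
    by apply/funext => x; rewrite mul0r addr0.
  rewrite [L2rho_dot rho (e n) w2]dotC => <-.
  have -> : zeta_ n = (alpha0 * w 0 + beta0 * w1 0) * zeta_ n by rewrite b0 mul1r.
  rewrite /zeta_ /zeta /D.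
  have := e0. set E := e n 0; set E' := D01 (e n) 0 => H.
  apply/eqP; rewrite -subr_eq0; apply/eqP.
  transitivity ((alpha0 * E + beta0 * E') * (beta0 * w 0 - alpha0 * w1 0)); last by rewrite H mul0r.
  ring.
pose S := 2 * D ^+ 2 * (L2rho_dot rho w w + L2rho_dot rho w2 w2).
exists S => N.
apply: (@le_trans _ _ (\sum_(n < N) 2 * D ^+ 2 * (L2rho_dot rho w (e n) ^+ 2 + L2rho_dot rho w2 (e n) ^+ 2))).
  apply: ler_sum => n _; rewrite Z.
  have l0 : 0 < (1 + `|lam n|) ^+ 2 by rewrite exprn_gt0// ltr_wpDr.
  rewrite ler_pdivrMr//.
  set X := L2rho_dot rho w _; set Y := L2rho_dot rho w2 _.
  have -> : (D * (- lam n * X - Y)) ^+ 2 = D ^+ 2 * (lam n * X + Y) ^+ 2 by ring.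
  have -> : 2 * D ^+ 2 * (X ^+ 2 + Y ^+ 2) * (1 + `|lam n|) ^+ 2 =
    D ^+ 2 * (2 * ((X ^+ 2 + Y ^+ 2) * (1 + `|lam n|) ^+ 2)) by ring.
  apply: (ler_wpM2l (sqr_ge0 D)).
  have h2 : (lam n * X + Y) ^+ 2 <= 2 * (lam n ^+ 2 * X ^+ 2 + Y ^+ 2).
    have := sqr_ge0 (lam n * X - Y); rewrite sqrrB sqrrD !exprMn; lra.
  apply: le_trans h2 _; rewrite ler_wpM2l// mulrDl; apply: lerD.
    rewrite mulrC ler_wpM2l ?sqr_ge0// -real_normK ?num_real//.
    by rewrite lerXn2r ?nnegrE ?addr_ge0// lerDr.
  by rewrite ler_peMr ?sqr_ge0// exprn_ege1// lerDl.
rewrite -mulr_sumr /S; apply: ler_wpM2l; first by rewrite mulr_ge0 ?sqr_ge0.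
rewrite big_split /=; apply: lerD.
- exact: (bessel rI rho_gt0 Le ON).
- exact: (bessel rI rho_gt0 Le ON).
Qed.

Variable c : nat -> R.
Hypothesis c_l2 : cvgn (series (fun n => `|c n| ^+ 2)).

Lemma c_l2_bound : exists S, 0 <= S /\ forall N, \sum_(n < N) c n ^+ 2 <= S.
Proof.
exists (limn (series (fun n => `|c n| ^+ 2))).
have H N : \sum_(n < N) c n ^+ 2 <= limn (series (fun n => `|c n| ^+ 2)).
  have -> : \sum_(n < N) c n ^+ 2 = series (fun n => `|c n| ^+ 2) N.
    by rewrite /series /= big_mkord; apply: eq_bigr => i _; rewrite real_normK ?num_real.
  apply: nondecreasing_cvgn_le => //; apply/nondecreasing_seqP => n.
  by rewrite /series /= big_nat_recr //= lerDl sqr_ge0.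
by split => //; have := H 0%N; rewrite big_ord0.
Qed.

(** The summability that makes the Dirichlet series y converge for
    t > 0 together with all its derivatives. *)
Lemma coef_zeta_sum : exists S, 0 <= S /\ forall N, \sum_(n < N) `|c n * zeta_ n| / (1 + `|lam n|) <= S.
Proof.
have [S1 H1] := zeta_sum; have [S2 [S20 H2]] := c_l2_bound.
have S10 : 0 <= S1 by have := H1 0%N; rewrite big_ord0.
exists (S1 + S2); split; first exact: addr_ge0.
move=> N; apply: le_trans (lerD (H1 N) (H2 N)).
rewrite -big_split /=; apply: ler_sum => n _.
have l0 : 0 < 1 + `|lam n| by rewrite ltr_wpDr.
set L := 1 + `|lam n| in l0 *.
have -> : `|c n * zeta_ n| / L = `|c n| * (`|zeta_ n| / L) by rewrite normrM mulrA.
have -> : zeta_ n ^+ 2 / L ^+ 2 = (`|zeta_ n| / L) ^+ 2.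
  by rewrite exprMn real_normK ?num_real// exprVn.
rewrite -[c n ^+ 2]real_normK ?num_real//.
set a := `|c n|; set b := `|zeta_ n| / L.
have b0 : 0 <= b := divr_ge0 (normr_ge0 _) (ltW l0).
have := sqr_ge0 (a - b); have : 0 <= a * b := mulr_ge0 (normr_ge0 _) b0.
rewrite sqrrB; lra.
Qed.

End Eigenfunctions.

(** * The output of the free evolution *)
Section Modes.
Set Implicit Arguments. Unset Strict Implicit. Unset Printing Implicit Defensive.
Variable R : realType.

Lemma is_derive_wderiv (D : set R) (f : R -> R) (x l : R) : is_derive x (1 : R) f l -> wderiv D f x l.
Proof.
move=> [df E]; have : h^-1 *: ((f \o shift x) (h *: (1 : R^o)) - f x) @[h --> 0^'] --> l by rewrite -E; exact: df.
move=> /cvgrPdist_lt H; apply/cvg_withinP => e e0; have := H e e0.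
rewrite /dnbhs near_withinE => /nbhs_ballP[d /= d0 Hd].
exists d => // y _ yx yd; rewrite distrC.
have := Hd (y - x); rewrite -ball_normE /= sub0r normrN subr_eq0 => /(_ yd yx).
rewrite [(y - x) *: _]mulr1 subrK; congr (`|_ - _| < _).
by rewrite /GRing.scale /= mulrC.
Qed.

Lemma wderiv_exp (D : set R) (m : R) t : wderiv D (fun r => expR (m * r)) t (m * expR (m * t)).
Proof.
apply: is_derive_wderiv.
have H : is_derive t (1 : R) (fun r => m * r) m.
  have := is_deriveZ m (is_derive_id t (1 : R)); by rewrite [m *: _]mulr1.
have := @is_derive1_comp _ expR (fun r => m * r) t _ _ (is_derive_expR (m * t)) H.
by rewrite mulrC.
Qed.

Lemma wderivZ (D : set R) (f : R -> R) k x l : wderiv D f x l -> wderiv D (fun y => k * f y) x (k * l).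
Proof.
move=> H; have := wderivM (@wderiv_cst _ D k x) H; by rewrite mul0r add0r.
Qed.

Variables (b lam : nat -> R) (A : R).
Hypothesis lam_lb : forall n, lam 0%N <= lam n.
Hypothesis bA : forall N, \sum_(n < N) `|b n| / (1 + `|lam n|) <= A.

Definition free_term k t n := b n * ((- lam n) ^+ k * expR (- lam n * t)).
Definition free_output k t := ser (free_term k t).
(** A bound for (1 + |lam_n|) |lam_n|^k exp(- lam_n t), uniform in n and in
    t in [ep, T].  The exponential factor accounts for negative eigenvalues. *)
Definition free_bound (ep T : R) k := expR ((1 + 2 * `|lam 0%N|) * T) * (k.+1)`!%:R / ep ^+ k.+1.
Let a n := `|b n| / (1 + `|lam n|).

Lemma coef_ge0 n : 0 <= a n.
Proof. by rewrite /a divr_ge0// addr_ge0. Qed.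

Lemma lam_split n : - lam n <= (1 + 2 * `|lam 0%N|) - (1 + `|lam n|).
Proof.
have := lam_lb n; have := ler_norm (lam 0%N); have := ler_norm (- lam 0%N); rewrite normrN.
by have [l0|l0] := ger0P (lam n); lra.
Qed.

(** With m = 1 + |lam_n|, use m^(k+1) exp(- m t) <= (k+1)! / t^(k+1);
    the extra power of m pays for the division in [coef_zeta_sum]. *)
Lemma free_term_bound ep T k t n : 0 < ep -> ep <= t <= T -> `|free_term k t n| <= a n * free_bound ep T k.
Proof.
move=> e0 /andP[et tT]; have t0 : 0 < t by apply: lt_le_trans et.
pose m := 1 + `|lam n|; have m1 : 1 <= m by rewrite /m lerDl.
have m0 : 0 < m by apply: lt_le_trans m1.
have H1 : expR (- lam n * t) <= expR ((1 + 2 * `|lam 0%N|) * T) * expR (- (m * t)).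
  rewrite -expRD ler_expR; have := ler_wpM2r (ltW t0) (lam_split n).
  have L0 : 0 <= 1 + 2 * `|lam 0%N| by rewrite addr_ge0// mulr_ge0.
  have := ler_wpM2l L0 tT; rewrite -/m mulrBl; lra.
have H2 : m ^+ k.+1 * expR (- (m * t)) <= (k.+1)`!%:R / ep ^+ k.+1.
  rewrite expRN ler_pdivrMr ?expR_gt0//.
  have := pow_le_exp k.+1 (ltW (mulr_gt0 m0 t0)); rewrite exprMn => H.
  rewrite mulrAC ler_pdivlMr ?exprn_gt0//; apply: le_trans H.
  rewrite ler_wpM2l ?exprn_ge0 ?(ltW m0)//.
  by apply: lerXn2r; rewrite ?nnegrE ?(ltW e0) ?(ltW t0).
have H3 : `|lam n| ^+ k <= m ^+ k by apply: lerXn2r; rewrite ?nnegrE ?(ltW m0)// /m lerDr.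
rewrite /free_term !normrM normrX normrN (ger0_norm (expR_ge0 _)).
have -> : a n * free_bound ep T k = `|b n| * ((k.+1`!%:R / ep ^+ k.+1) * expR ((1 + 2 * `|lam 0%N|) * T) / m).
  by rewrite /a /free_bound -/m; ring.
apply: ler_wpM2l => //; rewrite ler_pdivlMr//.
have E0 := expR_ge0 (- lam n * t); have E1 := expR_ge0 ((1 + 2 * `|lam 0%N|) * T).
have E2 := expR_ge0 (- (m * t)).
have mk : 0 <= m ^+ k by rewrite exprn_ge0// ltW.
apply: le_trans (_ : m ^+ k * (expR ((1 + 2 * `|lam 0%N|) * T) * expR (- (m * t))) * m <= _).
  by rewrite ler_wpM2r ?(ltW m0)//; apply: ler_pM.
have -> : m ^+ k * (expR ((1 + 2 * `|lam 0%N|) * T) * expR (- (m * t))) * m =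
  (m ^+ k.+1 * expR (- (m * t))) * expR ((1 + 2 * `|lam 0%N|) * T) by rewrite exprS; ring.
by rewrite ler_wpM2r.
Qed.

Lemma free_bound_ge0 ep T k : 0 < ep -> 0 <= free_bound ep T k.
Proof. by move=> e0; rewrite /free_bound divr_ge0 ?mulr_ge0 ?expR_ge0// exprn_ge0// ltW. Qed.

Lemma free_term_sum ep T k t N : 0 < ep -> ep <= t <= T ->
  \sum_(n < N) `|free_term k t n| <= A * free_bound ep T k.
Proof.
move=> e0 ti; apply: le_trans (_ : \sum_(n < N) a n * free_bound ep T k <= _).
  by apply: ler_sum => n _; exact: free_term_bound.
by rewrite -mulr_suml ler_wpM2r ?free_bound_ge0// bA.
Qed.

Lemma free_output_cvg ep T k t : 0 < ep -> ep <= t <= T -> cvgn (series (free_term k t)).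
Proof. by move=> e0 ti; apply: abs_series_cvg => N; exact: free_term_sum e0 ti. Qed.

Lemma free_output_bound ep T k t : 0 < ep -> ep <= t <= T -> `|free_output k t| <= A * free_bound ep T k.
Proof. by move=> e0 ti; apply: abs_series_le => N; exact: free_term_sum e0 ti. Qed.

Lemma free_term_wderiv (D : set R) k t n : wderiv D (fun r => free_term k r n) t (free_term k.+1 t n).
Proof.
have := wderivZ (k := b n * (- lam n) ^+ k) (@wderiv_exp D (- lam n) t).
rewrite /free_term (_ : b n * (- lam n) ^+ k * (- lam n * expR (- lam n * t)) = b n * ((- lam n) ^+ k.+1 * expR (- lam n * t))); last first.
  by rewrite exprS; ring.
by congr wderiv; apply/funext => r; rewrite mulrA.
Qed.

(** Termwise Taylor estimates, summed: this gives the derivative of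
    the series without a theorem on exchanging limits. *)
Lemma free_output_taylor ep T k t r : 0 < ep -> ep <= t <= T -> ep <= r <= T ->
  `|free_output k r - free_output k t - (r - t) * free_output k.+1 t| <= A * free_bound ep T k.+2 * `|r - t| ^+ 2.
Proof.
move=> e0 ti ri; apply: ser_taylor_bound; [exact: free_output_cvg ri|exact: free_output_cvg ti|exact: free_output_cvg ti|].
move=> N; apply: le_trans (_ : \sum_(n < N) a n * (free_bound ep T k.+2 * `|r - t| ^+ 2) <= _).
  apply: ler_sum => n _; rewrite [leRHS]mulrA.
  apply: (@taylor_bound _ ep T (fun r => free_term k r n) (fun r => free_term k.+1 r n) (fun r => free_term k.+2 r n)) => //.
  - by move=> x _; exact: free_term_wderiv.
  - by move=> x _; exact: free_term_wderiv.
  - by move=> x xi; exact: free_term_bound.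
by rewrite -mulr_suml -mulrA ler_wpM2r ?bA// mulr_ge0 ?free_bound_ge0// exprn_ge0.
Qed.

Lemma free_output_wderiv ep T k t : 0 < ep -> ep <= t <= T -> wderiv `[ep, T] (free_output k) t (free_output k.+1 t).
Proof.
move=> e0 ti; apply: wderiv_quad => r; rewrite /= in_itv /= => ri.
exact: (free_output_taylor k e0 ti ri).
Qed.

Lemma fact_le_powR (s : R) k : 1 <= s -> (k`!%:R : R) <= k`!%:R `^ s.
Proof.
move=> s1; rewrite -{1}[k`!%:R]powRr1//; apply: ler_powR => //.
by rewrite ler1n fact_gt0.
Qed.

Lemma coef_bound_ge0 : 0 <= A. Proof. by have := bA 0; rewrite big_ord0. Qed.

Lemma free_bound_gevrey s ep T k : 1 <= s -> 0 < ep ->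
  free_bound ep T k <= expR ((1 + 2 * `|lam 0%N|) * T) / ep * (k`!%:R `^ s) / (ep / 2) ^+ k.
Proof.
move=> s1 e0; have M0 : 0 <= expR ((1 + 2 * `|lam 0%N|) * T) / ep.
  by rewrite divr_ge0 ?(ltW e0)// expR_ge0.
have en : ep != 0 by rewrite gt_eqF.
have ek : ep ^+ k != 0 by rewrite expf_neq0.
have -> : free_bound ep T k = expR ((1 + 2 * `|lam 0%N|) * T) / ep * (k.+1%:R * k`!%:R) / ep ^+ k.
  by rewrite /free_bound factS natrM exprS; field; rewrite en ek.
set X := expR _ / ep in M0 *.
have k2 : (2 : R) ^+ k != 0 by rewrite expf_neq0.
have -> : X * k`!%:R `^ s / (ep / 2) ^+ k = X * (2 ^+ k * k`!%:R `^ s) / ep ^+ k.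
  by rewrite expr_div_n; field; rewrite ek k2.
apply: ler_wpM2r; first by rewrite invr_ge0 exprn_ge0// ltW.
apply: ler_wpM2l => //; apply: ler_pM => //.
- by rewrite -natrX ler_nat ltn_expl.
- exact: fact_le_powR.
Qed.

Lemma free_output_gevrey s ep T : 1 <= s -> 0 < ep -> exists M, 0 <= M /\
  forall k t, ep <= t <= T -> `|free_output k t| <= M * (k`!%:R `^ s) / (ep / 2) ^+ k.
Proof.
move=> s1 e0; exists (A * (expR ((1 + 2 * `|lam 0%N|) * T) / ep)); split.
  by rewrite mulr_ge0 ?coef_bound_ge0// divr_ge0 ?(ltW e0)// expR_ge0.
move=> k t ti; apply: le_trans (free_output_bound k e0 ti) _.
by rewrite -!mulrA ler_wpM2l ?coef_bound_ge0// !mulrA; exact: free_bound_gevrey.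
Qed.

(** The same sequence of remainders works for all k and all t in
    [ep, T], so the truncation of y at n < N is uniform. *)
Definition coef_tail N := ser a - \sum_(n < N) a n.

Lemma coef_cvg : cvgn (series a).
Proof. by apply: (@abs_series_cvg _ _ A) => N; under eq_bigr do rewrite (ger0_norm (coef_ge0 _)); exact: bA. Qed.

Lemma coef_partial M : \sum_(n < M) a n <= ser a.
Proof.
have -> : \sum_(n < M) a n = series a M by rewrite /series /= big_mkord.
apply: nondecreasing_cvgn_le; last exact: coef_cvg.
by apply/nondecreasing_seqP => n; rewrite /series /= big_nat_recr //= lerDl coef_ge0.
Qed.

Lemma coef_tail_ge0 N : 0 <= coef_tail N. Proof. by rewrite subr_ge0 coef_partial. Qed.

Lemma coef_tail_cvg : coef_tail @ \oo --> (0 : R).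
Proof.
rewrite -(subrr (ser a)); apply: cvgB; first exact: cvg_cst.
have /cvg_ex[l Hl] := coef_cvg.
by rewrite /ser (cvg_lim (@Rhausdorff R) Hl) -(eq_cvg _ _ (fun n => big_mkord xpredT a)).
Qed.

Lemma free_output_tail ep T k t N : 0 < ep -> ep <= t <= T ->
  `|free_output k t - \sum_(n < N) free_term k t n| <= coef_tail N * free_bound ep T k.
Proof.
move=> e0 ti; have /cvg_ex[l Hl] := free_output_cvg (k := k) e0 ti.
rewrite /free_output /ser (cvg_lim (@Rhausdorff R) Hl).
have Hl' : (fun M => series (free_term k t) (M + N)%N - \sum_(n < N) free_term k t n) @ \oo --> l - \sum_(n < N) free_term k t n.
  by apply: cvgB; [rewrite (cvg_shiftn N (series (free_term k t)))|exact: cvg_cst].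
apply: cvg_abs_le Hl' _ => M.
have NM : (N <= M + N)%N by rewrite leq_addl.
rewrite /series /= (@big_cat_nat _ _ _ N 0 (M + N)%N)//= big_mkord addrAC subrr add0r.
apply: le_trans (ler_norm_sum _ _ _) _.
apply: le_trans (_ : \sum_(N <= n < M + N) a n * free_bound ep T k <= _).
  by apply: ler_sum => n _; exact: free_term_bound.
rewrite -mulr_suml ler_wpM2r ?free_bound_ge0// /coef_tail lerBrDl.
apply: le_trans (coef_partial (M + N)); rewrite -!(big_mkord xpredT a).
by rewrite [leRHS](@big_cat_nat _ _ _ N 0 (M + N)%N).
Qed.

End Modes.

(** * Series over the generating functions with Gevrey coefficients *)
Section GevreyChains.
Set Implicit Arguments. Unset Strict Implicit. Unset Printing Implicit Defensive.
Variable R : realType.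

Definition gevrey_maj (s M r : R) (k : nat) : R := M * (k`!%:R `^ s) / r ^+ k.

Lemma gevrey_maj_ge0 s M r k : 0 <= M -> 0 <= r -> 0 <= gevrey_maj s M r k.
Proof. by move=> M0 r0; rewrite /gevrey_maj divr_ge0 ?exprn_ge0// mulr_ge0// powR_ge0. Qed.

Lemma gevrey_maj_le s M r M' r' k : 0 <= M -> M <= M' -> 0 < r' -> r' <= r -> gevrey_maj s M r k <= gevrey_maj s M' r' k.
Proof.
move=> M0 MM r0 rr; have r0' : 0 < r by apply: lt_le_trans rr.
rewrite /gevrey_maj; apply: ler_pM; rewrite ?mulr_ge0 ?powR_ge0 ?invr_ge0 ?exprn_ge0 ?(ltW r0')//.
  by rewrite ler_wpM2r ?powR_ge0.
by rewrite lef_pV2 ?posrE ?exprn_gt0//; apply: lerXn2r; rewrite ?nnegrE ?(ltW r0) ?(ltW r0').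
Qed.

Definition gevrey_chain (s ep T M r : R) (U : nat -> R -> R) : Prop :=
  forall k t, ep <= t <= T -> wderiv `[ep, T] (U k) t (U k.+1 t) /\ `|U k t| <= gevrey_maj s M r k.

Lemma gevrey_chain_taylor s ep T M r U : gevrey_chain s ep T M r U ->
  forall k t t', ep <= t <= T -> ep <= t' <= T ->
  `|U k t' - U k t - (t' - t) * U k.+1 t| <= gevrey_maj s M r k.+2 * `|t' - t| ^+ 2.
Proof.
move=> H k t t' ti ti'.
apply: (@taylor_bound _ ep T (U k) (U k.+1) (U k.+2)) => // x xi.
- exact: (H k x xi).1.
- exact: (H k.+1 x xi).1.
- exact: (H k.+2 x xi).2.
Qed.

Lemma leib_gevrey_chain s ep T M M' r U V : 1 <= s -> 0 <= M -> 0 <= M' -> 0 < r ->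
  gevrey_chain s ep T M r U -> gevrey_chain s ep T M' r V ->
  gevrey_chain s ep T (M * M') (r / 2) (fun k => leib U V k 0 0).
Proof.
move=> s1 M0 M0' r0 HU HV k t ti; split.
  apply: leib_wderiv => j; first by case: (HU j t ti).
  by case: (HV j t ti).
have := @leib_bound R U V M M' r s t s1 r0 M0 M0'.
move=> /(_ (fun k => (HU k t ti).2) (fun k => (HV k t ti).2) k 0%N 0%N) /le_trans; apply.
rewrite !add0n /gevrey_maj expr_div_n le_eqVlt; apply/orP; left; apply/eqP; field.
by rewrite !expf_neq0// gt_eqF.
Qed.

Lemma ser_sum (N : nat) (d : nat -> R) (al : nat -> nat -> R) :
  (forall n, cvgn (series (al n))) ->
  cvgn (series (fun i => \sum_(n < N) d n * al n i)) /\
  ser (fun i => \sum_(n < N) d n * al n i) = \sum_(n < N) d n * ser (al n).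
Proof.
move=> H; elim: N => [|N [IH1 IH2]].
  have -> : (fun i => \sum_(n < 0) d n * al n i) = (fun=> 0) by apply/funext => i; rewrite big_ord0.
  have E : series (fun=> 0 : R) = (fun=> 0) by apply/funext => n; rewrite /series /= big1.
  by rewrite /ser E big_ord0; split; [exact: is_cvg_cst|exact: lim_cst].
have [C1 C2] := ser_lin 1 (d N) IH1 (H N).
have E : (fun i => \sum_(n < N.+1) d n * al n i) = (fun i => 1 * (\sum_(n < N) d n * al n i) + d N * al N i).
  by apply/funext => i; rewrite big_ord_recr /= mul1r.
by rewrite E big_ord_recr /= -IH2 -[X in X + _]mul1r.
Qed.

Section Sums.
Variables (s C K : R).
Hypothesis s_ge1 : 1 <= s.
Hypothesis s_lt2 : s < 2.
Hypothesis C0 : 0 <= C.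
Hypothesis K0 : 0 <= K.
Definition gen_maj i : R := C * K ^+ i / i`!%:R ^+ 2.

Lemma gen_maj_ge0 i : 0 <= gen_maj i. Proof. by rewrite /gen_maj divr_ge0 ?mulr_ge0 ?exprn_ge0. Qed.

(** Applied both to values of y and, with a small factor d, to Taylor
    remainders of y. *)
Lemma gevrey_gen_sum M r : 0 <= M -> 0 < r -> exists M' r', [/\ 0 < M', 0 < r' &
  forall (a : nat -> R) (d : R) k, 0 <= d -> (forall i, `|a i| <= d * gevrey_maj s M r (i + k)) ->
   forall N, \sum_(i < N) `|a i| * gen_maj i <= d * gevrey_maj s M' r' k].
Proof.
move=> M0 r0; have s0 : 0 <= s by apply: le_trans s_ge1.
have [M' [r' [M0' r0' H]]] := gevrey_sum s0 s_lt2 K0 C0 M0 r0.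
exists M', r'; split => // a d k d0 Ha N.
apply: (@le_trans _ _ (\sum_(i < N) d * (`|gevrey_maj s M r (i + k)%N| * (C * K ^+ i / i`!%:R ^+ 2)))).
  apply: ler_sum => i _; rewrite -/(gen_maj i) [leRHS]mulrA; apply: ler_wpM2r; first exact: gen_maj_ge0.
  apply: le_trans (Ha i) _.
  by rewrite (ger0_norm (gevrey_maj_ge0 _ _ M0 (ltW r0))).
rewrite -mulr_sumr ler_wpM2l//; apply: (H (gevrey_maj s M r)) => j.
by rewrite (ger0_norm (gevrey_maj_ge0 _ _ M0 (ltW r0))).
Qed.

(** The k-th time derivative of sum_i y^(i) ga_i.  The sequence ga is that
    of the values at one point x of the g_i, of their derivatives, or of their
    right boundary values. *)
Definition flat_sum (y : nat -> R -> R) (ga : nat -> R) k t := ser (fun i => y (i + k)%N t * ga i).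

Lemma flat_sum_cvg M r (y : nat -> R -> R) ga k t : 0 <= M -> 0 < r ->
  (forall j, `|y j t| <= gevrey_maj s M r j) -> (forall i, `|ga i| <= gen_maj i) ->
  cvgn (series (fun i => y (i + k)%N t * ga i)).
Proof.
move=> M0 r0 Hy Hg; have [M' [r' [_ _ H]]] := gevrey_gen_sum M0 r0.
apply: (@abs_series_cvg _ _ (1 * gevrey_maj s M' r' k)) => N.
apply: le_trans (H (fun i => y (i + k)%N t) 1 k ler01 _ N); last by move=> i; rewrite mul1r.
by apply: ler_sum => i _; rewrite normrM ler_wpM2l.
Qed.

(** The constants do not depend on ga. *)
Lemma flat_sum_chain ep T M r (y : nat -> R -> R) : 0 <= M -> 0 < r -> gevrey_chain s ep T M r y ->
  exists M' r', [/\ 0 < M', 0 < r' & forall ga : nat -> R, (forall i, `|ga i| <= gen_maj i) ->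
    gevrey_chain s ep T M' r' (flat_sum y ga)].
Proof.
move=> M0 r0 Hy; have [M' [r' [M0' r0' H]]] := gevrey_gen_sum M0 r0.
exists M', r'; split => // ga Hg k t ti.
have cv k' t' : ep <= t' <= T -> cvgn (series (fun i => y (i + k')%N t' * ga i)).
  by move=> ti'; apply: (flat_sum_cvg M0 r0) => // j; case: (Hy j t' ti').
split.
  apply: (@wderiv_quad _ _ _ _ _ (gevrey_maj s M' r' k.+2)) => t'; rewrite /= in_itv /= => ti'.
  apply: ser_taylor_bound; [exact: cv|exact: cv|exact: cv|] => N.
  rewrite mulrC; apply: le_trans (H (fun i => y (i + k)%N t' - y (i + k)%N t - (t' - t) * y (i + k.+1)%N t) _ k.+2 _ _ N).
  - apply: ler_sum => i _.
    rewrite (_ : _ - _ - _ = (y (i + k)%N t' - y (i + k)%N t - (t' - t) * y (i + k.+1)%N t) * ga i); last by ring.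
    by rewrite normrM ler_wpM2l.
  - by rewrite exprn_ge0.
  - move=> i; rewrite !addnS [leRHS]mulrC; exact: (gevrey_chain_taylor Hy).
rewrite -[gevrey_maj _ _ _ _]mul1r; apply: abs_series_le => N.
apply: le_trans (H (fun i => y (i + k)%N t) 1 k ler01 _ N).
  by apply: ler_sum => i _; rewrite normrM ler_wpM2l.
by move=> i; rewrite mul1r; case: (Hy (i + k)%N t ti).
Qed.

Variables (nu : R -> R) (g g1 gw : nat -> R -> R).
Hypothesis Hg : forall i, sprim2 nu (gen_maj i) (g i) (g1 i) (gw i).

Definition flat_fun (h : nat -> R -> R) (y : nat -> R -> R) k t x := flat_sum y (fun i => h i x) k t.

Lemma gen_le i x : 0 <= x <= 1 -> [/\ `|g i x| <= gen_maj i, `|g1 i x| <= gen_maj i & `|gw i x| <= gen_maj i].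
Proof. by move=> xi; case: (Hg i xi xi) => -[]. Qed.

(** The second part says that the flat series is differentiable in
    time in the strong sense of [sprim2], with remainder of order |t' - t|: the
    difference quotient minus the derivative is itself a series over the g_i,
    whose coefficients are Taylor remainders of y. *)
Lemma flat_fun_sprim2 ep T M r (y : nat -> R -> R) : 0 <= M -> 0 < r -> gevrey_chain s ep T M r y ->
  exists M' r', [/\ 0 < M', 0 < r',
    forall k t, ep <= t <= T -> sprim2 nu (gevrey_maj s M' r' k) (flat_fun g y k t) (flat_fun g1 y k t) (flat_fun gw y k t) &
    forall k t t', ep <= t <= T -> ep <= t' <= T -> t' != t ->
      sprim2 nu (`|t' - t| * gevrey_maj s M' r' k.+2)
       (fun x => (t' - t)^-1 * (flat_fun g y k t' x - flat_fun g y k t x) - flat_fun g y k.+1 t x)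
       (fun x => (t' - t)^-1 * (flat_fun g1 y k t' x - flat_fun g1 y k t x) - flat_fun g1 y k.+1 t x)
       (fun x => (t' - t)^-1 * (flat_fun gw y k t' x - flat_fun gw y k t x) - flat_fun gw y k.+1 t x)].
Proof.
move=> M0 r0 Hy; have [M' [r' [M0' r0' H]]] := gevrey_gen_sum M0 r0.
exists M', r'; split => //.
- move=> k t ti; apply: (sprim2_series (a := fun i => y (i + k)%N t) Hg) => N; rewrite -[leRHS]mul1r.
  by apply: (H (fun i => y (i + k)%N t) 1 k ler01) => i; rewrite mul1r; case: (Hy (i + k)%N t ti).
- move=> k t t' ti ti' tt'.
  have tn : t' - t != 0 by rewrite subr_eq0.
  pose a i := (t' - t)^-1 * (y (i + k)%N t' - y (i + k)%N t) - y (i + k.+1)%N t.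
  have Ha i : `|a i| <= `|t' - t| * gevrey_maj s M r (i + k.+2).
    have -> : a i = (t' - t)^-1 * (y (i + k)%N t' - y (i + k)%N t - (t' - t) * y (i + k.+1)%N t).
      by rewrite /a; field.
    rewrite normrM normfV mulrC ler_pdivrMr ?normr_gt0//.
    have := gevrey_chain_taylor Hy (i + k) ti ti'; rewrite !addnS => /le_trans; apply.
    by rewrite le_eqVlt; apply/orP; left; apply/eqP; rewrite expr2; ring.
  have RS := sprim2_series Hg (H a _ k.+2 (normr_ge0 _) Ha).
  have cv (h : nat -> R -> R) x : (forall i, `|h i x| <= gen_maj i) ->
     limn (series (fun i => a i * h i x)) = (t' - t)^-1 * (flat_fun h y k t' x - flat_fun h y k t x) - flat_fun h y k.+1 t x.
    move=> Hh.
    have cvv k' t0 : ep <= t0 <= T -> cvgn (series (fun i => y (i + k')%N t0 * h i x)).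
      by move=> ti0; apply: (flat_sum_cvg M0 r0) => // j; case: (Hy j t0 ti0).
    have [E1 E2] := ser_lin ((t' - t)^-1) (- (t' - t)^-1) (cvv k t' ti') (cvv k t ti).
    have [E3 E4] := ser_lin 1 (-1) E1 (cvv k.+1 t ti).
    rewrite /flat_fun /flat_sum -[LHS]/(ser _).
    rewrite (_ : (fun i => a i * h i x) = (fun n : nat =>
       1 * ((t' - t)^-1 * (y (n + k)%N t' * h n x) + - (t' - t)^-1 * (y (n + k)%N t * h n x)) +
       -1 * (y (n + k.+1)%N t * h n x))); last by apply/funext => i; rewrite /a; ring.
    by rewrite E4 E2; ring.
  apply: sprim2_ext RS => x xi; split; apply: cv => i; by have [? ? ?] := gen_le i xi.
Qed.

End Sums.

Section Compare.
Variables (s C K : R).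
Hypothesis s_ge1 : 1 <= s.
Hypothesis s_lt2 : s < 2.
Hypothesis C0 : 0 <= C.
Hypothesis K0 : 0 <= K.
Variables (b lam : nat -> R) (A : R).
Hypothesis lam_lb : forall n, lam 0%N <= lam n.
Hypothesis bA : forall N, \sum_(n < N) `|b n| / (1 + `|lam n|) <= A.

(** Interchange of the sums over i and n: truncate y at n < N, where
    the interchange is that of a finite sum with a series, and control the
    remainder by [coef_tail] uniformly in ga. *)
Lemma flat_sum_expand ep T : 0 < ep -> exists D, 0 <= D /\ forall (ga : nat -> R) t N, ep <= t <= T ->
  (forall i, `|ga i| <= gen_maj C K i) ->
  `|flat_sum (free_output b lam) ga 0 t - \sum_(n < N) b n * (expR (- lam n * t) * ser (fun i => (- lam n) ^+ i * ga i))|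
    <= coef_tail b lam N * D.
Proof.
move=> e0.
pose M := expR ((1 + 2 * `|lam 0%N|) * T) / ep.
have M0 : 0 <= M by rewrite /M divr_ge0 ?(ltW e0)// expR_ge0.
have e20 : 0 < ep / 2 by rewrite divr_gt0.
have [M' [r' [M0' r0' H]]] := gevrey_gen_sum s_ge1 s_lt2 C0 K0 M0 e20.
exists (gevrey_maj s M' r' 0); split; first by rewrite gevrey_maj_ge0 ?(ltW M0') ?(ltW r0').
move=> ga t N ti Hg.
have A0 := coef_bound_ge0 bA.
have cvY : cvgn (series (fun i => free_output b lam (i + 0)%N t * ga i)).
  have AM0 : 0 <= A * M by rewrite mulr_ge0.
  apply: (flat_sum_cvg s_ge1 s_lt2 C0 K0 AM0 e20) => // j.
  apply: le_trans (free_output_bound lam_lb bA j e0 ti) _.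
  by rewrite /gevrey_maj -!mulrA ler_wpM2l// !mulrA; exact: free_bound_gevrey.
have cvl n : cvgn (series (fun i => (- lam n) ^+ i * ga i)).
  have [S HS] := pow_gen_sum (lam n) C0 K0.
  apply: (@abs_series_cvg _ _ S) => N'; apply: le_trans (HS N').
  by apply: ler_sum => i _; rewrite normrM normrX normrN ler_wpM2l ?exprn_ge0//; exact: Hg.
have [c1 c2] := ser_sum N (fun n => b n * expR (- lam n * t)) cvl.
under [X in _ - X]eq_bigr => n _ do rewrite mulrA.
rewrite -c2 /flat_sum.
have [c3 c4] := ser_lin 1 (-1) cvY c1.
rewrite (_ : ser _ - ser _ = 1 * ser (fun i => free_output b lam (i + 0)%N t * ga i) + -1 * ser (fun i => \sum_(n < N) b n * expR (- lam n * t) * ((- lam n) ^+ i * ga i))); last by ring.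
rewrite -c4; apply: abs_series_le => N'.
apply: le_trans (H (fun i => free_output b lam i t - \sum_(n < N) free_term b lam i t n) (coef_tail b lam N) 0%N _ _ N').
- apply: ler_sum => i _; rewrite addn0.
  rewrite (_ : _ + _ = (free_output b lam i t - \sum_(n < N) free_term b lam i t n) * ga i).
    by rewrite normrM ler_wpM2l//; exact: Hg.
  rewrite mulrBl mul1r mulN1r mulr_suml; congr (_ - _); apply: eq_bigr => n _.
  by rewrite /free_term; ring.
- exact: (coef_tail_ge0 bA).
- move=> i; rewrite addn0; apply: le_trans (free_output_tail lam_lb bA i N e0 ti) _.
  by rewrite ler_wpM2l ?(coef_tail_ge0 bA)//; exact: free_bound_gevrey.
Qed.

End Compare.
End GevreyChains.

(** * Uniqueness of solutions *)
Section Uniqueness.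
Set Implicit Arguments. Unset Strict Implicit. Unset Printing Implicit Defensive.
Variable R : realType.
Local Notation mu := (@lebesgue_measure R).
Local Notation I01 := (`]0%R, 1%R[%classic : set R).

Variables (p : \bar R) (rho : R -> R).
Hypothesis p_gt1 : (1 < p)%E.
Hypothesis rho_Lp : Lp01 p rho.
Hypothesis rho_gt0 : ae01 (fun x => 0 < rho x).
Let sg : R -> R := fun z => `|rho z|.
Let rI := rho_int p_gt1 rho_Lp.
Let sI : mu.-integrable I01 (EFin \o sg) := sg_int' p_gt1 rho_Lp.
Local Notation dot := (L2rho_dot rho).
Local Notation nrm := (L2rho_norm rho).

Lemma W2p_nrm f : W2p p f -> L2rho rho f /\ nrm f <= W2p_norm p f * Num.sqrt (nu sg 1).
Proof.
move=> Wf; have [M L] := W2p_Lip Wf.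
apply: (L2_bounded rI rho_gt0); last exact: (W2p_sup p_gt1 Wf).
by apply: (@lip_measurable _ M) => x y xi yi; case: (L x y xi yi).
Qed.

Lemma dot_sub f f' k : L2rho rho f -> L2rho rho f' -> L2rho rho k ->
  dot (fun x => f x - f' x) k = dot f k - dot f' k.
Proof.
move=> Lf Lf' Lk; have := dotD rI rho_gt0 1 (-1) Lf Lf' Lk; rewrite mul1r mulN1r => <-.
by congr L2rho_dot; apply/funext => x; rewrite mul1r mulN1r.
Qed.

(** By [W2p_sup] the norm of W^{2,p} dominates that of L^2_rho, so scalar
    products may be differentiated in time. *)
Lemma dot_wderiv (D : set R) (u ut : R -> R -> R) f a b t :
  has_derivative_in (W2p p) (W2p_norm p) D u ut ->
  `[a, b] `<=` D -> a <= t <= b -> L2rho rho f ->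
  wderiv `[a, b] (fun r => dot (u r) f) t (dot (ut t) f).
Proof.
move=> [Wu Wut H] sD ti Lf; apply/cvg_withinP => eps eps0.
have Dt : D t by apply: sD; rewrite /= in_itv.
have K0 : 0 <= Num.sqrt (nu sg 1) * nrm f by rewrite mulr_ge0 ?sqrtr_ge0 ?nrm_ge0.
set K := Num.sqrt _ * _ in K0.
have K1 : 0 < K + 1 by rewrite ltr_wpDl.
have /cvg_withinP/(_ _ (divr_gt0 eps0 K1))[d d0 Hd] := H t Dt.
exists d => // r ri rt rd; have Dr : D r by apply: sD.
have rt0 : r - t != 0 by rewrite subr_eq0.
pose k := (r - t)^-1.
pose q x := 1 * (k * u r x + (- k) * u t x) + (-1) * ut t x.
have Wq1 := W2p_lin p_gt1 k (- k) (Wu r Dr) (Wu t Dt).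
have Wq : W2p p q := W2p_lin p_gt1 1 (-1) Wq1 (Wut t Dt).
have [L1 _] := W2p_nrm (Wu r Dr); have [L2 _] := W2p_nrm (Wu t Dt).
have [L3 _] := W2p_nrm Wq1; have [L4 _] := W2p_nrm (Wut t Dt); have [Lq Nq] := W2p_nrm Wq.
have -> : (dot (u r) f - dot (u t) f) / (r - t) - dot (ut t) f = dot q f.
  rewrite (dotD rI rho_gt0 1 (-1) L3 L4 Lf) (dotD rI rho_gt0 k (- k) L1 L2 Lf) /k; field.
  exact: rt0.
have Hq : W2p_norm p q < eps / (K + 1).
  have := Hd r Dr rt rd; rewrite subr0.
  have -> : (r - t)^-1 *: (u r - u t : R -> R^o) - ut t = q :> (R -> R).
    by apply/funext => x; rewrite /q mul1r mulN1r mulNr -mulrBr.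
  by apply: le_lt_trans; exact: ler_norm.
have q0 : 0 <= W2p_norm p q by rewrite /W2p_norm !addr_ge0 ?Lp01_norm_ge0.
apply: le_lt_trans (cauchy_schwarz rI rho_gt0 Lq Lf) _.
apply: le_lt_trans (ler_wpM2r (nrm_ge0 rho f) Nq) _; rewrite -mulrA -/K.
move: Hq; rewrite ltr_pdivlMr// mulrDr mulr1; lra.
Qed.

Variables (alpha0 beta0 alpha1 beta1 : R) (lam : nat -> R) (e : nat -> R -> R) (T : R).
Hypothesis ab0 : (alpha0, beta0) != (0, 0).
Hypothesis ab1 : (alpha1, beta1) != (0, 0).
Hypothesis eigen : eigenbasis p rho alpha0 beta0 alpha1 beta1 lam e.
Hypothesis T_gt0 : 0 < T.

(** The boundary terms in Green's formula are Wronskians of pairs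
    satisfying the same boundary condition. *)
Lemma dot_second_eigen B f f1 w n : sprim2 (nu sg) B f f1 w ->
  alpha0 * f 0 + beta0 * f1 0 = 0 -> alpha1 * f 1 + beta1 * f1 1 = 0 ->
  dot w (e n) = - lam n * dot f (e n).
Proof.
move=> Hf b0 b1; have [[Le _ _] _ Ep] := eigen; have [_ _ e0 e1] := Ep n.
have [Be Re] := eigen_sprim2 p_gt1 rho_Lp rho_gt0 (Ep n).
have := green_dot rI rho_gt0 Hf Re.
rewrite (wronskian_eq0 ab1 b1 e1) (wronskian_eq0 ab0 b0 e0) subrr => /esym/eqP; rewrite subr_eq0 => /eqP E.
rewrite dotC -E.
have [Lf _] := L2_Lip rI rho_gt0 (sprim2_Lip0 rI Hf).
rewrite dotC; have := dotD rI rho_gt0 (- lam n) 0 (Le n) (Le n) Lf.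
rewrite mul0r addr0 [dot f _]dotC => <-; congr L2rho_dot.
by apply/funext => x; rewrite mul0r addr0.
Qed.

Lemma solution_cont0 h u0 u u' : L2rho rho u0 ->
  is_solution p rho alpha0 beta0 alpha1 beta1 T h u0 u ->
  is_solution p rho alpha0 beta0 alpha1 beta1 T h u0 u' ->
  forall t, 0 <= t <= T -> forall eps, 0 < eps -> exists2 d, 0 < d & forall r, 0 <= r <= T -> `|r - t| < d ->
   nrm (fun x => u r x - u t x) < eps /\ nrm (fun x => u' r x - u' t x) < eps.
Proof.
move=> L0 [[Eu Cu] _ _] [[Eu' Cu'] _ _] t ti eps eps0.
have ti' : `[0, T]%classic t by rewrite /= in_itv.
have /cvg_within_nbhsP/(_ _ eps0)[d d0 Hd] := Cu t ti'.
have /cvg_within_nbhsP/(_ _ eps0)[d' d0' Hd'] := Cu' t ti'.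
exists (Num.min d d'); first by rewrite lt_min d0.
move=> r ri; rewrite lt_min => /andP[r1 r2].
have ri' : `[0, T]%classic r by rewrite /= in_itv.
have := Hd r ri' r1; have := Hd' r ri' r2; rewrite !subr0 !ger0_norm ?nrm_ge0//.
Qed.

(** The product of the coefficient of u - u' on e_n with
    exp(lam_n t) has zero derivative on (0, T) and tends to 0 at t = 0.  At t = T
    the conclusion follows by continuity in L^2_rho, as the equation is only
    assumed for t < T. *)
Lemma solution_unique h u0 u u' : L2rho rho u0 ->
  is_solution p rho alpha0 beta0 alpha1 beta1 T h u0 u ->
  is_solution p rho alpha0 beta0 alpha1 beta1 T h u0 u' ->
  forall t x, 0 < t <= T -> 0 <= x <= 1 -> u t x = u' t x.
Proof.
move=> L0 S S'; have C := solution_cont0 L0 S S'.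
move: S S' => [[Eu _] u_0 [ut [[[Wu _] [Wut _] HD] Pu]]] [[Eu' _] u_0' [ut' [[[Wu' _] [Wut' _] HD'] Pu']]].
have pos t : 0 < t <= T -> `]0, T]%classic t by move=> ti; rewrite /= in_itv.
have nn t : 0 <= t <= T -> `[0, T]%classic t by move=> ti; rewrite /= in_itv.
have [[Le ON dense] _ _] := eigen.
pose v t x := u t x - u' t x.
have Lu t : 0 <= t <= T -> L2rho rho (u t) by move=> /nn; exact: Eu.
have Lu' t : 0 <= t <= T -> L2rho rho (u' t) by move=> /nn; exact: Eu'.
have Lv t : 0 <= t <= T -> L2rho rho (v t).
  by move=> ti; apply: (L2_sub rI rho_gt0); [exact: Lu|exact: Lu'].
have LipW f : W2p p f -> exists B, Lip B f by exact: W2p_Lip.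
have dv t n : 0 < t < T -> dot (ut t) (e n) - dot (ut' t) (e n) = - lam n * dot (v t) (e n).
  move=> /andP[t0 tT]; have ti : 0 < t <= T by rewrite t0 ltW.
  have ti' : `]0, T[%classic t by rewrite /= in_itv /= t0.
  have [P1 P2 P3] := Pu t ti'; have [Q1 Q2 Q3] := Pu' t ti'.
  have [B HB] : exists B, sprim2 (nu sg) B (u t) (D01 (u t)) (ut t).
    apply: (W2p_sprim2_rho p_gt1 rho_Lp rho_gt0 (Wu t (pos t ti)) (LipW _ (Wut t (pos t ti)))).
    by apply: aefilterS P1 => x H /H/eqP; rewrite subr_eq0 => /eqP.
  have [B' HB'] : exists B, sprim2 (nu sg) B (u' t) (D01 (u' t)) (ut' t).
    apply: (W2p_sprim2_rho p_gt1 rho_Lp rho_gt0 (Wu' t (pos t ti)) (LipW _ (Wut' t (pos t ti)))).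
    by apply: aefilterS Q1 => x H /H/eqP; rewrite subr_eq0 => /eqP.
  have HR := sprim2D HB (sprim2Z (-1) HB').
  have [L1 _] := W2p_nrm (Wut t (pos t ti)); have [L2 _] := W2p_nrm (Wut' t (pos t ti)).
  rewrite -dot_sub//.
  have -> : v t = (fun x => u t x + -1 * u' t x) by apply/funext => x; rewrite mulN1r.
  rewrite -(dot_second_eigen n HR).
  - by congr L2rho_dot; apply/funext => x; rewrite mulN1r.
  - transitivity ((alpha0 * u t 0 + beta0 * D01 (u t) 0) - (alpha0 * u' t 0 + beta0 * D01 (u' t) 0)); first by ring.
    by rewrite P2 Q2 subrr.
  - transitivity ((alpha1 * u t 1 + beta1 * D01 (u t) 1) - (alpha1 * u' t 1 + beta1 * D01 (u' t) 1)); first by ring.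
    by rewrite P3 Q3 subrr.
have v0 : nrm (v 0) = 0.
  have Z : measurable_fun I01 (fun=> 0 : R) by exact: measurable_cst.
  rewrite (nrm_aeext rI _ Z).
  - by rewrite nrmE dot0 sqrtr0.
  - by apply: L2_mes; apply: Lv; rewrite lexx ltW.
  - by apply: aefilterS2 u_0 u_0' => x H H' xi; rewrite /v H// H'// subrr.
have split3 t r : 0 <= t <= T -> 0 <= r <= T ->
    nrm (v r) <= nrm (fun x => u r x - u t x) + nrm (v t) + nrm (fun x => u' r x - u' t x).
  move=> ti ri.
  have h1 := nrm_tri rI rho_gt0 (Lu r ri) (Lu t ti) (Lu' r ri).
  have h2 := nrm_tri rI rho_gt0 (Lu t ti) (Lu' t ti) (Lu' r ri).
  have sym : nrm (fun x => u' t x - u' r x) = nrm (fun x => u' r x - u' t x).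
    rewrite !nrmE /L2rho_dot; congr (Num.sqrt _); apply: eq_Rintegral => x _; ring.
  by rewrite sym in h2; apply: le_trans h1 _; rewrite -addrA lerD2l; exact: h2.
have vn t n : 0 < t < T -> dot (v t) (e n) = 0.
  move=> /andP[t0 tT].
  (* The integrating factor of a' = - lam_n a. *)
  pose E r := (dot (u r) (e n) - dot (u' r) (e n)) * expR (lam n * r).
  have EE r : 0 <= r <= T -> E r = dot (v r) (e n) * expR (lam n * r).
    by move=> ri; rewrite /E /v dot_sub//; [exact: Lu|exact: Lu'].
  have cst ep : 0 < ep <= t -> E t = E ep.
    move=> /andP[e0 et]; apply/eqP; rewrite -subr_eq0 -normr_le0 -(mul0r `|t - ep|).
    have sub : `[ep, t] `<=` (`]0, T]%classic : set R).
      by move=> z; rewrite /= !in_itv /= => /andP[e1 e2]; rewrite (lt_le_trans e0 e1) (le_trans e2 (ltW tT)).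
    apply: (@mvt_bound R ep t E (fun=> 0) 0); rewrite ?lexx ?et//; last by move=> x _; rewrite normr0.
    move=> x xi.
    have xi' : 0 < x < T by case/andP: xi => e1 e2; rewrite (lt_le_trans e0 e1) (le_lt_trans e2 tT).
    have d1 := dot_wderiv HD sub xi (Le n); have d2 := dot_wderiv HD' sub xi (Le n).
    have := wderivM (wderivD d1 (wderivZ (k := -1) d2)) (@wderiv_exp R `[ep, t] (lam n) x).
    set l := (X in wderiv _ _ _ X -> _).
    have -> : l = 0.
      have := dv x n xi'; rewrite /v dot_sub; last 3 first.
      - by apply: Lu; case/andP: xi' => ? ?; rewrite !ltW.
      - by apply: Lu'; case/andP: xi' => ? ?; rewrite !ltW.
      - exact: Le.
      move=> dd; rewrite /l /= !mulN1r dd; ring.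
    congr wderiv; apply/funext => r; by rewrite /E mulN1r.
  have ti : 0 <= t <= T by rewrite !ltW.
  suff : E t = 0 by rewrite EE// => /eqP; rewrite mulf_eq0 (gt_eqF (expR_gt0 _)) orbF => /eqP.
  apply/eqP; rewrite -normr_le0; apply/ler_addgt0Pl => eps eps0; rewrite addr0.
  pose W := expR (`|lam n| * T); have W0 : 0 < W by exact: expR_gt0.
  have eps1 : 0 < eps / (2 * W) by rewrite divr_gt0// mulr_gt0.
  have z0 : 0 <= (0 : R) <= T by rewrite lexx ltW.
  have [d d0 Hd] := C 0 z0 _ eps1.
  pose ep := Num.min t (d / 2).
  have ep0 : 0 < ep by rewrite lt_min t0 divr_gt0.
  have ept : ep <= t by rewrite ge_min lexx.
  have epd : ep <= d / 2 by rewrite ge_min lexx orbT.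
  have epi : 0 <= ep <= T by rewrite (ltW ep0) (le_trans ept)// ltW.
  have [|n1 n2] := Hd ep epi; first by rewrite subr0 gtr0_norm// (le_lt_trans epd)// ltr_pdivrMr// ltr_pMr// ltr1n.
  have := split3 0 ep z0 epi; rewrite v0 addr0 => n3.
  rewrite (cst ep) ?ep0// EE// normrM (gtr0_norm (expR_gt0 _)).
  have b1 : `|dot (v ep) (e n)| <= eps / W.
    apply: le_trans (cauchy_schwarz rI rho_gt0 (Lv ep epi) (Le n)) _.
    rewrite [nrm (e n)]nrmE ON eqxx sqrtr1 mulr1.
    have -> : eps / W = eps / (2 * W) + eps / (2 * W) by field; rewrite gt_eqF.
    by apply: le_trans n3 _; apply: lerD; exact: ltW.
  have b2 : expR (lam n * ep) <= W.
    rewrite ler_expR; apply: le_trans (ler_norm _) _; rewrite normrM ler_wpM2l//.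
    by rewrite gtr0_norm//; case/andP: epi.
  have := ler_pM (normr_ge0 _) (expR_ge0 _) b1 b2.
  by rewrite divfK// gt_eqF.
have vz t : 0 < t < T -> nrm (v t) = 0.
  move=> ti; apply: (dense_dot0 rI rho_gt0 Le ON dense); last by move=> n; exact: vn.
  by apply: Lv; case/andP: ti => ? ?; rewrite !ltW.
have vT : nrm (v T) = 0.
  apply/eqP; rewrite eq_le nrm_ge0 andbT; apply/ler_addgt0Pl => eps eps0; rewrite addr0.
  have eps2 : 0 < eps / 2 by rewrite divr_gt0.
  have Ti : 0 <= T <= T by rewrite lexx ltW.
  have [d d0 Hd] := C T Ti _ eps2.
  pose r := T - Num.min (T / 2) (d / 2).
  have m0 : 0 < Num.min (T / 2) (d / 2) by rewrite lt_min !divr_gt0.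
  have m1 : Num.min (T / 2) (d / 2) <= T / 2 by rewrite ge_min lexx.
  have m2 : Num.min (T / 2) (d / 2) <= d / 2 by rewrite ge_min lexx orbT.
  have ri : 0 < r < T by rewrite /r gtrBl m0 andbT subr_gt0 (le_lt_trans m1)// ltr_pdivrMr// ltr_pMr// ltr1n.
  have ri' : 0 <= r <= T by case/andP: ri => ? ?; rewrite !ltW.
  have [|n1 n2] := Hd r ri'; first by rewrite /r addrAC subrr sub0r normrN gtr0_norm// (le_lt_trans m2)// ltr_pdivrMr// ltr_pMr// ltr1n.
  have := split3 r T ri' Ti; rewrite (vz r ri) addr0.
  have sym (f : R -> R -> R) : nrm (fun x => f T x - f r x) = nrm (fun x => f r x - f T x).
    rewrite !nrmE /L2rho_dot; congr (Num.sqrt _); apply: eq_Rintegral => x _; ring.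
  by move=> n3; apply: le_trans n3 _; rewrite !sym [leRHS]splitr; apply: lerD; exact: ltW.
move=> t x ti xi.
have n0 : nrm (v t) = 0.
  by case/andP: ti => t0; rewrite le_eqVlt => /predU1P[->//|tT]; apply: vz; rewrite t0.
have [B LB] := W2p_Lip (Wu t (pos t ti)); have [B' LB'] := W2p_Lip (Wu' t (pos t ti)).
have Lvt := Lip_lin 1 (-1) LB LB'.
have E : (fun x => 1 * u t x + -1 * u' t x) = v t by apply/funext => z; rewrite mul1r mulN1r.
rewrite E in Lvt; apply/eqP; rewrite -subr_eq0; apply/eqP.
exact: (nrm0_Lip rI rho_gt0 Lvt n0).
Qed.

End Uniqueness.

(** * The flat output, the control and the solution *)
Section FlatOutput.
Set Implicit Arguments. Unset Strict Implicit. Unset Printing Implicit Defensive.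
Variable R : realType.
Local Notation mu := (@lebesgue_measure R).
Local Notation I01 := (`]0%R, 1%R[%classic : set R).

Variables (p : \bar R) (rho : R -> R) (T tau : R) (alpha0 beta0 alpha1 beta1 : R)
    (lam : nat -> R) (e g : nat -> R -> R) (u0 : R -> R) (c : nat -> R) (s : R) (phi : R -> R).
Hypothesis p_gt1 : (1 < p)%E.
Hypothesis rho_Lp : Lp01 p rho.
Hypothesis rho_gt0 : ae01 (fun x => 0 < rho x).
Hypothesis T_gt0 : 0 < T.
Hypothesis tau_bounds : 0 < tau < T.
Hypothesis ab0 : (alpha0, beta0) != (0, 0).
Hypothesis ab1 : (alpha1, beta1) != (0, 0).
Hypothesis eigen : eigenbasis p rho alpha0 beta0 alpha1 beta1 lam e.
Hypothesis gen : generating_functions p rho alpha0 beta0 g.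
Hypothesis u0_L2 : L2rho rho u0.
Hypothesis u0_dec : L2rho_series rho c e u0.
Hypothesis c_l2 : cvgn (series (fun n => `|c n| ^+ 2)).
Hypothesis s_gt1 : 1 < s.
Hypothesis s_lt : (s%:E < 2%:E - p^-1)%E.
Hypothesis phi_gevrey : gevreyR s 0 (2 * T) phi.
Hypothesis phi1 : forall t, 0 <= t <= tau -> phi t = 1.
Hypothesis phi0 : forall t, T <= t <= 2 * T -> phi t = 0.

Let sg : R -> R := fun z => `|rho z|.
Let rI := rho_int p_gt1 rho_Lp.
Let sI : mu.-integrable I01 (EFin \o sg) := sg_int' p_gt1 rho_Lp.
Let sg0 : forall x, 0 <= sg x := sg_ge0' rho.
Let sL : Lp01 p sg := sg_Lp p_gt1 rho_Lp.
Let s1 : 1 <= s := ltW s_gt1.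
Let s2 : s < 2 := gevrey_order_lt2 p_gt1 s_lt.
Let b n := c n * zeta alpha0 beta0 e n.
Let y := flat_output alpha0 beta0 phi lam e c.
Let h := control alpha1 beta1 tau T y g.
Local Notation dot := (L2rho_dot rho).
Local Notation nrm := (L2rho_norm rho).

Lemma lam_lb n : lam 0%N <= lam n.
Proof. by case: n => [//|n]; have [_ H _] := eigen; apply: ltW; exact: H. Qed.

Lemma y_termE t n : y_term alpha0 beta0 lam e c t n = free_term b lam 0 t n.
Proof. by rewrite /y_term /free_term expr0 mul1r. Qed.

(** The sequence of derivatives is that of Leibniz' rule for the
    cutoff and the Dirichlet series.  All derivatives of the cutoff of order at
    least 1 vanish up to tau, and all its derivatives vanish from T on. *)
Lemma flat_output_chain : exists dy : nat -> R -> R,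
  [/\ dy 0%N = y,
      forall ep, 0 < ep -> exists M r, [/\ 0 <= M, 0 < r & gevrey_chain s ep T M r dy],
      forall k t, 0 < t <= tau -> dy k t = free_output b lam k t &
      forall k, dy k T = 0].
Proof.
have [tau0 tauT] := andP tau_bounds.
have [A [A0 HA0]] := coef_zeta_sum p_gt1 rho_Lp rho_gt0 ab0 ab1 gen eigen c_l2.
have HA : forall N, \sum_(n < N) `|b n| / (1 + `|lam n|) <= A := HA0.
have [Phi [P0 Pd [Mp [rp [Mp0 rp0 Pb]]]]] := phi_gevrey.
have Pw k t : 0 <= t <= 2 * T -> wderiv `[0, 2 * T] (Phi k) t (Phi k.+1 t).
  by move=> ti; apply: (proj1 (has_derivative_realP _ _ _) (Pd k)); rewrite /= in_itv.
have P1 k t : 0 <= t <= tau -> Phi k.+1 t = 0.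
  elim: k t => [|k IH] t ti.
    apply: (@wderiv_uniq R 0 tau (Phi 0%N) t) => //.
      apply: wderiv_subset (Pw 0%N t _); last by apply/andP; split; move: ti => /andP[]; lra.
      by move=> z /=; rewrite !in_itv /= => /andP[? ?]; apply/andP; split; lra.
    apply: wderiv_eqD (@wderiv_cst R `[0, tau] 1 t); first by rewrite /= in_itv.
    by move=> z; rewrite /= in_itv /= => zi; rewrite P0 phi1.
  apply: (@wderiv_uniq R 0 tau (Phi k.+1) t) => //.
    apply: wderiv_subset (Pw k.+1 t _); last by apply/andP; split; move: ti => /andP[]; lra.
    by move=> z /=; rewrite !in_itv /= => /andP[? ?]; apply/andP; split; lra.
  apply: wderiv_eqD (@wderiv_cst R `[0, tau] 0 t); first by rewrite /= in_itv.
  by move=> z; rewrite /= in_itv /= => zi; rewrite IH.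
have PT k t : T <= t <= 2 * T -> Phi k t = 0.
  elim: k t => [|k IH] t ti; first by rewrite P0 phi0.
  apply: (@wderiv_uniq R T (2 * T) (Phi k) t) => //; first lra.
    apply: wderiv_subset (Pw k t _); last by apply/andP; split; move: ti => /andP[]; lra.
    by move=> z /=; rewrite !in_itv /= => /andP[? ?]; apply/andP; split; lra.
  apply: wderiv_eqD (@wderiv_cst R `[T, 2 * T] 0 t); first by rewrite /= in_itv.
  by move=> z; rewrite /= in_itv /= => zi; rewrite IH.
exists (fun k => leib Phi (free_output b lam) k 0 0); split.
- rewrite /y /flat_output; apply/funext => t /=; rewrite P0; congr (_ * _).
  by rewrite /free_output /ser; congr (limn (series _)); apply/funext => n; rewrite y_termE.
- move=> ep e0.
  have [MY [MY0 HY]] := free_output_gevrey lam_lb HA T s1 e0.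
  pose r := Num.min rp (ep / 2).
  have r0 : 0 < r by rewrite /r lt_min rp0 divr_gt0.
  exists (Mp * MY), (r / 2); split; [exact: mulr_ge0 (ltW Mp0) MY0|exact: divr_gt0|].
  apply: leib_gevrey_chain => //; first exact: ltW.
  + move=> k t /andP[et tT]; have ti : 0 <= t <= 2 * T by apply/andP; split; lra.
    split.
      apply: wderiv_subset (Pw k t ti).
      by move=> z /=; rewrite !in_itv /= => /andP[? ?]; apply/andP; split; lra.
    apply: le_trans (Pb k t _) _; first by rewrite /= in_itv.
    by apply: (@gevrey_maj_le R s Mp rp Mp r) => //; rewrite ?(ltW Mp0)// /r ge_min lexx.
  + move=> k t ti; split; first exact: (free_output_wderiv (k := k) lam_lb HA e0 ti).
    apply: le_trans (HY k t ti) _.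
    by apply: (@gevrey_maj_le R s MY (ep / 2) MY r) => //; rewrite /r ge_min lexx orbT.
- move=> k t /andP[t0 tt].
  have ti : 0 <= t <= tau by rewrite (ltW t0).
  have := @leib_delta R Phi (free_output b lam) t _ _ k 0; rewrite P0 phi1//.
  by move=> /(_ erefl (fun k => P1 k t ti))[-> _]; rewrite add0n.
- by move=> k; apply: leib_zero => j; apply: PT; apply/andP; split; lra.
Qed.

Lemma D2_rho_sg f w : ae01 (fun x => D2 f x = sg x * w x) -> ae01 (fun x => D2 f x = rho x * w x).
Proof. by apply: aefilterS2 (rho_sg rho_gt0) => x H1 H2 xi; rewrite (H2 xi) (H1 xi). Qed.

Let lamlb : forall n, lam 0%N <= lam n := lam_lb.

Variable dy : nat -> R -> R.
Hypothesis dy0 : dy 0%N = y.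
Hypothesis dy_chain : forall ep, 0 < ep -> exists M r, [/\ 0 <= M, 0 < r & gevrey_chain s ep T M r dy].
Hypothesis dy_free : forall k t, 0 < t <= tau -> dy k t = free_output b lam k t.
Hypothesis dy_T : forall k, dy k T = 0.
Variables C K : R.
Hypothesis C0 : 0 <= C.
Hypothesis K0 : 0 <= K.
Hypothesis Hg : forall i, sprim2 (nu sg) (gen_maj C K i) (g i) (D01 (g i)) (gprev g i).

Lemma flat_sum_cv (ga : nat -> R) C' k t : 0 <= C' -> 0 < t <= T -> (forall i, `|ga i| <= gen_maj C' K i) ->
  cvgn (series (fun i => dy (i + k)%N t * ga i)).
Proof.
move=> C0' /andP[t0 tT] H; have [M [r [M0 r0 Hc]]] := dy_chain t0.
apply: (flat_sum_cvg s1 s2 C0' K0 M0 r0) => // j.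
by case: (Hc j t); rewrite ?lexx ?tT.
Qed.

Lemma gen_le_maj i x : 0 <= x <= 1 -> [/\ `|g i x| <= gen_maj C K i, `|D01 (g i) x| <= gen_maj C K i & `|gprev g i x| <= gen_maj C K i].
Proof. by move=> xi; exact: (gen_le Hg). Qed.

Lemma flat_sum_lin (ga de : nat -> R) a a' k t : 0 < t <= T ->
  (forall i, `|ga i| <= gen_maj C K i) -> (forall i, `|de i| <= gen_maj C K i) ->
  flat_sum dy (fun i => a * ga i + a' * de i) k t = a * flat_sum dy ga k t + a' * flat_sum dy de k t.
Proof.
move=> ti H1 H2.
have [_ <-] := ser_lin a a' (flat_sum_cv C0 ti H1 (k := k)) (flat_sum_cv C0 ti H2 (k := k)).
by rewrite /flat_sum; congr ser; apply/funext => i; ring.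
Qed.

(** The k-th time derivative of the flat series. *)
Definition flat_u k t : R -> R := flat_fun g dy k t.
Definition flat_ux k t : R -> R := flat_fun (fun i => D01 (g i)) dy k t.

(** The second derivative in x shifts the index of the g_i, which is the same
    as differentiating y once more: this is the heat equation. *)
Lemma flat_u_w k t x : 0 < t <= T -> 0 <= x <= 1 -> flat_fun (gprev g) dy k t x = flat_u k.+1 t x.
Proof.
move=> ti xi; rewrite /flat_fun /flat_sum ser_shift; first last.
- by apply: (flat_sum_cv C0 ti) => i; case: (gen_le_maj i xi).
- by rewrite /= mulr0.
by rewrite /flat_u /flat_fun /flat_sum; congr ser; apply/funext => i /=; rewrite addSnnS.
Qed.

Lemma flat_u_sprim2 ep : 0 < ep -> exists M' r', [/\ 0 < M', 0 < r',
    forall k t, ep <= t <= T -> sprim2 (nu sg) (gevrey_maj s M' r' k) (flat_u k t) (flat_ux k t) (flat_u k.+1 t) &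
    forall k t t', ep <= t <= T -> ep <= t' <= T -> t' != t ->
      sprim2 (nu sg) (`|t' - t| * gevrey_maj s M' r' k.+2)
       (fun x => (t' - t)^-1 * (flat_u k t' x - flat_u k t x) - flat_u k.+1 t x)
       (fun x => (t' - t)^-1 * (flat_ux k t' x - flat_ux k t x) - flat_ux k.+1 t x)
       (fun x => (t' - t)^-1 * (flat_u k.+1 t' x - flat_u k.+1 t x) - flat_u k.+2 t x)].
Proof.
move=> e0; have [M [r [M0 r0 Hc]]] := dy_chain e0.
have [M' [r' [M0' r0' H1 H2]]] := flat_fun_sprim2 s1 s2 C0 K0 Hg M0 r0 Hc.
have pos t : ep <= t <= T -> 0 < t <= T by move=> /andP[et ->]; rewrite (lt_le_trans e0).
exists M', r'; split => //.
- move=> k t ti; apply: sprim2_ext (H1 k t ti) => x xi; split => //.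
  by rewrite flat_u_w// pos.
- move=> k t t' ti ti' tt; apply: sprim2_ext (H2 k t t' ti ti' tt) => x xi; split => //.
  by rewrite !flat_u_w// pos.
Qed.

Lemma flat_u_diff ep k : 0 < ep -> exists Kc, 0 <= Kc /\ forall t t', ep <= t <= T -> ep <= t' <= T ->
  sprim2 (nu sg) (Kc * `|t' - t|) (fun x => flat_u k t' x - flat_u k t x) (fun x => flat_ux k t' x - flat_ux k t x)
    (fun x => flat_u k.+1 t' x - flat_u k.+1 t x).
Proof.
move=> e0; have [M' [r' [M0 r0 H1 H2]]] := flat_u_sprim2 e0.
have P0 j : 0 <= gevrey_maj s M' r' j by apply: gevrey_maj_ge0; exact: ltW.
exists (T * gevrey_maj s M' r' k.+2 + gevrey_maj s M' r' k.+1); split.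
  by rewrite addr_ge0// mulr_ge0// ltW.
move=> t t' ti ti'; have [->|tt] := eqVneq t' t.
  by apply: sprim2_ext (sprim2_le _ (sprim20 _)) => [x _|]; rewrite ?subrr// normr0 mulr0.
have tn : t' - t != 0 by rewrite subr_eq0.
have := sprim2Z (t' - t) (sprim2D (H2 k t t' ti ti' tt) (H1 k.+1 t ti)).
move=> H; apply: sprim2_le (_ : `|t' - t| * (`|t' - t| * gevrey_maj s M' r' k.+2 + gevrey_maj s M' r' k.+1) <= _) _.
  rewrite mulrC ler_wpM2r// lerD2r ler_wpM2r//.
  rewrite ler_norml; move: ti ti' => /andP[? ?] /andP[? ?]; apply/andP; split; lra.
by apply: sprim2_ext H => x _; split; field.
Qed.

Lemma pos_range t : 0 < t <= T -> t <= t <= T. Proof. by move=> /andP[_ ->]; rewrite lexx. Qed.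

Lemma flat_u_sprim21 k t : 0 < t <= T -> exists B, sprim2 (nu sg) B (flat_u k t) (flat_ux k t) (flat_u k.+1 t).
Proof.
move=> ti; have [M' [r' [_ _ H _]]] := flat_u_sprim2 (proj1 (andP ti)).
by exists (gevrey_maj s M' r' k); apply: H; exact: pos_range.
Qed.

Lemma flat_u_W2p k t : 0 < t <= T -> W2p p (flat_u k t).
Proof. by move=> /(flat_u_sprim21 k)[B HB]; have [] := sprim2_W2p p_gt1 sg0 sL HB. Qed.

Lemma flat_u_D01 k t x : 0 < t <= T -> 0 <= x <= 1 -> D01 (flat_u k t) x = flat_ux k t x.
Proof. by move=> /(flat_u_sprim21 k)[B HB] xi; exact: (sprim2_D01 sI HB). Qed.

Lemma flat_u_D2 k t : 0 < t <= T -> ae01 (fun x => D2 (flat_u k t) x = rho x * flat_u k.+1 t x).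
Proof.
move=> /(flat_u_sprim21 k)[B HB]; apply: D2_rho_sg => //.
exact: (sprim2_D2 p_gt1 sg0 sL HB).
Qed.

Lemma flat_u_L2 k t : 0 < t <= T -> L2rho rho (flat_u k t).
Proof. by move=> /(flat_u_sprim21 k)[B HB]; have [] := L2_Lip rI rho_gt0 (sprim2_Lip0 rI HB). Qed.

Lemma flat_u_bc0 k t : 0 < t <= T -> alpha0 * flat_u k t 0 + beta0 * flat_ux k t 0 = 0.
Proof.
move=> ti; rewrite -flat_sum_lin//; [|by move=> i; case: (gen_le_maj i (zero01 R))..].
rewrite /flat_sum -[RHS]ser0; congr ser; apply/funext => i.
suff -> : alpha0 * g i 0 + beta0 * D01 (g i) 0 = 0 by rewrite mulr0.
have [_ [_ H0 _] HS] := gen.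
by case: i => [//|i]; have [_ -> ->] := HS i; rewrite !mulr0 addr0.
Qed.

Let bdry1 i := alpha1 * g i 1 + beta1 * D01 (g i) 1.

Lemma bdry1_bound i : `|bdry1 i| <= gen_maj ((`|alpha1| + `|beta1|) * C) K i.
Proof.
have [h1 h2 _] := gen_le_maj i (one01 R).
have -> : gen_maj ((`|alpha1| + `|beta1|) * C) K i = `|alpha1| * gen_maj C K i + `|beta1| * gen_maj C K i.
  by rewrite /gen_maj; ring.
by apply: le_trans (ler_normD _ _) _; rewrite !normrM lerD// ler_wpM2l.
Qed.

Let bdry1_C := (`|alpha1| + `|beta1|) * C.
Lemma bdry1_C_ge0 : 0 <= bdry1_C. Proof. by rewrite mulr_ge0 ?addr_ge0. Qed.

Lemma flat_u_bc1 k t : 0 < t <= T -> alpha1 * flat_u k t 1 + beta1 * flat_ux k t 1 = flat_sum dy bdry1 k t.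
Proof. by move=> ti; rewrite -flat_sum_lin// => i; case: (gen_le_maj i (one01 R)). Qed.

Lemma flat_u_T x : flat_u 0 T x = 0.
Proof.
rewrite /flat_u /flat_fun /flat_sum -[RHS]ser0; congr ser; apply/funext => i.
by rewrite dy_T mul0r.
Qed.

Lemma coef_sum_bound : exists A, forall N, \sum_(n < N) `|b n| / (1 + `|lam n|) <= A.
Proof.
have [A [A0 HA0]] := coef_zeta_sum p_gt1 rho_Lp rho_gt0 ab0 ab1 gen eigen c_l2.
by exists A; exact: HA0.
Qed.

Lemma ser_eigen (ga : nat -> R) (z v q : R) : (forall i, `|ga i| <= gen_maj C K i) ->
  (fun k => z * \sum_(i < k) q ^+ i * ga i) @ \oo --> v ->
  z * ser (fun i => q ^+ i * ga i) = v.
Proof.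
move=> H Hv.
have [S HS] := pow_gen_sum q C0 K0.
have : cvgn (series (fun i => q ^+ i * ga i)).
  apply: (@abs_series_cvg _ _ S) => N; apply: le_trans (HS N).
  by apply: ler_sum => i _; rewrite normrM normrX ler_wpM2l ?exprn_ge0//; exact: H.
move=> /cvg_ex[l Hl]; rewrite /ser (cvg_lim (@Rhausdorff R) Hl).
have H2 : (fun k => z * \sum_(i < k) q ^+ i * ga i) @ \oo --> z * l.
  apply: cvgMr; rewrite -(eq_cvg _ _ (fun n => big_mkord xpredT (fun i => q ^+ i * ga i))).
  exact: Hl.
by rewrite -(cvg_lim (@Rhausdorff R) H2) (cvg_lim (@Rhausdorff R) Hv).
Qed.

Lemma flat_sum_free (ga : nat -> R) t : 0 < t <= tau -> flat_sum dy ga 0 t = flat_sum (free_output b lam) ga 0 t.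
Proof. by move=> ti; rewrite /flat_sum; congr ser; apply/funext => i; rewrite dy_free. Qed.

(** Before tau the flat series is the free evolution, by
    [flat_sum_expand] and the expansion of each e_n over the g_i. *)
Lemma flat_u_expand ep : 0 < ep -> exists D, 0 <= D /\ forall t x N, ep <= t <= tau -> 0 <= x <= 1 ->
  `|flat_u 0 t x - \sum_(n < N) c n * expR (- lam n * t) * e n x| <= coef_tail b lam N * D.
Proof.
move=> e0; have [A HA] := coef_sum_bound.
have [D [D0 HD]] := flat_sum_expand s1 s2 C0 K0 lamlb HA T e0.
exists D; split => // t x N /andP[et tt] xi; have [_ tauT] := andP tau_bounds.
have ti : ep <= t <= T by rewrite et (le_trans tt)// ltW.
have ti' : 0 < t <= tau by rewrite tt (lt_le_trans e0).
have Hx i : `|g i x| <= gen_maj C K i by case: (gen_le_maj i xi).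
have := HD (fun i => g i x) t N ti Hx.
rewrite -flat_sum_free//; congr (`|_ - _| <= _); apply: eq_bigr => n _.
have [_ _ En] := eigen.
have [H1 _] := eigen_expansion p_gt1 rho_Lp rho_gt0 ab0 gen (En n) xi.
by rewrite -(ser_eigen Hx H1) /b /zeta; ring.
Qed.

(** Each e_n satisfies the right boundary condition, so every partial
    sum of the expanded series is 0. *)
Lemma flat_sum_bdry1_0 t : 0 < t <= tau -> flat_sum dy bdry1 0 t = 0.
Proof.
move=> ti; have [t0 tt] := andP ti; have [_ tauT] := andP tau_bounds.
have [A HA] := coef_sum_bound.
have [D [D0 HD]] := flat_sum_expand s1 s2 bdry1_C_ge0 K0 lamlb HA T t0.
have ti' : t <= t <= T by rewrite lexx (le_trans tt)// ltW.
rewrite flat_sum_free//; set v := flat_sum _ _ _ _.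
have H N : `|v| <= coef_tail b lam N * D.
  have := HD bdry1 t N ti' bdry1_bound; rewrite -/v big1 ?subr0// => n _.
  have [_ _ En] := eigen; have [_ _ _ bc1] := En n.
  have [H1 H2] := eigen_expansion p_gt1 rho_Lp rho_gt0 ab0 gen (En n) (one01 R).
  have Hx i : `|g i 1| <= gen_maj C K i by case: (gen_le_maj i (one01 R)).
  have Hx1 i : `|D01 (g i) 1| <= gen_maj C K i by case: (gen_le_maj i (one01 R)).
  have cv (d : nat -> R) : (forall i, `|d i| <= gen_maj C K i) -> cvgn (series (fun i => (- lam n) ^+ i * d i)).
    move=> Hd; have [S HS] := pow_gen_sum (- lam n) C0 K0.
    apply: (@abs_series_cvg _ _ S) => N'; apply: le_trans (HS N').
    by apply: ler_sum => i _; rewrite normrM normrX ler_wpM2l ?exprn_ge0//; exact: Hd.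
  have [_ E] := ser_lin alpha1 beta1 (cv _ Hx) (cv _ Hx1).
  have -> : ser (fun i => (- lam n) ^+ i * bdry1 i) =
     alpha1 * ser (fun i => (- lam n) ^+ i * g i 1) + beta1 * ser (fun i => (- lam n) ^+ i * D01 (g i) 1).
    by rewrite -E; congr ser; apply/funext => i; rewrite /bdry1; ring.
  set S1 := ser _ in H1 *; set S2 := ser _.
  transitivity (c n * expR (- lam n * t) * (alpha1 * (zeta alpha0 beta0 e n * S1) + beta1 * (zeta alpha0 beta0 e n * S2))).
    by rewrite /b; ring.
  have E1 : zeta alpha0 beta0 e n * S1 = e n 1 by apply: ser_eigen Hx H1.
  have E2 : zeta alpha0 beta0 e n * S2 = D01 (e n) 1 by apply: ser_eigen Hx1 H2.
  by rewrite E1 E2 bc1 mulr0.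
have Hc : (fun N => coef_tail b lam N * D) @ \oo --> (0 : R).
  rewrite -(mul0r D); apply: cvgM; last exact: cvg_cst.
  exact: (coef_tail_cvg HA).
have L := cvg_lim (@Rhausdorff R) Hc.
apply/eqP; rewrite -normr_le0 -L; apply: limr_ge; first by apply/cvg_ex; eexists; exact: Hc.
exact: nearW.
Qed.

Lemma nderiv_dy i t : tau <= t <= T -> nderiv_within i `[tau, T] y t = dy i t.
Proof.
have [tau0 tauT] := andP tau_bounds.
have [M [r [M0 r0 Hc]]] := dy_chain tau0.
move=> ti; rewrite -dy0; apply: nderiv_within_chain => // k x xi.
by case: (Hc k x xi).
Qed.

(** The two formulas in the definition of the control are one: the
    series vanishes for t <= tau. *)
Lemma control_flat_sum t : 0 < t <= T -> h t = flat_sum dy bdry1 0 t.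
Proof.
move=> /andP[t0 tT]; rewrite /h /control; case: leP => tt.
  by rewrite flat_sum_bdry1_0// t0.
rewrite /flat_sum /ser; congr (limn (series _)); apply/funext => i.
by rewrite /h_term nderiv_dy ?addn0// (ltW tt).
Qed.

Lemma h_term_cvg t : tau < t <= T -> cvgn (series (h_term alpha1 beta1 tau T y g t)).
Proof.
move=> /andP[tt tT]; have [tau0 tauT] := andP tau_bounds.
have ti : 0 < t <= T by rewrite tT (lt_trans tau0).
have -> : h_term alpha1 beta1 tau T y g t = (fun i => dy (i + 0)%N t * bdry1 i).
  by apply/funext => i; rewrite /h_term nderiv_dy ?addn0// (ltW tt).
exact: (flat_sum_cv bdry1_C_ge0 ti bdry1_bound).
Qed.

(** The derivatives of h are 0 up to tau and those of the series on
    [tau / 2, T]; the two descriptions agree on the overlap, so no matching of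
    one-sided derivatives at tau is needed. *)
Lemma h_gevrey : gevreyR s 0 T h.
Proof.
have [tau0 tauT] := andP tau_bounds.
have t20 : 0 < tau / 2 by rewrite divr_gt0.
have [M [r [M0 r0 Hc]]] := dy_chain t20.
have [M' [r' [M0' r0' HV]]] := flat_sum_chain s1 s2 bdry1_C_ge0 K0 M0 r0 Hc.
have Hch := HV bdry1 bdry1_bound.
pose V k t := if t <= tau then 0 else flat_sum dy bdry1 k t.
have Z k t : tau / 2 <= t <= tau -> flat_sum dy bdry1 k t = 0.
  elim: k t => [|k IH] t ti.
    by apply: flat_sum_bdry1_0; case/andP: ti => ? ->; rewrite andbT; lra.
  apply: (@wderiv_uniq R (tau / 2) tau (flat_sum dy bdry1 k) t) => //; first lra.
    have ti' : tau / 2 <= t <= T by case/andP: ti => -> ?; lra.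
    apply: wderiv_subset (Hch k t ti').1.
    by move=> z /=; rewrite !in_itv /= => /andP[? ?]; apply/andP; split; lra.
  apply: wderiv_eqD (@wderiv_cst R `[tau / 2, tau] 0 t); first by rewrite /= in_itv.
  by move=> z; rewrite /= in_itv /= => zi; rewrite IH.
have VE k t : tau / 2 <= t -> V k t = flat_sum dy bdry1 k t.
  by move=> tt; rewrite /V; case: leP => // ttau; rewrite Z// tt.
exists (fun k => if k is 0%N then h else V k); split => //.
- case=> [|k]; apply/has_derivative_realP => t; rewrite /= in_itv /= => /andP[t0 tT].
  + have E0 : forall z, h z = if z <= tau then 0 else h z.
      by move=> z; rewrite {1}/h /control; case: leP => // zt; rewrite /h /control leNgt zt.
    have [lt|ge] := ltP t tau.
      apply: (@wderiv_local R _ setT _ (fun=> 0) t _ (tau - t)) => //; rewrite ?subr_gt0//.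
      - move=> z _ /ltr_normlW zt; split => //; rewrite E0 ifT//; lra.
      - by rewrite E0 ifT// ltW.
      rewrite /V ifT ?(ltW lt)//; exact: wderiv_cst.
    apply: (@wderiv_local R _ `[tau / 2, T] _ (flat_sum dy bdry1 0) t _ (tau / 2)) => //.
    - move=> z; rewrite /= !in_itv /= => /andP[z0 zT]; rewrite ltr_norml => /andP[? ?].
      by split; [apply/andP; split; lra|rewrite control_flat_sum//; apply/andP; split; lra].
    - by rewrite control_flat_sum//; apply/andP; split; lra.
    rewrite VE; last lra.
    by apply: (Hch 0%N t _).1; apply/andP; split; lra.
  + have [lt|ge] := ltP t tau.
      apply: (@wderiv_local R _ setT _ (fun=> 0) t _ (tau - t)) => //; rewrite ?subr_gt0//.
      - move=> z _ /ltr_normlW zt; split => //; rewrite /V ifT//; lra.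
      - by rewrite /V ifT// ltW.
      rewrite /V ifT ?(ltW lt)//; exact: wderiv_cst.
    apply: (@wderiv_local R _ `[tau / 2, T] _ (flat_sum dy bdry1 k.+1) t _ (tau / 2)) => //.
    - move=> z; rewrite /= !in_itv /= => /andP[z0 zT]; rewrite ltr_norml => /andP[? ?].
      by split; [apply/andP; split; lra|rewrite VE//; lra].
    - by rewrite VE//; lra.
    rewrite VE; last lra.
    by apply: (Hch k.+1 t _).1; apply/andP; split; lra.
- exists M', r'; split => // k t; rewrite /= in_itv /= => /andP[t0 tT].
  have Vb : `|V k t| <= gevrey_maj s M' r' k.
    rewrite /V; case: (leP t tau) => tt; first by rewrite normr0 gevrey_maj_ge0// ltW.
    by apply: (Hch k t _).2; apply/andP; split; lra.
  case: k Vb => // Vb; apply: le_trans Vb.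
  have -> : h t = V 0%N t; last exact: lexx.
  rewrite /V; case: (leP t tau) => tt; first by rewrite /h /control tt.
  by rewrite control_flat_sum//; apply/andP; split; lra.
Qed.

(** Solutions are only determined on [0, 1], whereas functions are defined on
    the line; regularity in time is therefore proved for every function with the
    values of the flat series. *)
Definition agrees (u : R -> R -> R) k := forall t x, 0 < t <= T -> 0 <= x <= 1 -> u t x = flat_u k t x.

Lemma agrees_flat_u k : agrees (flat_u k) k. Proof. by []. Qed.

Lemma agrees_W2p u k t : agrees u k -> 0 < t <= T -> W2p p (u t).
Proof. by move=> H ti; apply: W2p_ext (flat_u_W2p k ti) => x xi; rewrite H. Qed.

Lemma agrees_hd u v k (D : set R) : agrees u k -> agrees v k.+1 -> D `<=` `]0, T] ->
  has_derivative_in (W2p p) (W2p_norm p) D u v.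
Proof.
move=> Hu Hv DT.
have D0 t : D t -> 0 < t <= T by move=> /DT; rewrite /= in_itv.
apply: has_derivative_in_local; first exact: W2p_norm_ge0.
- by move=> t /D0; apply: agrees_W2p; eassumption.
- by move=> t /D0; apply: agrees_W2p; eassumption.
move=> t /D0 ti; have [t0 tT] := andP ti.
have t20 : 0 < t / 2 by rewrite divr_gt0.
have [M' [r' [M0 r0 _ H2]]] := flat_u_sprim2 t20.
exists (gevrey_maj s M' r' k.+2 * (2 + Lp01_norm p sg)), (t / 2); split => // r /D0 ri rt rd.
have ti' : t / 2 <= t <= T by rewrite tT andbT; lra.
have ri' : t / 2 <= r <= T by rewrite (half_le_near t0 rd); case/andP: ri.
have [W N] := sprim2_W2p p_gt1 sg0 sL (H2 k t r ti' ri' rt).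
rewrite -(@W2p_norm_ext R p (fun x => (r - t)^-1 * (flat_u k r x - flat_u k t x) - flat_u k.+1 t x)) //.
  by apply: le_trans N _; rewrite le_eqVlt; apply/orP; left; apply/eqP; ring.
by move=> x xi; rewrite -(Hu r x ri xi) -(Hu t x ti xi) -(Hv t x ti xi).
Qed.

Lemma agrees_cont u k (D : set R) : agrees u k -> D `<=` `]0, T] ->
  continuous_in (W2p p) (W2p_norm p) D u.
Proof.
move=> Hu DT.
have D0 t : D t -> 0 < t <= T by move=> /DT; rewrite /= in_itv.
apply: continuous_in_local; first exact: W2p_norm_ge0.
- by move=> t /D0; apply: agrees_W2p; eassumption.
move=> t /D0 ti; have [t0 tT] := andP ti.
have t20 : 0 < t / 2 by rewrite divr_gt0.
have [Kc [Kc0 H]] := flat_u_diff k t20.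
exists (Kc * (2 + Lp01_norm p sg)), (t / 2); split => // r /D0 ri rd.
have ti' : t / 2 <= t <= T by rewrite tT andbT; lra.
have ri' : t / 2 <= r <= T by rewrite (half_le_near t0 rd); case/andP: ri.
have [W N] := sprim2_W2p p_gt1 sg0 sL (H t r ti' ri').
rewrite -(@W2p_norm_ext R p (fun x => flat_u k r x - flat_u k t x)) //.
  by apply: le_trans N _; rewrite le_eqVlt; apply/orP; left; apply/eqP; ring.
by move=> x xi; rewrite -(Hu r x ri xi) -(Hu t x ti xi).
Qed.

Lemma agrees_gevrey u eps : agrees u 0 -> 0 < eps < T -> gevrey (W2p p) (W2p_norm p) s eps T u.
Proof.
move=> Hu /andP[e0 eT]; exists (fun k => if k is 0%N then u else flat_u k).
have Ha k : agrees (if k is 0%N then u else flat_u k) k by case: k.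
have sub : `[eps, T] `<=` (`]0, T]%classic : set R).
  by move=> z /=; rewrite !in_itv /= => /andP[ez ->]; rewrite (lt_le_trans e0).
split => //; first by move=> k; exact: (agrees_hd (Ha k) (Ha k.+1) sub).
have [M' [r' [M0 r0 H1 _]]] := flat_u_sprim2 e0.
exists (M' * (2 + Lp01_norm p sg)), r'; split => //.
  by rewrite mulr_gt0// ltr_wpDr// Lp01_norm_ge0.
move=> k t; rewrite /= in_itv /= => ti.
have ti' : 0 < t <= T by move: ti => /andP[et ->]; rewrite (lt_le_trans e0).
have [W N] := sprim2_W2p p_gt1 sg0 sL (H1 k t ti).
rewrite -(@W2p_norm_ext R p (flat_u k t)) //; last by move=> x xi; rewrite (Ha k t x).
by apply: le_trans N _; rewrite /gevrey_maj le_eqVlt; apply/orP; left; apply/eqP; ring.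
Qed.

(** At t = 0 the flat series is not available and u_0 is only square
    integrable. *)
Definition sol (t : R) : R -> R := if t <= 0 then u0 else flat_u 0 t.

Lemma sol_pos t : 0 < t -> sol t = flat_u 0 t.
Proof. by move=> t0; rewrite /sol leNgt t0. Qed.

Lemma agrees_sol : agrees sol 0.
Proof. by move=> t x /andP[t0 _] _; rewrite sol_pos. Qed.

Lemma sol_L2 t : 0 <= t <= T -> L2rho rho (sol t).
Proof.
move=> /andP[t0 tT]; rewrite /sol; case: (leP t 0) => // t0'.
by apply: flat_u_L2; rewrite t0'.
Qed.

Lemma Le n : L2rho rho (e n). Proof. by have [[H _ _] _ _] := eigen. Qed.

Lemma ONe m n : dot (e m) (e n) = (m == n)%:R. Proof. by have [[_ H _] _ _] := eigen. Qed.

Definition decay_coef t n := c n * expR (- lam n * t).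

Lemma nu1_ge0 : 0 <= Num.sqrt (nu sg 1). Proof. exact: sqrtr_ge0. Qed.

Lemma flat_u_fsum ep : 0 < ep -> exists D, 0 <= D /\ forall t N, ep <= t <= tau ->
  nrm (fun x => flat_u 0 t x - fsum e (decay_coef t) N x) <= coef_tail b lam N * D.
Proof.
move=> e0; have [D [D0 HD]] := flat_u_expand e0.
exists (D * Num.sqrt (nu sg 1)); split; first exact: mulr_ge0 D0 nu1_ge0.
move=> t N ti; rewrite mulrA.
have [_ tauT] := andP tau_bounds.
have ti' : 0 < t <= T by move: ti => /andP[? ?]; apply/andP; split; lra.
have [] // := @L2_bounded R rho rI rho_gt0 (fun x => flat_u 0 t x - fsum e (decay_coef t) N x) (coef_tail b lam N * D).
  apply: measurable_funB; first by case: (flat_u_L2 0 ti').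
  by case: (L2_fsum rI rho_gt0 Le (decay_coef t) N).
by move=> x xi; exact: HD.
Qed.

Lemma coef_tailM_cvg D : (fun N => coef_tail b lam N * D) @ \oo --> (0 : R).
Proof.
have [A HA] := coef_sum_bound.
by rewrite -(mul0r D); apply: cvgM; [exact: (coef_tail_cvg HA)|exact: cvg_cst].
Qed.

Lemma flat_u_fsum_cvg t : 0 < t <= tau ->
  nrm (fun x => flat_u 0 t x - fsum e (decay_coef t) N x) @[N --> \oo] --> (0 : R).
Proof.
move=> /andP[t0 tt]; have [D [_ HD]] := flat_u_fsum t0.
apply: (@squeeze0 R _ (fun N => coef_tail b lam N * D)); last exact: coef_tailM_cvg.
  by move=> N; exact: nrm_ge0.
by move=> N; apply: HD; rewrite lexx.
Qed.

Lemma c_tail eta : 0 < eta -> exists N, forall M, (N <= M)%N -> \sum_(N <= k < M) c k ^+ 2 <= eta ^+ 2.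
Proof.
move=> eta0.
have e20 : 0 < eta ^+ 2 by rewrite exprn_gt0.
have Cy : cauchy (series (fun n => `|c n| ^+ 2) @ \oo) by exact: cvg_cauchy.
have := (cauchy_seriesP (fun n => `|c n| ^+ 2)).1 Cy _ e20.
move=> [[P1 P2] [[N1 _ HN1] [N2 _ HN2]] HP].
exists (maxn N1 N2) => M NM.
have := HP (maxn N1 N2, M); rewrite /= => /(_ _)/ltW H.
have : `|\sum_(maxn N1 N2 <= k < M) `|c k| ^+ 2| <= eta ^+ 2.
  apply: H; split; [apply: HN1|apply: HN2] => /=; first exact: leq_maxl.
  by apply: leq_trans NM; exact: leq_maxr.
rewrite ger0_norm; last by apply: sumr_ge0 => k _; rewrite exprn_ge0.
by apply: le_trans; rewrite le_eqVlt; apply/orP; left; apply/eqP; apply: eq_bigr => k _; rewrite real_normK ?num_real.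
Qed.

Lemma exp_lip m t : 0 <= t <= T -> `|expR (m * t) - 1| <= `|m| * expR (`|m| * T) * t.
Proof.
move=> ti; have [t0 tT] := andP ti.
have := @mvt_bound R 0 T (fun r => expR (m * r)) (fun r => m * expR (m * r)) (`|m| * expR (`|m| * T)).
move=> /(_ (fun x _ => @wderiv_exp R _ m x)) H.
have := H _ 0 t _ ti; rewrite mulr0 expR0 subr0 (ger0_norm t0); apply; last by rewrite lexx ltW.
move=> x /andP[x0 xT]; rewrite normrM (ger0_norm (expR_ge0 _)) ler_wpM2l// ler_expR.
by apply: le_trans (_ : `|m| * x <= _); [rewrite ler_wpM2r// ler_norm|rewrite ler_wpM2l].
Qed.

(** Split both the solution and u_0 at rank N.  The remainders are small
    uniformly in time by [series_tail], since exp(- lam_n t) is bounded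
    uniformly in n; the finite sums converge termwise. *)
Lemma sol_cont0 eps : 0 < eps -> exists2 d, 0 < d & forall r, 0 <= r <= T -> r < d -> nrm (fun x => sol r x - u0 x) < eps.
Proof.
move=> eps0; have [tau0 tauT] := andP tau_bounds.
have quarters (x y' z : R) : x <= eps / 4 -> y' < eps / 4 -> z <= eps / 4 -> x + (y' + z) < eps by lra.
pose EE := expR (`|lam 0%N| * T).
have E1 : 1 <= EE by rewrite -expR0 ler_expR mulr_ge0// ltW.
have EE0 : 0 < EE by apply: lt_le_trans E1.
(* The two remainders and the difference of the finite sums get eps / 4 each. *)
pose eta := eps / (4 * EE).
have eta0 : 0 < eta by rewrite divr_gt0// mulr_gt0.
have [N HN] := c_tail eta0.
pose Q := \sum_(k < N) (c k * (`|lam k| * expR (`|lam k| * T))) ^+ 2.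
have Q0 : 0 <= Q by apply: sumr_ge0 => k _; exact: sqr_ge0.
exists (Num.min tau (eps / (4 * (Num.sqrt Q + 1)))).
  by rewrite lt_min tau0 divr_gt0// mulr_gt0// ltr_wpDl// sqrtr_ge0.
move=> r /[dup] ri /andP[r0 rT]; rewrite lt_min => /andP[rtau rQ].
move: r0; rewrite le_eqVlt => /predU1P[<-|r0].
  rewrite /sol lexx (@nrm_ext _ _ _ (fun=> 0)); last by move=> x _; rewrite subrr.
  by rewrite nrmE dot0 sqrtr0.
rewrite (sol_pos r0).
have Lu : L2rho rho (flat_u 0 r) by apply: flat_u_L2; rewrite r0.
have Lc := L2_fsum rI rho_gt0 Le.
have rt : 0 < r <= tau by rewrite r0 ltW.
have h1 : nrm (fun x => flat_u 0 r x - fsum e (decay_coef r) N x) <= EE * eta.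
  apply: (series_tail rI rho_gt0 Le ONe Lu).
  - by rewrite mulr_ge0 ?ltW.
  - exact: flat_u_fsum_cvg.
  - move=> M NM; rewrite exprMn.
    apply: le_trans (_ : \sum_(N <= k < M) EE ^+ 2 * c k ^+ 2 <= _).
      apply: ler_sum => k _; rewrite /decay_coef exprMn mulrC ler_wpM2r ?sqr_ge0//.
      apply: lerXn2r; rewrite ?nnegrE ?expR_ge0 ?(ltW EE0)// ler_expR.
      apply: le_trans (_ : `|lam 0%N| * r <= _); last by rewrite ler_wpM2l.
      rewrite ler_wpM2r ?(ltW r0)//; have := lamlb k; have := ler_norm (- lam 0%N); rewrite normrN; lra.
    by rewrite -mulr_sumr ler_wpM2l ?sqr_ge0// HN.
have h3 : nrm (fun x => u0 x - fsum e c N x) <= eta.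
  by apply: (series_tail rI rho_gt0 Le ONe u0_L2) => //; exact: ltW.
have h2 : nrm (fun x => fsum e (decay_coef r) N x - fsum e c N x) <= r * Num.sqrt Q.
  have -> : (fun x => fsum e (decay_coef r) N x - fsum e c N x) = fsum e (fun k => decay_coef r k - c k) N.
    apply/funext => x; rewrite /fsum -sumrB; apply: eq_bigr => k _; ring.
  rewrite nrmE (dot_fsum_fsum rI rho_gt0 Le ONe).
  rewrite -[X in _ <= X * _]ger0_norm ?(ltW r0)// -sqrtr_sqr -sqrtrM ?sqr_ge0//; apply: ler_wsqrtr.
  rewrite mulr_sumr; apply: ler_sum => k _; rewrite -exprMn -[leLHS]real_normK ?num_real// -[leRHS]real_normK ?num_real//.
  apply: lerXn2r; rewrite ?nnegrE//.
  have E : decay_coef r k - c k = c k * (expR (- lam k * r) - 1) by rewrite /decay_coef; ring.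
  rewrite E !normrM mulrCA ler_wpM2l//.
  have := @exp_lip (- lam k) r ri; rewrite normrN => /le_trans; apply.
  by rewrite normr_id (ger0_norm (expR_ge0 _)) (ger0_norm (ltW r0)) [leRHS]mulrC.
have t1 := nrm_tri rI rho_gt0 Lu (Lc (decay_coef r) N) u0_L2.
have t2 := nrm_tri rI rho_gt0 (Lc (decay_coef r) N) (Lc c N) u0_L2.
have sym : nrm (fun x => fsum e c N x - u0 x) = nrm (fun x => u0 x - fsum e c N x).
  rewrite !nrmE /L2rho_dot; congr (Num.sqrt _); apply: eq_Rintegral => x _; ring.
have b1 : EE * eta = eps / 4 by rewrite /eta; field; rewrite gt_eqF.
have b2 : eta <= EE * eta by rewrite ler_peMl// ltW.
have b3 : r * Num.sqrt Q < eps / 4.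
  have s0' : 0 <= Num.sqrt Q by exact: sqrtr_ge0.
  have s1' : 0 < Num.sqrt Q + 1 by rewrite ltr_wpDl.
  apply: le_lt_trans (_ : r * (Num.sqrt Q + 1) < _); first by rewrite ler_wpM2l ?(ltW r0)// lerDl.
  by rewrite ltr_pdivlMr// -mulrA [_ * 4]mulrC -ltr_pdivlMr// mulr_gt0.
rewrite sym in t2; apply: le_lt_trans (le_trans t1 (lerD h1 (le_trans t2 (lerD (lexx _) h3)))) _.
by apply: quarters; [rewrite b1|exact: le_lt_trans h2 b3|rewrite -b1].
Qed.

Lemma sol_cont : continuous_in (L2rho rho) (L2rho_norm rho) `[0, T] sol.
Proof.
split; first by move=> t; rewrite /= in_itv /=; exact: sol_L2.
move=> t; rewrite /= in_itv /= => /andP[t0 tT]; apply/cvg_within_nbhsP => eps eps0.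
move: t0; rewrite le_eqVlt => /predU1P[<-|t0].
  have [d d0 Hd] := sol_cont0 eps0; exists d => // r; rewrite /= in_itv /= subr0 => ri rd.
  rewrite subr0 ger0_norm ?nrm_ge0//.
  have -> : sol r - sol 0 = (fun x => sol r x - u0 x) :> (R -> R) by apply/funext => x; rewrite /sol lexx.
  by apply: Hd => //; apply: le_lt_trans rd; exact: ler_norm.
have t20 : 0 < t / 2 by rewrite divr_gt0.
have [Kc [Kc0 H]] := flat_u_diff 0 t20.
have n0 := nu1_ge0.
have K1 : 0 < Kc * Num.sqrt (nu sg 1) + 1 by rewrite ltr_wpDl// mulr_ge0.
exists (Num.min (t / 2) (eps / (Kc * Num.sqrt (nu sg 1) + 1))); first by rewrite lt_min t20 divr_gt0.
move=> r; rewrite /= in_itv /= => /andP[r0 rT]; rewrite lt_min => /andP[rd re].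
have ti' : t / 2 <= t <= T by rewrite tT andbT; lra.
have ri' : t / 2 <= r <= T by rewrite (half_le_near t0 rd) rT.
have r0' : 0 < r by case/andP: ri' => ? _; lra.
rewrite subr0 ger0_norm ?nrm_ge0//.
have -> : sol r - sol t = (fun x => flat_u 0 r x - flat_u 0 t x) :> (R -> R).
  by apply/funext => x; rewrite (sol_pos t0) (sol_pos r0').
have [_ L] := L2_Lip rI rho_gt0 (sprim2_Lip0 rI (H t r ti' ri')).
apply: le_lt_trans L _; move: re; rewrite ltr_pdivlMr//; apply: le_lt_trans.
by rewrite mulrAC mulrDr mulr1 [leRHS]addrC [X in _ <= _ + X]mulrC lerDr.
Qed.

Lemma sol_pde t : 0 < t < T ->
  [/\ ae01 (fun x => D2 (sol t) x - rho x * flat_u 1 t x = 0),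
      alpha0 * sol t 0 + beta0 * D01 (sol t) 0 = 0 &
      alpha1 * sol t 1 + beta1 * D01 (sol t) 1 = h t].
Proof.
move=> /andP[t0 tT]; have ti : 0 < t <= T by rewrite t0 ltW.
rewrite (sol_pos t0); split.
- by apply: aefilterS (flat_u_D2 0 ti) => x H xi; rewrite H// subrr.
- by rewrite (flat_u_D01 0 ti (zero01 R)) flat_u_bc0.
- by rewrite (flat_u_D01 0 ti (one01 R)) flat_u_bc1// control_flat_sum.
Qed.

Lemma sol_solution : is_solution p rho alpha0 beta0 alpha1 beta1 T h u0 sol.
Proof.
split; first exact: sol_cont.
- by apply: nearW => x _; rewrite /sol lexx.
- exists (flat_u 1); split.
    split; [exact: (agrees_cont agrees_sol)|exact: (agrees_cont (@agrees_flat_u 1))|].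
    exact: (agrees_hd agrees_sol (@agrees_flat_u 1)).
  by move=> t; rewrite /= in_itv /=; exact: sol_pde.
Qed.

(** Uniqueness transfers everything known about the flat series to an
    arbitrary solution. *)
Lemma solution_agrees u : is_solution p rho alpha0 beta0 alpha1 beta1 T h u0 u -> agrees u 0.
Proof.
move=> S t x ti xi; have [t0 _] := andP ti; rewrite -(sol_pos t0).
exact: (solution_unique p_gt1 rho_Lp rho_gt0 ab0 ab1 eigen T_gt0 u0_L2 S sol_solution ti xi).
Qed.

Lemma y_cvg t : tau <= t <= T -> cvgn (series (y_term alpha0 beta0 lam e c t)).
Proof.
move=> ti; have [tau0 tauT] := andP tau_bounds; have [A HA] := coef_sum_bound.
have -> : y_term alpha0 beta0 lam e c t = free_term b lam 0 t.
  by apply/funext => n; rewrite y_termE.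
exact: (free_output_cvg lamlb HA tau0 ti).
Qed.

Lemma y_gevrey : gevreyR s tau T y.
Proof.
have [tau0 tauT] := andP tau_bounds.
have [M [r [M0 r0 Hc]]] := dy_chain tau0.
exists dy; split => //.
- by move=> k; apply/has_derivative_realP => t; rewrite /= in_itv /= => ti; exact: (Hc k t ti).1.
exists (M + 1), r; split => //; first exact: ltr_wpDl.
move=> k t; rewrite /= in_itv /= => ti; apply: le_trans (Hc k t ti).2 _.
by apply: gevrey_maj_le; rewrite // lerDl.
Qed.

Lemma agrees_L2_series u t : agrees u 0 -> ae01 (fun x => u 0 x = u0 x) -> L2rho rho (u 0) ->
  0 <= t <= tau -> L2rho_series rho (fun n => c n * expR (- lam n * t)) e (u t).
Proof.
move=> Hu u_0 L0 /andP[t0 tt]; have [tau0 tauT] := andP tau_bounds; rewrite /L2rho_series.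
move: t0; rewrite le_eqVlt => /predU1P[<-|t0].
  apply: cvg_trans u0_dec; apply: near_eq_cvg; apply: nearW => N.
  have [mc _] := L2_fsum rI rho_gt0 Le c N.
  have E : (fun x => u 0 x - \sum_(k < N) c k * expR (- lam k * 0) * e k x) =
    (fun x => u 0 x - fsum e c N x).
    apply/funext => x; congr (_ - _); apply: eq_bigr => k _.
    by rewrite mulr0 expR0 mulr1.
  rewrite E; apply: (nrm_aeext rI).
  - by apply: measurable_funB => //; case: u0_L2.
  - by apply: measurable_funB => //; case: L0.
  - by apply: aefilterS u_0 => x H xi; rewrite H.
have tt' : 0 < t <= tau by rewrite t0.
have ti : 0 < t <= T by rewrite t0 (le_trans tt)// ltW.
apply: cvg_trans (flat_u_fsum_cvg tt'); apply: near_eq_cvg; apply: nearW => N.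
by apply: nrm_ext => x /andP[x0 x1]; rewrite (Hu t x ti)// !ltW.
Qed.

Lemma agrees_eigen_series u t x : agrees u 0 -> 0 < t <= tau -> 0 <= x <= 1 ->
  series (fun n => c n * expR (- lam n * t) * e n x) @ \oo --> u t x.
Proof.
move=> Hu /andP[t0 tt] xi; have [_ tauT] := andP tau_bounds.
have ti : 0 < t <= T by rewrite t0 (le_trans tt)// ltW.
rewrite (Hu t x ti xi); have [D [_ HD]] := flat_u_expand t0.
have H N : `|flat_u 0 t x - series (fun n => c n * expR (- lam n * t) * e n x) N| <= coef_tail b lam N * D.
  by rewrite /series /= big_mkord; apply: HD => //; rewrite lexx.
apply/cvgrPdist_le => eps eps0.
have /cvgrPdist_le/(_ eps eps0) := coef_tailM_cvg D.
apply: filterS => N; rewrite sub0r normrN => HN; apply: le_trans (H N) _.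
by apply: le_trans HN; exact: ler_norm.
Qed.

Lemma agrees_flat_series u t x : agrees u 0 -> tau < t <= T -> 0 <= x <= 1 ->
  series (fun i => nderiv_within i `[tau, T] y t * g i x) @ \oo --> u t x.
Proof.
move=> Hu /andP[tt tT] xi; have [tau0 _] := andP tau_bounds.
have ti : 0 < t <= T by rewrite tT (lt_trans tau0).
have -> : (fun i => nderiv_within i `[tau, T] y t * g i x) = (fun i => dy (i + 0)%N t * g i x).
  by apply/funext => i; rewrite nderiv_dy ?addn0// (ltW tt).
rewrite (Hu t x ti xi).
by apply: (flat_sum_cv C0 ti) => i; case: (gen_le_maj i xi).
Qed.

Lemma flat_control_spec :
  [/\ forall t, tau <= t <= T ->
        cvgn (series (y_term alpha0 beta0 lam e c t)),
      gevreyR s tau T y,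
      forall t, tau < t <= T ->
        cvgn (series (h_term alpha1 beta1 tau T y g t)),
      gevreyR s 0 T h &
      (exists u, is_solution p rho alpha0 beta0 alpha1 beta1 T h u0 u) /\
      forall u, is_solution p rho alpha0 beta0 alpha1 beta1 T h u0 u ->
        [/\ forall x, 0 <= x <= 1 -> u T x = 0,
            (forall t, 0 <= t <= tau ->
              L2rho_series rho (fun n => c n * expR (- lam n * t)) e (u t)) /\
            (forall t x, 0 < t <= tau -> 0 <= x <= 1 ->
              series (fun n => c n * expR (- lam n * t) * e n x) @ \oo
                --> u t x),
            forall t x, tau < t <= T -> 0 <= x <= 1 ->
              series (fun i => nderiv_within i `[tau, T] y t * g i x) @ \oo
                --> u t x,
            continuous_in (L2rho rho) (L2rho_norm rho) `[0, T] u &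
            forall eps : R, 0 < eps < T ->
              gevrey (W2p p) (W2p_norm p) s eps T u]].
Proof.
split; [exact: y_cvg|exact: y_gevrey|exact: h_term_cvg|exact: h_gevrey|].
split; first by exists sol; exact: sol_solution.
move=> u S; have Hu := solution_agrees S; have [Cu u_0 _] := S.
have L0 : L2rho rho (u 0) by apply: (proj1 Cu); rewrite /= in_itv /= lexx ltW.
split => //.
- by move=> x xi; rewrite Hu ?flat_u_T// T_gt0 lexx.
- split; first by move=> t; exact: agrees_L2_series.
  by move=> t x; exact: agrees_eigen_series.
- by move=> t x; exact: agrees_flat_series.
- by move=> eps; exact: agrees_gevrey.
Qed.

End FlatOutput.

Theorem theorem2p9 (R : realType) (p : \bar R) (rho : R -> R) (T tau : R)
    (alpha0 beta0 alpha1 beta1 : R)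
    (lam : nat -> R) (e g : nat -> R -> R)
    (u0 : R -> R) (c : nat -> R) (s : R) (phi : R -> R)
    (p_gt1 : (1 < p)%E)
    (rho_Lp : Lp01 p rho)
    (rho_gt0 : ae01 (fun x => 0 < rho x))
    (T_gt0 : 0 < T)
    (tau_bounds : 0 < tau < T)
    (ab0_neq0 : (alpha0, beta0) != (0, 0))
    (ab1_neq0 : (alpha1, beta1) != (0, 0))
    (eigen : eigenbasis p rho alpha0 beta0 alpha1 beta1 lam e)
    (gen : generating_functions p rho alpha0 beta0 g)
    (u0_L2 : L2rho rho u0)
    (u0_dec : L2rho_series rho c e u0)
    (c_l2 : cvgn (series (fun n => `|c n| ^+ 2)))
    (s_gt1 : 1 < s)
    (s_lt : (s%:E < 2%:E - p^-1)%E)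
    (phi_gevrey : gevreyR s 0 (2 * T) phi)
    (phi1 : forall t, 0 <= t <= tau -> phi t = 1)
    (phi0 : forall t, T <= t <= 2 * T -> phi t = 0) :
  let y := flat_output alpha0 beta0 phi lam e c in
  let h := control alpha1 beta1 tau T y g in
  [/\ forall t, tau <= t <= T ->
        cvgn (series (y_term alpha0 beta0 lam e c t)),
      gevreyR s tau T y,
      forall t, tau < t <= T ->
        cvgn (series (h_term alpha1 beta1 tau T y g t)),
      gevreyR s 0 T h &
      (exists u, is_solution p rho alpha0 beta0 alpha1 beta1 T h u0 u) /\
      forall u, is_solution p rho alpha0 beta0 alpha1 beta1 T h u0 u ->
        [/\ forall x, 0 <= x <= 1 -> u T x = 0,
            (* at t = 0 the expansion holds in L^2_rho only *)
            (forall t, 0 <= t <= tau ->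
              L2rho_series rho (fun n => c n * expR (- lam n * t)) e (u t)) /\
            (forall t x, 0 < t <= tau -> 0 <= x <= 1 ->
              series (fun n => c n * expR (- lam n * t) * e n x) @ \oo
                --> u t x),
            forall t x, tau < t <= T -> 0 <= x <= 1 ->
              series (fun i => nderiv_within i `[tau, T] y t * g i x) @ \oo
                --> u t x,
            continuous_in (L2rho rho) (L2rho_norm rho) `[0, T] u &
            forall eps : R, 0 < eps < T ->
              gevrey (W2p p) (W2p_norm p) s eps T u]].
Proof.
have [dy [dy0 dy_chain dy_free dy_T]] := flat_output_chain p_gt1 rho_Lp rho_gt0 tau_bounds ab0_neq0 ab1_neq0
  eigen gen c_l2 s_gt1 phi_gevrey phi1 phi0.
have [C [K [C0 K0 Hg]]] := gen_sprim2_unif p_gt1 rho_Lp rho_gt0 gen.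
exact: (flat_control_spec p_gt1 rho_Lp rho_gt0 T_gt0 tau_bounds ab0_neq0 ab1_neq0 eigen gen
  u0_L2 u0_dec c_l2 s_gt1 s_lt dy0 dy_chain dy_free dy_T C0 K0 Hg).
Qed.
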